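(* Let $\mu_1,\mu_2\in\mathcal M_+$. There exist two uniquely determined functions $Z_1$ and $Z_2$ in the Krein class $\mathcal K$ such that $$Z_1(z)Z_2(z)=zK_{\mu_1}(Z_1(z))\quad\text{and}\quad K_{\mu_1}(Z_1(z))=K_{\mu_2}(Z_2(z)),\qquad z\in\mathbb C^+.$$
   Context: $\mathbb C^+$ is the open upper half-plane and $\mathbb R_+=[0,\infty)$. $\mathcal M_+$ is the set of Borel probability measures $\mu$ on $\mathbb R_+$ with $\mu(\{0\})<1$. For $\mu\in\mathcal M_+$ and $z\in\mathbb C\setminus\mathbb R_+$ put $\psi_\mu(z)=\int_{\mathbb R_+}\frac{z\xi}{1-z\xi}\,\mu(d\xi)$ and $K_\mu(z)=\psi_\mu(z)/(1+\psi_\mu(z))$. $\mathcal N$ (the Nevanlinna class) is the class of analytic functions $f:\mathbb C^+\to\mathbb C^+\cup\mathbb R$. The Krein class $\mathcal K$ is the class of $f\in\mathcal N$ that are analytic and nonpositive on the negative real axis (i.e. $f$ extends analytically across $(-\infty,0)$ with real nonpositive values there) and satisfy $f(-x)\to0$ as $x\to0$, $x>0$. The identities in the claim presuppose that the compositions are defined, i.e. $Z_j(z)\in\mathbb C\setminus\mathbb R_+$ for $z\in\mathbb C^+$ (this excludes only the zero function). *)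

(* Defs.v *)
From HB Require Import structures.
From mathcomp Require Import all_boot all_order all_algebra complex.
From mathcomp Require Import all_classical all_reals all_analysis.

Set Implicit Arguments.
Unset Strict Implicit.
Unset Printing Implicit Defensive.

Import Order.TTheory GRing.Theory Num.Theory.
Import numFieldNormedType.Exports.

Local Open Scope classical_set_scope.
Local Open Scope complex_scope.
Local Open Scope ring_scope.

Definition upper_half_plane (R : realType) : set R[i] :=
  [set z | 0 < complex.Im z].

Definition real_line (R : realType) : set R[i] := [set x%:C | x in [set: R]].

Definition nonneg_axis (R : realType) : set R[i] :=
  [set x%:C | x in [set x : R | 0 <= x]].

(* Locally the sum of a convergent power series. The topology of R[i] is the
   one induced by its modulus; MathComp-Analysis attaches it to the alias
   R[i]^o only, hence the casts. *)
Definition analytic_at (R : realType) (f : R[i] -> R[i]) (z : R[i]) : Prop :=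
  exists (a : nat -> R[i]) (r : R), 0 < r /\
    forall w : R[i], `|w - z| < r%:C ->
      series (fun n => a n * (w - z) ^+ n : R[i]^o) @ \oo --> (f w : R[i]^o).

(* Functions are total: only the values of f on the upper half-plane matter. *)
Definition nevanlinna (R : realType) (f : R[i] -> R[i]) : Prop :=
  forall z, upper_half_plane z ->
    analytic_at f z /\ (@upper_half_plane R `|` @real_line R) (f z).

(* g is the analytic extension of f across the negative real axis; it is
   determined by f at every point of C^+ and of (-oo, 0). *)
Definition krein (R : realType) (f : R[i] -> R[i]) : Prop :=
  nevanlinna f /\
  exists g : R[i] -> R[i],
    [/\ forall z, upper_half_plane z -> g z = f z,
        forall z, upper_half_plane z -> analytic_at g z,
        forall x : R, x < 0 -> analytic_at g x%:C,
        forall x : R, x < 0 -> exists2 y : R, g x%:C = y%:C & y <= 0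
      & (g (- x)%:C : R[i]^o) @[x --> (0 : R)^'+] --> (0 : R[i]^o)].

(* A Borel probability measure on [0, +oo[ is encoded as one on R that does
   not charge the negative half-line. *)
Definition Mplus (R : realType) (mu : probability (measurableTypeR R) R) :
    Prop :=
  mu [set x : R | x < 0] = 0%E /\ (mu [set 0%R] < 1)%E.

Definition cintegral (R : realType) (mu : probability (measurableTypeR R) R)
    (D : set R) (f : R -> R[i]) : R[i] :=
  (\int[mu]_(x in D) complex.Re (f x)) +i* (\int[mu]_(x in D) complex.Im (f x)).

Definition psi_transform (R : realType)
    (mu : probability (measurableTypeR R) R) (z : R[i]) : R[i] :=
  cintegral mu `[(0 : R), +oo[%classic (fun xi => z * xi%:C / (1 - z * xi%:C)).

Definition K_transform (R : realType)
    (mu : probability (measurableTypeR R) R) (z : R[i]) : R[i] :=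
  psi_transform mu z / (1 + psi_transform mu z).

(* psi_transform and K_transform are meaningful only off [0, +oo[, so a
   solution is required to avoid [0, +oo[ on C^+. *)
Definition subordination_pair (R : realType)
    (mu1 mu2 : probability (measurableTypeR R) R) (Z1 Z2 : R[i] -> R[i]) :
    Prop :=
  [/\ krein Z1, krein Z2 &
      forall z, upper_half_plane z ->
        [/\ ~ nonneg_axis (Z1 z), ~ nonneg_axis (Z2 z),
            Z1 z * Z2 z = z * K_transform mu1 (Z1 z)
          & K_transform mu1 (Z1 z) = K_transform mu2 (Z2 z)]].

(* Main.v *)
Require Import Defs.
From mathcomp Require Import all_boot all_order all_algebra complex.
From mathcomp Require Import all_classical all_reals all_analysis.
From mathcomp Require Import measurable_realfun.
From mathcomp Require Import ring lra.

(** Off the half-line [0, +oo[ write psi(w) = w p(w), where p(w) is the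
    integral of xi / (1 - w xi), and K(w) = w h(w), where h = p / (1 + w p).
    The two equations for (Z1, Z2) at z then become the symmetric system
      w2 = z h1(w1),   w1 = z h2(w2),
    which also makes sense for z on the negative half-line, where w1 and w2
    are then sought on that half-line ([solution]). Everything rests on one
    identity, h(w) = B(w) - w^* A(w) with real A >= 0 and B > 0 ([KratioE]): it
    says that on the upper half-plane Im h >= 0 and Im K > 0, and it turns the
    system into real linear algebra.

    Uniqueness. Cauchy-Schwarz gives the Schwarz-Pick inequality
    |h(w) - h(v)|^2 <= |w - v|^2 A(w) A(v) ([Kratio_SchwarzPick]), and at any
    solution |z|^2 A1(w1) A2(w2) < 1 ([solution_slopes_lt1]). So the map
    w1 |-> z h2(z h1(w1)) would bring two distinct solutions, which it fixes,
    strictly closer to each other ([solution_unique]).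

    Existence. On the negative half-line the functions s |-> s h(-s) increase
    from 0, and the intermediate value theorem provides a solution for some
    z = x0 < 0 ([solution_exists_negative]). From there solutions are continued
    along a segment to any other z ([solution_continues]). The parameters
    reached form an open set because the derivative of the system is invertible,
    again by |z|^2 A1 A2 < 1 ([local_solution]). They form a closed set because
    solutions stay in a compact part of the domain: each wj lies in the cone
    spanned by z and -1 ([sector_solution1]), in such a cone |h(w)| is comparable
    to h(-|w|) ([normc_Kratio_le], [normc_Kratio_ge]), and the monotonicity of
    h(-s) and s h(-s) then keeps |wj| between positive bounds
    ([solution_bounds]).

    Analyticity. [local_solution] comes from an implicit function theorem that
    produces power series ([implicit_system]); by uniqueness they coincide with
    the solution around each point, and on the negative half-line with its
    extension by reflection ([solution_analytic]). The power series is constructed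
    formally, as the fixed point of an operator contracting the X-adic distance,
    while a ball invariant for the norm sum |a_n| r^n of a polynomial yields its
    convergence ([adic_fixpoint]). Finally the monotonicity of s h(-s) forces
    the solution to tend to 0 with z on the negative half-line
    ([solution_small]). *)

Set Implicit Arguments.
Unset Strict Implicit.
Unset Printing Implicit Defensive.

Import Order.TTheory GRing.Theory Num.Theory.
Import numFieldNormedType.Exports.
Import Normc.

Local Open Scope classical_set_scope.
Local Open Scope complex_scope.
Local Open Scope ring_scope.

Local Notation Re := complex.Re.
Local Notation Im := complex.Im.

(** * Complex numbers and their limits *)

Section ComplexArithmetic.
Context {R : realType}.
Implicit Types x y z w : R[i].

Lemma complexP z w : Re z = Re w -> Im z = Im w -> z = w.
Proof. by case: z w => [a b] [c d] /= -> ->. Qed.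

Lemma ReD z w : Re (z + w) = Re z + Re w. Proof. by case: z w => [? ?] []. Qed.
Lemma ImD z w : Im (z + w) = Im z + Im w. Proof. by case: z w => [? ?] []. Qed.
Lemma ReN z : Re (- z) = - Re z. Proof. by case: z. Qed.
Lemma ImN z : Im (- z) = - Im z. Proof. by case: z. Qed.
Lemma ReM z w : Re (z * w) = Re z * Re w - Im z * Im w.
Proof. by case: z w => [? ?] []. Qed.
Lemma ImM z w : Im (z * w) = Re z * Im w + Im z * Re w.
Proof. by case: z w => [? ?] []. Qed.
Lemma Re_conj z : Re z^* = Re z. Proof. by case: z. Qed.
Lemma Im_conj z : Im z^* = - Im z. Proof. by case: z. Qed.
Lemma Re1 : Re (1 : R[i]) = 1. Proof. by []. Qed.
Lemma Im1 : Im (1 : R[i]) = 0. Proof. by []. Qed.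

Lemma Re_real (a : R) : Re a%:C = a. Proof. by []. Qed.
Lemma Im_real (a : R) : Im a%:C = 0. Proof. by []. Qed.

Definition ReIm_simp :=
  (ReD, ImD, ReN, ImN, ReM, ImM, Re_conj, Im_conj, Re1, Im1, Re_real, Im_real).

Lemma conjcM z w : (z * w)^* = z^* * w^*. Proof. exact: rmorphM. Qed.
Lemma conjcD z w : (z + w)^* = z^* + w^*. Proof. exact: rmorphD. Qed.
Lemma conjcV z : (z^-1)^* = (z^*)^-1. Proof. exact: conjc_inv. Qed.
Lemma conj1 : (1 : R[i])^* = 1. Proof. exact: conjc1. Qed.
Lemma conjK z : z^*^* = z. Proof. exact: conjcK. Qed.

Lemma normc_ge0 z : 0 <= normc z.
Proof. by case: z => a b; exact: sqrtr_ge0. Qed.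

Lemma normc_sqr z : normc z ^+ 2 = Re z ^+ 2 + Im z ^+ 2.
Proof. by case: z => a b; rewrite /= sqr_sqrtr// addr_ge0// sqr_ge0. Qed.

Lemma normc_real (a : R) : normc a%:C = `|a|.
Proof. by rewrite /= expr0n /= addr0 sqrtr_sqr. Qed.

Lemma normc_conj z : normc z^* = normc z.
Proof. by case: z => a b; rewrite /= sqrrN. Qed.

Lemma normcD z w : normc (z + w) <= normc z + normc w.
Proof. exact: (@le_normcD R z w). Qed.

Lemma normc_opp z : normc (- z) = normc z.
Proof. exact: (@normcN R z). Qed.

Lemma normc_distC z w : normc (z - w) = normc (w - z).
Proof. by rewrite -normc_opp opprB. Qed.

Lemma normcB z w : normc (z - w) <= normc z + normc w.
Proof. by rewrite -(normc_opp w) normcD. Qed.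

Lemma normc_subr z w : normc z - normc w <= normc (z - w).
Proof. by rewrite lerBlDr -{1}(subrK w z) normcD. Qed.

Lemma normcX z n : normc (z ^+ n) = normc z ^+ n.
Proof.
by elim: n => [|n IH]; rewrite ?expr0 ?normc1// !exprS normcM IH.
Qed.

Lemma normc_eq0 z : (normc z == 0) = (z == 0).
Proof. by apply/eqP/eqP => [/eq0_normc//|->]; exact: normc0. Qed.

Lemma normc_gt0 z : (0 < normc z) = (z != 0).
Proof. by rewrite lt_def normc_ge0 andbT normc_eq0. Qed.

Lemma normc_Re z : `|Re z| <= normc z.
Proof.
by rewrite -ler_sqr ?nnegrE ?normc_ge0// normc_sqr real_normK ?num_real// lerDl sqr_ge0.
Qed.

Lemma normc_Im z : `|Im z| <= normc z.
Proof.
by rewrite -ler_sqr ?nnegrE ?normc_ge0// normc_sqr real_normK ?num_real// lerDr sqr_ge0.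
Qed.

Lemma normc_le z : normc z <= `|Re z| + `|Im z|.
Proof.
rewrite -ler_sqr ?nnegrE ?normc_ge0 ?addr_ge0// normc_sqr sqrrD !real_normK ?num_real//.
by rewrite -addrA lerD2l lerDr mulrn_wge0 ?mulr_ge0.
Qed.

Lemma mulc_conj z : z * z^* = (normc z ^+ 2)%:C.
Proof.
by apply: complexP; rewrite !ReIm_simp ?normc_sqr /=; ring.
Qed.

(** Convergence in modulus, with real epsilons: R[i] itself has a partial
    order, and its topology is carried by the alias R[i]^o. *)
Definition tends (u : nat -> R[i]) (l : R[i]) : Prop :=
  forall e : R, 0 < e -> \forall n \near \oo, normc (l - u n) < e.

Lemma tendsP (u : nat -> R[i]) (l : R[i]) :
  tends u l <-> ((u : nat -> R[i]^o) @ \oo --> (l : R[i]^o)).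
Proof.
split=> [H|/cvgrPdist_lt H].
  apply/cvgrPdist_lt => e; rewrite ltcE /= => /andP[/eqP e0 e1].
  have /filterS := H _ e1; apply => n Hn.
  by rewrite ltcE /= e0 eqxx.
move=> e e0; have ec : (0 : R[i]) < e%:C by rewrite ltcR.
by have /filterS := H _ ec; apply => n; rewrite ltcR.
Qed.

Lemma tends_cst (l : R[i]) : tends (fun=> l) l.
Proof. by move=> e e0; apply: nearW => n; rewrite subrr normc0. Qed.

Lemma tendsD u v (l m : R[i]) :
  tends u l -> tends v m -> tends (fun n => u n + v n) (l + m).
Proof.
move=> ul vm e e0; have e2 : 0 < e / 2 by rewrite divr_gt0.
near=> n; rewrite opprD addrACA; apply: le_lt_trans (normcD _ _) _.
rewrite [e]splitr; apply: ltrD; near: n; [exact: ul | exact: vm].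
Unshelve. all: by end_near.
Qed.

Lemma tendsM u v (l m : R[i]) :
  tends u l -> tends v m -> tends (fun n => u n * v n) (l * m).
Proof.
move=> ul vm e e0; have l0 := normc_ge0 l; have m0 := normc_ge0 m.
have e1 : 0 < e / 2 / (normc m + 1) by rewrite !divr_gt0//; lra.
have e2 : 0 < e / 2 / (normc l + 1) by rewrite !divr_gt0//; lra.
near=> n.
have -> : l * m - u n * v n = (l - u n) * m + u n * (m - v n) by ring.
have h1 : normc (l - u n) < e / 2 / (normc m + 1) by near: n; exact: ul.
have h2 : normc (m - v n) < e / 2 / (normc l + 1) by near: n; exact: vm.
have h3 : normc (l - u n) < 1 by near: n; exact: ul.
have un : normc (u n) <= normc l + 1.
  by have := normc_subr (u n) l; rewrite normc_distC; lra.
apply: le_lt_trans (normcD _ _) _; rewrite !normcM [e]splitr.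
rewrite ltr_pdivlMr in h1; last lra.
rewrite ltr_pdivlMr in h2; last lra.
have n1 := normc_ge0 (l - u n); have n2 := normc_ge0 (m - v n).
have : normc (u n) * normc (m - v n) <= (normc l + 1) * normc (m - v n).
  by rewrite ler_wpM2r.
lra.
Unshelve. all: by end_near.
Qed.

Lemma tendsB u v (l m : R[i]) :
  tends u l -> tends v m -> tends (fun n => u n - v n) (l - m).
Proof.
move=> ul vm; have := tendsD ul (tendsM (tends_cst (-1)) vm).
rewrite mulN1r; congr tends.
by apply/funext => n; rewrite mulN1r.
Qed.

Lemma tends_unique u (l m : R[i]) : tends u l -> tends u m -> l = m.
Proof.
move=> ul um; apply/eqP; rewrite -subr_eq0 -normc_eq0; apply/negPn/negP => n0.
have d0 : 0 < normc (l - m) / 2 by rewrite divr_gt0// lt_def n0 normc_ge0.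
have [n [h1 h2]] : exists n, normc (l - u n) < normc (l - m) / 2 /\
    normc (m - u n) < normc (l - m) / 2.
  by apply: (@filter_ex _ \oo); apply: filterI; [exact: ul | exact: um].
have : normc (l - m) <= normc (l - u n) + normc (m - u n).
  by rewrite (normc_distC m); apply: le_trans (normcD _ _); rewrite addrA subrK.
lra.
Qed.

Lemma tends_normc_le u (l : R[i]) (M : R) :
  tends u l -> (forall n, normc (u n) <= M) -> normc l <= M.
Proof.
move=> ul uM; apply/ler_addgt0Pr => e e0.
have := ul _ e0 => -[N _ /(_ N (leqnn N))] /= h.
by have := normc_subr l (u N); have := uM N; lra.
Qed.

Lemma tends_shift u (l : R[i]) : tends u l -> tends (fun n => u n.+1) l.
Proof.
move=> ul e /ul [N _ h]; exists N => // n /= Nn; apply: h => /=.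
by rewrite (leq_trans Nn).
Qed.

Lemma tends_geometric_dist (u v : nat -> R[i]) (l : R[i]) (K : R) :
  tends u l -> (forall k, normc (u k - v k) <= K * 2^-1 ^+ k) -> tends v l.
Proof.
move=> ul uv e e0; have e2 : 0 < e / 2 by rewrite divr_gt0.
have half : `|2^-1 : R| < 1 by rewrite ger0_norm ?invr_ge0// invf_lt1// ltr1n.
have gc : (geometric K (2^-1 : R)) @ \oo --> (0 : R) by exact: cvg_geometric.
near=> k; rewrite -(subrK (u k) l) -addrA.
apply: le_lt_trans (normcD _ _) _; rewrite [e]splitr; apply: ltrD.
  by near: k; exact: ul.
apply: le_lt_trans (uv k) _.
have : `|0 - geometric K (2^-1 : R) k| < e / 2.
  by near: k; move/cvgrPdist_lt: gc; exact.
by rewrite sub0r normrN /=; apply: le_lt_trans; exact: ler_norm.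
Unshelve. all: by end_near.
Qed.

End ComplexArithmetic.

(* Simplification would otherwise expose the square root. *)
Local Arguments normc {R} x : simpl never.

(** * Expectation of bounded functions *)

Section RealExpectation.
Context {R : realType}.
Implicit Types (f g : R -> R).

Definition halfline : set R := `[(0 : R), +oo[%classic.

Lemma halflineP x : halfline x <-> 0 <= x.
Proof. by rewrite /halfline /= in_itv /= andbT. Qed.

Lemma measurable_halfline : measurable (halfline : set (measurableTypeR R)).
Proof. exact: measurable_itv. Qed.

Definition bounded_measurable f : Prop :=
  measurable_fun (halfline : set (measurableTypeR R)) f /\
  exists M, forall x, 0 <= x -> `|f x| <= M.

Lemma bmeas_cst r : bounded_measurable (fun=> r).
Proof. by split; [exact: measurable_cst | exists `|r|]. Qed.

Lemma bmeasD f g : bounded_measurable f -> bounded_measurable g ->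
  bounded_measurable (fun x => f x + g x).
Proof.
move=> [mf [M fM]] [mg [N gN]]; split; first exact: measurable_funD.
by exists (M + N) => x x0; rewrite (le_trans (ler_normD _ _))// lerD ?fM ?gN.
Qed.

Lemma bmeasM f g : bounded_measurable f -> bounded_measurable g ->
  bounded_measurable (fun x => f x * g x).
Proof.
move=> [mf [M fM]] [mg [N gN]]; split; first exact: measurable_funM.
by exists (M * N) => x x0; rewrite normrM ler_pM ?fM ?gN.
Qed.

Lemma bmeasN f : bounded_measurable f -> bounded_measurable (fun x => - f x).
Proof.
move=> [mf [M fM]]; split; first exact: measurable_funN.
by exists M => x x0; rewrite normrN fM.
Qed.

Lemma bmeasB f g : bounded_measurable f -> bounded_measurable g ->
  bounded_measurable (fun x => f x - g x).
Proof. by move=> hf hg; apply: bmeasD => //; exact: bmeasN. Qed.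

Context (mu : probability (measurableTypeR R) R).
Local Notation E f := (\int[mu]_(x in halfline) f x).

Lemma bmeas_integrable f : bounded_measurable f ->
  mu.-integrable halfline (EFin \o f).
Proof.
move=> [mf [M fM]]; apply: measurable_bounded_integrable => //.
- exact: measurable_halfline.
- by rewrite (le_lt_trans (probability_le1 _ _)) ?ltry//; exact: measurable_halfline.
- exists M; split; first exact: num_real.
  move=> N MN x /halflineP x0 /=; rewrite (le_trans (fM _ x0))//; exact: ltW.
Qed.

Lemma expectD f g : bounded_measurable f -> bounded_measurable g ->
  E (fun x => f x + g x) = E f + E g.
Proof.
move=> hf hg; apply: RintegralD; [exact: measurable_halfline | exact: bmeas_integrable..].
Qed.

Lemma expectB f g : bounded_measurable f -> bounded_measurable g ->
  E (fun x => f x - g x) = E f - E g.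
Proof.
move=> hf hg; apply: RintegralB; [exact: measurable_halfline | exact: bmeas_integrable..].
Qed.

Lemma expectZ r f : bounded_measurable f -> E (fun x => r * f x) = r * E f.
Proof.
move=> hf; apply: RintegralZl; [exact: measurable_halfline | exact: bmeas_integrable].
Qed.

Lemma expect_ge0 f : (forall x, 0 <= x -> 0 <= f x) -> 0 <= E f.
Proof. by move=> f0; apply: Rintegral_ge0 => x /halflineP; exact: f0. Qed.

Lemma expect_le f g : bounded_measurable f -> bounded_measurable g ->
  (forall x, 0 <= x -> f x <= g x) -> E f <= E g.
Proof.
move=> hf hg fg; apply: le_Rintegral => //; first exact: measurable_halfline.
- exact: bmeas_integrable.
- exact: bmeas_integrable.
- by move=> x /halflineP; exact: fg.
Qed.

Lemma eq_expect f g : (forall x, 0 <= x -> f x = g x) -> E f = E g.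
Proof. by move=> fg; apply: eq_Rintegral => x /set_mem /halflineP; exact: fg. Qed.

Hypothesis hmu : Mplus mu.

Lemma mu_halfline : mu halfline = 1%E.
Proof.
have m0 : measurable ([set x | x < 0] : set (measurableTypeR R)).
  by rewrite -set_itvNyo; exact: measurable_itv.
have -> : halfline = ~` [set x | x < 0].
  by apply/seteqP; split=> x /=; rewrite halflineP leNgt => /negP.
by rewrite probability_setC// hmu.1 sube0.
Qed.

Lemma expect_cst r : E (fun=> r) = r.
Proof.
transitivity (r * fine (mu halfline)); last by rewrite mu_halfline mulr1.
exact: (Rintegral_cst _ measurable_halfline).
Qed.

Lemma expect_norm_le f (M : R) : bounded_measurable f ->
  (forall x, 0 <= x -> `|f x| <= M) -> `|E f| <= M.
Proof.
move=> hf fM; rewrite ler_norml; apply/andP; split.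
  rewrite -(expect_cst (- M)); apply: expect_le => //; first exact: bmeas_cst.
  by move=> x /fM; rewrite ler_norml => /andP[].
rewrite -[leRHS](expect_cst M); apply: expect_le => //; first exact: bmeas_cst.
by move=> x /fM; rewrite ler_norml => /andP[].
Qed.

(** A function that is positive off 0 can have integral 0 only if all the mass
    is at 0, which [Mplus] forbids. *)
Lemma expect_gt0 f : bounded_measurable f -> (forall x, 0 <= x -> 0 <= f x) ->
  (forall x, 0 < x -> 0 < f x) -> 0 < E f.
Proof.
move=> hf f0 fp; rewrite lt_def expect_ge0// andbT; apply/negP => /eqP Ef.
have fi := bmeas_integrable hf.
have If : (\int[mu]_(x in halfline) `|(f x)%:E| = 0)%E.
  have -> : (\int[mu]_(x in halfline) `|(f x)%:E| =
             \int[mu]_(x in halfline) (f x)%:E)%E.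
    by apply: eq_integral => x /set_mem/halflineP x0; rewrite gee0_abs// lee_fin f0.
  rewrite -[LHS]fineK; last exact: (integrable_fin_num measurable_halfline fi).
  by rewrite -/(Rintegral _ _ _) Ef.
have mf : measurable_fun (halfline : set (measurableTypeR R)) (EFin \o f).
  by apply/measurable_EFinP; exact: hf.1.
have := (ae_eq_integral_abs mu measurable_halfline mf).1 If.
move=> [N [mN N0 sub]].
have pos : (`]0, +oo[%classic : set R) `<=` N.
  move=> x; rewrite /= in_itv /= andbT => x0; apply: sub => /= H.
  have /H [] : halfline x by apply/halflineP; exact: ltW.
  by move=> fx; have := fp x x0; rewrite fx ltxx.
have m0 : mu (`]0, +oo[%classic) = 0%E.
  by apply: (subset_measure0 _ mN pos N0); exact: measurable_itv.
have := mu_halfline.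
have -> : halfline = [set 0] `|` `]0, +oo[%classic.
  apply/seteqP; split=> x; rewrite halflineP /= in_itv /= andbT.
    by rewrite le_eqVlt eq_sym => /predU1P; tauto.
  by case=> [->|/ltW].
rewrite measureU//; last first.
  by apply/seteqP; split=> x //= [->]; rewrite in_itv /= ltxx.
move=> m1; have := hmu.2; suff -> : mu [set 0] = 1%E by rewrite ltxx.
by rewrite -m1 -[LHS]adde0; congr (_ + _)%E; exact: esym.
Qed.

End RealExpectation.

Section ComplexExpectation.
Context {R : realType}.
Implicit Types (f g : R -> R[i]).

Definition cbounded_measurable f : Prop :=
  bounded_measurable (fun x => Re (f x)) /\
  bounded_measurable (fun x => Im (f x)).

Lemma eq_bmeas (u v : R -> R) : u =1 v ->
  bounded_measurable u -> bounded_measurable v.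
Proof. by move=> /funext ->. Qed.

Lemma cbmeas_cst (c : R[i]) : cbounded_measurable (fun=> c).
Proof. by split; exact: bmeas_cst. Qed.

Lemma cbmeasD f g : cbounded_measurable f -> cbounded_measurable g ->
  cbounded_measurable (fun x => f x + g x).
Proof.
move=> [rf mf] [rg mg]; split.
  by apply: eq_bmeas (bmeasD rf rg) => x; rewrite ReD.
by apply: eq_bmeas (bmeasD mf mg) => x; rewrite ImD.
Qed.

Lemma cbmeasM f g : cbounded_measurable f -> cbounded_measurable g ->
  cbounded_measurable (fun x => f x * g x).
Proof.
move=> [rf mf] [rg mg]; split.
  by apply: eq_bmeas (bmeasB (bmeasM rf rg) (bmeasM mf mg)) => x; rewrite ReM.
by apply: eq_bmeas (bmeasD (bmeasM rf mg) (bmeasM mf rg)) => x; rewrite ImM.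
Qed.

Lemma cbmeas_conj f : cbounded_measurable f ->
  cbounded_measurable (fun x => (f x)^*).
Proof.
move=> [rf mf]; split; first by apply: eq_bmeas rf => x; rewrite Re_conj.
by apply: eq_bmeas (bmeasN mf) => x; rewrite Im_conj.
Qed.

Lemma cbmeasN f : cbounded_measurable f -> cbounded_measurable (fun x => - f x).
Proof.
move=> [rf mf]; split; first by apply: eq_bmeas (bmeasN rf) => x; rewrite ReN.
by apply: eq_bmeas (bmeasN mf) => x; rewrite ImN.
Qed.

Lemma cbmeasB f g : cbounded_measurable f -> cbounded_measurable g ->
  cbounded_measurable (fun x => f x - g x).
Proof. by move=> hf hg; apply: cbmeasD => //; exact: cbmeasN. Qed.

Lemma cbmeasX f n : cbounded_measurable f -> cbounded_measurable (fun x => f x ^+ n).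
Proof.
move=> hf; elim: n => [|n IH]; first exact: cbmeas_cst.
rewrite (_ : (fun x => _) = (fun x => f x * f x ^+ n)); first exact: cbmeasM.
by apply/funext => x; rewrite exprS.
Qed.

Lemma bmeas_normc_sqr f : cbounded_measurable f ->
  bounded_measurable (fun x => normc (f x) ^+ 2).
Proof.
move=> [rf mf]; apply: eq_bmeas (bmeasD (bmeasM rf rf) (bmeasM mf mf)) => x.
by rewrite normc_sqr !expr2.
Qed.

Context (mu : probability (measurableTypeR R) R) (hmu : Mplus mu).
Local Notation E u := (\int[mu]_(x in halfline) u x).
Local Notation CE f := (cintegral mu halfline f).

Lemma eq_cexpect f g : (forall x, 0 <= x -> f x = g x) -> CE f = CE g.
Proof. by move=> fg; apply: complexP; apply: eq_expect => x /fg ->. Qed.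

Lemma cexpectD f g : cbounded_measurable f -> cbounded_measurable g ->
  CE (fun x => f x + g x) = CE f + CE g.
Proof.
move=> [rf mf] [rg mg]; apply: complexP; rewrite ?ReIm_simp /=.
  by rewrite -expectD//; apply: eq_expect => x _; rewrite ReD.
by rewrite -expectD//; apply: eq_expect => x _; rewrite ImD.
Qed.

Lemma cexpectZ c f : cbounded_measurable f -> CE (fun x => c * f x) = c * CE f.
Proof.
move=> [rf mf]; have cm := bmeas_cst.
apply: complexP; rewrite ?ReIm_simp /= -!expectZ//.
  by rewrite -expectB; [|exact: bmeasM..]; apply: eq_expect => x _; rewrite ReM.
by rewrite -expectD; [|exact: bmeasM..]; apply: eq_expect => x _; rewrite ImM.
Qed.

Lemma cexpectN f : cbounded_measurable f -> CE (fun x => - f x) = - CE f.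
Proof.
move=> hf; rewrite -mulN1r -cexpectZ//; apply: eq_cexpect => x _.
by rewrite mulN1r.
Qed.

Lemma cexpectB f g : cbounded_measurable f -> cbounded_measurable g ->
  CE (fun x => f x - g x) = CE f - CE g.
Proof. by move=> hf hg; rewrite cexpectD ?cexpectN//; exact: cbmeasN. Qed.

Lemma cexpect_conj f : cbounded_measurable f -> CE (fun x => (f x)^*) = (CE f)^*.
Proof.
move=> [rf mf]; apply: complexP; rewrite ?ReIm_simp /=.
  by apply: eq_expect => x _; rewrite Re_conj.
rewrite -mulN1r -expectZ//; apply: eq_expect => x _.
by rewrite Im_conj mulN1r.
Qed.

Lemma cexpect_real (u : R -> R) : CE (fun x => (u x)%:C) = (E u)%:C.
Proof.
apply: complexP => //=; exact: (expect_cst hmu 0).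
Qed.

Lemma cexpect_cst c : CE (fun=> c) = c.
Proof. by apply: complexP; exact: (expect_cst hmu). Qed.

(** The factor 2 is the cost of bounding real and imaginary parts separately. *)
Lemma cexpect_norm_le f (M : R) : cbounded_measurable f ->
  (forall x, 0 <= x -> normc (f x) <= M) -> normc (CE f) <= 2 * M.
Proof.
move=> [rf mf] fM; rewrite (le_trans (normc_le _))// mulr_natl mulr2n lerD//=.
  by apply: expect_norm_le => // x /fM; exact: le_trans (normc_Re _).
by apply: expect_norm_le => // x /fM; exact: le_trans (normc_Im _).
Qed.

Lemma cexpect_norm_le_fun f (g : R -> R) :
  cbounded_measurable f -> bounded_measurable g ->
  (forall x, 0 <= x -> normc (f x) <= g x) -> normc (CE f) <= 2 * E g.
Proof.
have H (u : R -> R) : bounded_measurable u -> bounded_measurable g ->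
    (forall x, 0 <= x -> `|u x| <= g x) -> `|E u| <= E g.
  move=> hu hg ug; rewrite ler_norml -mulN1r -expectZ//; apply/andP; split.
    apply: expect_le => //; first by apply: bmeasM => //; exact: bmeas_cst.
    by move=> x /ug; rewrite ler_norml mulN1r => /andP[].
  by apply: expect_le => // x /ug; rewrite ler_norml => /andP[].
move=> [rf mf] hg fg; rewrite (le_trans (normc_le _))// mulr_natl mulr2n lerD//=.
  by apply: H => // x /fg; exact: le_trans (normc_Re _).
by apply: H => // x /fg; exact: le_trans (normc_Im _).
Qed.

(** The bound comes from s = 1 / d; if d = 0, the polynomial is affine in s, and
    nonnegative everywhere only if b = 0. The coefficients are those met when
    f - s c g is integrated in square, with c the integral of f g^*. *)
Lemma quadratic_discriminant (a b d : R) : 0 <= a -> 0 <= b -> 0 <= d ->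
  (forall s, 0 <= a - 2 * s * b + s ^+ 2 * b * d) -> b <= a * d.
Proof.
move=> a0 b0 d0 H; have [->|bn0] := eqVneq b 0; first exact: mulr_ge0.
have bp : 0 < b by rewrite lt_def bn0.
have [d0'|dn0] := eqVneq d 0.
  have := H ((a + 1) / (2 * b)).
  have -> : 2 * ((a + 1) / (2 * b)) * b = a + 1 by field; lra.
  by rewrite d0' mulr0 addr0; lra.
have dp : 0 < d by rewrite lt_def dn0.
have := H d^-1; have -> : a - 2 * d^-1 * b + d^-1 ^+ 2 * b * d = (a * d - b) / d.
  by field.
by rewrite pmulr_lge0 ?invr_gt0// subr_ge0.
Qed.

Lemma cexpect_CauchySchwarz f g :
  cbounded_measurable f -> cbounded_measurable g ->
  normc (CE (fun x => f x * (g x)^*)) ^+ 2 <=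
  E (fun x => normc (f x) ^+ 2) * E (fun x => normc (g x) ^+ 2).
Proof.
move=> hf hg; set c := CE _.
have nf := bmeas_normc_sqr hf; have ng := bmeas_normc_sqr hg.
have hfg : cbounded_measurable (fun x => f x * (g x)^*).
  by apply: cbmeasM => //; exact: cbmeas_conj.
apply: quadratic_discriminant.
- by apply: expect_ge0 => x _; exact: sqr_ge0.
- exact: sqr_ge0.
- by apply: expect_ge0 => x _; exact: sqr_ge0.
move=> s.
set u := fun x => Re (c^* * (f x * (g x)^*)).
have hu : bounded_measurable u by exact: (cbmeasM (cbmeas_cst _) hfg).1.
have Eu : E u = normc c ^+ 2.
  have : CE (fun x => c^* * (f x * (g x)^*)) = (normc c ^+ 2)%:C.
    by rewrite cexpectZ// -/c mulrC mulc_conj.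
  by move=> /(congr1 (@complex.Re _)).
have cm := bmeas_cst; have h1 := bmeasM (cm _ (2 * s)) hu.
have h2 := bmeasM (cm _ (s ^+ 2 * normc c ^+ 2)) ng.
rewrite -Eu -expectZ// Eu -expectZ// -expectB// -expectD//; last exact: bmeasB.
apply: expect_ge0 => x _.
suff -> : normc (f x) ^+ 2 - 2 * s * u x +
    s ^+ 2 * normc c ^+ 2 * normc (g x) ^+ 2 =
    normc (f x - s%:C * c * g x) ^+ 2 by exact: sqr_ge0.
by rewrite !normc_sqr /u !ReIm_simp /=; ring.
Qed.

(** Cauchy-Schwarz for f and g^* minus their means. *)
Lemma covariance_le f g : cbounded_measurable f -> cbounded_measurable g ->
  normc (CE (fun x => f x * g x) - CE f * CE g) ^+ 2 <=
  (E (fun x => normc (f x) ^+ 2) - normc (CE f) ^+ 2) *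
  (E (fun x => normc (g x) ^+ 2) - normc (CE g) ^+ 2).
Proof.
have variance h : cbounded_measurable h ->
    E (fun x => normc (h x - CE h) ^+ 2) =
    E (fun x => normc (h x) ^+ 2) - normc (CE h) ^+ 2.
  move=> hh; set c := CE h.
  have hu : cbounded_measurable (fun x => c^* * h x).
    by apply: cbmeasM => //; exact: cbmeas_cst.
  have Eu : E (fun x => Re (c^* * h x)) = normc c ^+ 2.
    have : CE (fun x => c^* * h x) = (normc c ^+ 2)%:C.
      by rewrite cexpectZ// -/c mulrC mulc_conj.
    by move=> /(congr1 (@complex.Re _)).
  have nh := bmeas_normc_sqr hh; have h2 := bmeasM (bmeas_cst 2) hu.1.
  transitivity (E (fun x => normc (h x) ^+ 2 - 2 * Re (c^* * h x) + normc c ^+ 2)).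
    by apply: eq_expect => x _; rewrite !normc_sqr !ReIm_simp /=; ring.
  have Eu2 : E (fun x => 2 * Re (c^* * h x)) = 2 * normc c ^+ 2.
    by rewrite -Eu; exact: (expectZ _ _ hu.1).
  rewrite expectD ?expectB// ?Eu2 ?(expect_cst hmu).
  - by ring.
  - exact: bmeasB.
  - exact: bmeas_cst.
move=> hf hg; rewrite -!variance//; set a := CE f; set b := CE g.
have hfa : cbounded_measurable (fun x => f x - a).
  by apply: cbmeasB => //; exact: cbmeas_cst.
have hgb : cbounded_measurable (fun x => g x - b).
  by apply: cbmeasB => //; exact: cbmeas_cst.
have := cexpect_CauchySchwarz hfa (cbmeas_conj hgb).
have -> : E (fun x => normc (g x - b)^* ^+ 2) = E (fun x => normc (g x - b) ^+ 2).
  by apply: eq_expect => x _; rewrite normc_conj.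
congr (normc _ ^+ 2 <= _).
have hfg := cbmeasM hf hg.
have hag : cbounded_measurable (fun x => a * g x).
  by apply: cbmeasM => //; exact: cbmeas_cst.
have hbf : cbounded_measurable (fun x => b * f x).
  by apply: cbmeasM => //; exact: cbmeas_cst.
transitivity (CE (fun x => f x * g x - a * g x - b * f x + a * b)).
  by apply: eq_cexpect => x _; apply: complexP; rewrite !ReIm_simp; ring.
have cab := cbmeas_cst (a * b).
rewrite cexpectD ?cexpectB ?cexpectZ ?cexpect_cst -/a -/b//; try exact: cbmeas_cst.
- by ring.
- exact: cbmeasB.
- by apply: cbmeasB => //; exact: cbmeasB.
Qed.

End ComplexExpectation.

(** * The kernel xi / (1 - w xi) *)

Section Kernel.
Context {R : realType}.
Implicit Types (w : R[i]) (xi C : R).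

(** The complement of [0, +oo[, as a boolean. *)
Definition slit w : bool := (Im w != 0) || (Re w < 0).

Lemma slitP w : slit w <-> ~ nonneg_axis w.
Proof.
rewrite /slit; split=> [|H].
  by move=> + [x x0 xw]; rewrite -xw /= eqxx ltNge x0.
case: (eqVneq (Im w) 0) => //= w0; rewrite ltNge; apply/negP => r0.
by apply: H; exists (Re w) => //; apply: complexP.
Qed.

Definition kernel w xi : R[i] := xi%:C / (1 - w * xi%:C).

(** A number lies off the half-line iff xi |-> |1 - w xi| dominates a multiple
    of xi, that is iff the kernel at that number is bounded. *)
Definition kernel_bound w C : Prop :=
  0 < C /\ forall xi, 0 <= xi -> xi <= C * normc (1 - w * xi%:C).

Lemma kernel_bound_slit w C : kernel_bound w C -> slit w.
Proof.
move=> [C0 H]; apply/slitP => -[x /= x0 xw].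
have [xe|xn] := eqVneq x 0.
  have := H (C + 1); rewrite -xw xe mul0r subr0 normc1; lra.
have xp : 0 < x by rewrite lt_def xn.
have := H x^-1; rewrite invr_ge0 x0 => /(_ erefl).
rewrite -xw -rmorphM /= mulfV// subrr normc0 mulr0.
by rewrite leNgt invr_gt0 xp.
Qed.

Lemma slit_kernel_bound w : slit w -> exists C, kernel_bound w C.
Proof.
move=> /orP[b0|a0].
  exists (`|Im w|^-1); split; first by rewrite invr_gt0 normr_gt0.
  move=> xi xi0; rewrite mulrC ler_pdivlMr ?normr_gt0//.
  apply: le_trans (normc_Im _).
  have -> : Im (1 - w * xi%:C) = - (xi * Im w) by rewrite !ReIm_simp /=; ring.
  by rewrite normrN normrM (ger0_norm xi0).
exists (- Re w)^-1; split; first by rewrite invr_gt0 oppr_gt0.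
move=> xi xi0; rewrite mulrC ler_pdivlMr ?oppr_gt0//.
apply: le_trans (normc_Re _); apply: le_trans (ler_norm _).
have -> : Re (1 - w * xi%:C) = 1 - xi * Re w by rewrite !ReIm_simp /=; ring.
lra.
Qed.

Lemma kernel_bound_near w w' C : kernel_bound w C ->
  normc (w' - w) * (2 * C) <= 1 -> kernel_bound w' (2 * C).
Proof.
move=> [C0 H] d; split=> [|xi xi0]; first by lra.
have h1 := H _ xi0.
have : normc (1 - w * xi%:C) <= normc (1 - w' * xi%:C) + normc (w' - w) * xi.
  rewrite -{3}(ger0_norm xi0) -normc_real -normcM.
  by apply: le_trans (normcD _ _); rewrite mulrBl addrA subrK.
set n := normc (1 - _) in h1 *; set n' := normc (1 - _); set e := normc _.
move=> h2; have : C * n <= C * (n' + e * xi) by rewrite ler_pM2l.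
have : e * (2 * C) * xi <= 1 * xi by rewrite ler_wpM2r.
lra.
Qed.

Lemma slit_den_neq0 w xi : slit w -> 0 <= xi -> 1 - w * xi%:C != 0.
Proof.
move=> /slit_kernel_bound [C [C0 H]] xi0; rewrite -normc_gt0.
have [->|xn] := eqVneq xi 0; first by rewrite mulr0 subr0 normc1.
have xp : 0 < xi by rewrite lt_def xn.
have := lt_le_trans xp (H _ xi0); by rewrite pmulr_rgt0.
Qed.

Lemma kernel_le w C xi : kernel_bound w C -> 0 <= xi -> normc (kernel w xi) <= C.
Proof.
move=> kC xi0; have n0 := slit_den_neq0 (kernel_bound_slit kC) xi0.
rewrite /kernel normcM normcV normc_real (ger0_norm xi0) ler_pdivrMr ?normc_gt0//.
exact: kC.2.
Qed.

Lemma kernel_normc_sqr w xi :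
  normc (kernel w xi) ^+ 2 = xi ^+ 2 / normc (1 - w * xi%:C) ^+ 2.
Proof. by rewrite /kernel normcM normcV normc_real exprMn real_normK ?num_real// exprVn. Qed.

Lemma invc_conj (z : R[i]) : z != 0 -> z^-1 = z^* * ((normc z ^+ 2)^-1)%:C.
Proof.
move=> z0; apply: (mulfI z0); rewrite divff// mulrA mulc_conj -rmorphM /=.
by rewrite mulfV ?rmorph1// expf_neq0// normc_eq0.
Qed.

Lemma kernelE w xi : slit w -> 0 <= xi ->
  kernel w xi = xi%:C * (1 - w^* * xi%:C) * ((normc (1 - w * xi%:C) ^+ 2)^-1)%:C.
Proof.
move=> sw xi0; rewrite /kernel invc_conj ?slit_den_neq0// mulrA.
congr (_ * _ * _).
by apply: complexP; rewrite !ReIm_simp /=; ring.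
Qed.

Lemma cbmeas_kernel w : slit w -> cbounded_measurable (kernel w).
Proof.
move=> sw; have [C kC] := slit_kernel_bound sw.
set N : R -> R := fun xi => normc (1 - w * xi%:C) ^+ 2.
have NE : N = fun xi => (1 - Re w * xi) ^+ 2 + (Im w * xi) ^+ 2.
  by apply/funext => xi; rewrite /N normc_sqr !ReIm_simp /=; ring.
have mid : measurable_fun (halfline : set (measurableTypeR R)) (fun x : R => x).
  exact: measurable_id.
have mN : measurable_fun (halfline : set (measurableTypeR R)) N.
  rewrite NE; apply: measurable_funD; apply: measurable_funX.
    by apply: measurable_funB => //; apply: measurable_funM.
  by apply: measurable_funM.
have mV : measurable_fun (halfline : set (measurableTypeR R)) (fun xi => (N xi)^-1).
  apply: (@measurable_comp _ _ _ (measurableTypeR R) (measurableTypeR R)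
    (measurableTypeR R) `]0, +oo[%classic (fun y : R => y^-1) halfline N) => //.
  - move=> _ [xi /halflineP xi0 <-] /=; rewrite in_itv /= andbT /N.
    by rewrite exprn_gt0// normc_gt0 slit_den_neq0.
  - apply: open_continuous_measurable_fun; first exact: interval_open.
    move=> x /set_mem /=; rewrite in_itv /= andbT => x0.
    by apply: inv_continuous; rewrite gt_eqF.
have bnd (f : R -> R) : measurable_fun (halfline : set (measurableTypeR R)) f ->
    (forall xi, 0 <= xi -> `|f xi| <= normc (kernel w xi)) ->
    bounded_measurable f.
  move=> mf fk; split=> //; exists C => xi xi0.
  by rewrite (le_trans (fk _ xi0))// kernel_le.
split; apply: bnd => [|xi _]; rewrite ?normc_Re ?normc_Im//.
  apply: (eq_measurable_fun (fun xi => xi * (1 - Re w * xi) * (N xi)^-1)).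
    move=> xi /set_mem /halflineP xi0; rewrite kernelE//.
    by rewrite !ReIm_simp /= /N; ring.
  apply: measurable_funM => //; apply: measurable_funM => //.
  by apply: measurable_funB => //; apply: measurable_funM.
apply: (eq_measurable_fun (fun xi => xi * (Im w * xi) * (N xi)^-1)).
  move=> xi /set_mem /halflineP xi0; rewrite kernelE//.
  by rewrite !ReIm_simp /= /N; ring.
by do 3 apply: measurable_funM => //.
Qed.

End Kernel.

(** * The function h(w) = K(w) / w *)

Section KRatio.
Context {R : realType} (mu : probability (measurableTypeR R) R).
Implicit Types (w v : R[i]) (xi C : R).
Local Notation E u := (\int[mu]_(x in halfline) u x).
Local Notation CE f := (cintegral mu halfline f).

(** In the notation p, q, h of the introduction, [kmean] is p, [kden] is
    q = 1 + w p, and [Kratio] is h. The real numbers [slopeA] and [slopeB] are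
    the coefficients of h = B - w^* A; the former is the variance of the kernel
    divided by |q|^2, and bounds the derivative of h. *)
Definition kmean w : R[i] := CE (kernel w).
Definition kden w : R[i] := 1 + w * kmean w.
Definition Kratio w : R[i] := kmean w / kden w.
Definition ksqmean w : R := E (fun xi => normc (kernel w xi) ^+ 2).
Definition slopeA w : R := (ksqmean w - normc (kmean w) ^+ 2) / normc (kden w) ^+ 2.
Definition slopeB w : R := (Re (kmean w) + Re w * ksqmean w) / normc (kden w) ^+ 2.

Hypothesis hmu : Mplus mu.

Lemma psi_transformE w : slit w -> psi_transform mu w = w * kmean w.
Proof.
move=> sw; rewrite /psi_transform -cexpectZ//; last exact: cbmeas_kernel.
by apply: eq_cexpect => xi _; rewrite /kernel mulrA.
Qed.

Lemma K_transformE w : slit w -> K_transform mu w = w * Kratio w.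
Proof. by move=> sw; rewrite /K_transform psi_transformE// /Kratio mulrA. Qed.

Lemma kernel_conj w xi : (kernel w xi)^* = kernel w^* xi.
Proof.
rewrite /kernel conjcM conjcV; congr (_ / _); first exact: conjc_real.
by apply: complexP; rewrite !ReIm_simp /=; ring.
Qed.

Lemma kmean_conj w : slit w -> kmean w^* = (kmean w)^*.
Proof.
move=> sw; rewrite /kmean -cexpect_conj; last exact: cbmeas_kernel.
by apply: eq_cexpect => xi _; rewrite kernel_conj.
Qed.

Lemma Kratio_conj w : slit w -> Kratio w^* = (Kratio w)^*.
Proof.
move=> sw; rewrite /Kratio /kden kmean_conj// conjcM conjcV conjcD conjcM.
by rewrite conj1.
Qed.

Lemma kernel_sub w v xi : slit w -> slit v -> 0 <= xi ->
  kernel w xi - kernel v xi = (w - v) * (kernel w xi * kernel v xi).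
Proof.
move=> sw sv xi0; have := slit_den_neq0 sw xi0; have := slit_den_neq0 sv xi0.
by rewrite /kernel => h1 h2; field; rewrite h1 h2.
Qed.

Definition kcorr w v : R[i] := CE (fun xi => kernel w xi * kernel v xi).

(** The resolvent identity, integrated. *)
Lemma kmean_sub w v : slit w -> slit v ->
  kmean w - kmean v = (w - v) * kcorr w v.
Proof.
move=> sw sv; have hw := cbmeas_kernel sw; have hv := cbmeas_kernel sv.
rewrite -cexpectB// -cexpectZ; last exact: cbmeasM.
by apply: eq_cexpect => xi xi0; rewrite kernel_sub.
Qed.

Lemma Im_kmean w : slit w -> Im (kmean w) = Im w * ksqmean w.
Proof.
move=> sw; rewrite /ksqmean -expectZ; last first.
  by apply: bmeas_normc_sqr; exact: cbmeas_kernel.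
apply: eq_expect => xi xi0; rewrite kernel_normc_sqr kernelE//.
by rewrite !ReIm_simp /=; ring.
Qed.

(** The left summands integrate to the mean of xi / |1 - w xi|^2. *)
Lemma slopeB_num_gt0 w : slit w -> 0 < Re (kmean w) + Re w * ksqmean w.
Proof.
move=> sw; have hk := cbmeas_kernel sw; have hs := bmeas_normc_sqr hk.
have hc := bmeasM (bmeas_cst (Re w)) hs.
rewrite /ksqmean -expectZ// -expectD//; last exact: hk.1.
have ke xi : 0 <= xi ->
    Re (kernel w xi) + Re w * normc (kernel w xi) ^+ 2 =
    xi / normc (1 - w * xi%:C) ^+ 2.
  move=> xi0; rewrite kernel_normc_sqr kernelE//.
  by rewrite !ReIm_simp /=; ring.
apply: expect_gt0 => //; first by apply: bmeasD => //; exact: hk.1.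
  by move=> xi xi0; rewrite ke// divr_ge0// sqr_ge0.
move=> xi xi0; rewrite ke ?ltW// divr_gt0// exprn_gt0// normc_gt0.
by rewrite slit_den_neq0// ltW.
Qed.

(** Im q is Im w times a positive number; when Im w = 0, so that w < 0, the
    number q is the integral of the positive function 1 / (1 - w xi). *)
Lemma kden_neq0 w : slit w -> kden w != 0.
Proof.
move=> sw; have B0 := slopeB_num_gt0 sw; apply/eqP => q0.
have ImE : Im (kden w) = Im w * (Re (kmean w) + Re w * ksqmean w).
  by rewrite /kden !ReIm_simp Im_kmean//; ring.
have b0 : Im w = 0.
  by move: ImE; rewrite q0 /= => /esym/eqP; rewrite mulf_eq0 (gt_eqF B0) orbF => /eqP.
have a0 : Re w < 0 by move: sw; rewrite /slit b0 eqxx.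
have : Re (kden w) = E (fun xi => 1 + Re w * Re (kernel w xi)).
  rewrite expectD ?expectZ ?(expect_cst hmu) ?(cbmeas_kernel sw).1//.
  - by rewrite /kden !ReIm_simp b0 mul0r subr0.
  - exact: (cbmeas_kernel sw).1.
  - exact: bmeas_cst.
  - by apply: bmeasM; [exact: bmeas_cst | exact: (cbmeas_kernel sw).1].
rewrite q0 /= => /eqP; apply/negP; rewrite lt_eqF//.
have we : w = (Re w)%:C by apply: complexP.
have ke xi : 0 <= xi -> 1 + Re w * Re (kernel w xi) = (1 - Re w * xi)^-1.
  move=> xi0; have h : 1 - Re w * xi != 0 by rewrite gt_eqF//; nra.
  have -> : kernel w xi = (xi / (1 - Re w * xi))%:C.
    by rewrite /kernel {1}we rmorphM fmorphV rmorphB rmorph1 rmorphM.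
  by rewrite /=; field.
apply: expect_gt0 => //.
- apply: bmeasD; first exact: bmeas_cst.
  by apply: bmeasM; [exact: bmeas_cst | exact: (cbmeas_kernel sw).1].
- by move=> xi xi0; rewrite ke// invr_ge0; nra.
- by move=> xi xi0; rewrite ke ?ltW// invr_gt0; nra.
Qed.

Lemma normc_kden_gt0 w : slit w -> 0 < normc (kden w).
Proof. by move=> /kden_neq0; rewrite normc_gt0. Qed.

Lemma slopeB_gt0 w : slit w -> 0 < slopeB w.
Proof.
by move=> sw; rewrite divr_gt0 ?slopeB_num_gt0// exprn_gt0// normc_kden_gt0.
Qed.

(** A variance is nonnegative: Cauchy-Schwarz against the constant 1. *)
Lemma slopeA_ge0 w : slit w -> 0 <= slopeA w.
Proof.
move=> sw; rewrite divr_ge0 ?sqr_ge0// subr_ge0.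
have := cexpect_CauchySchwarz mu (cbmeas_kernel sw) (cbmeas_cst 1).
have -> : E (fun x : R => normc (1 : R[i]) ^+ 2) = 1.
  by rewrite normc1 expr1n; exact: expect_cst.
rewrite mulr1; congr (normc _ ^+ 2 <= _).
by apply: eq_cexpect => xi _; rewrite conj1 mulr1.
Qed.

(** This identity contains both Pick properties, Im h = A Im w and
    Im K = B Im w, the latter since K(w) = w B - |w|^2 A. *)
Lemma KratioE w : slit w -> Kratio w = (slopeB w)%:C - w^* * (slopeA w)%:C.
Proof.
move=> sw; have q0 := kden_neq0 sw.
rewrite /Kratio invc_conj// /slopeA /slopeB; set n := (normc (kden w) ^+ 2)^-1.
have Ip := Im_kmean sw; have np := normc_sqr (kmean w).
rewrite /kden; move: (kmean w) (ksqmean w) Ip np => p m Ip np.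
by apply: complexP; rewrite !ReIm_simp ?np ?Ip; ring.
Qed.

Lemma Kratio_sub w v : slit w -> slit v ->
  Kratio w - Kratio v =
  (w - v) * (kcorr w v - kmean w * kmean v) / (kden w * kden v).
Proof.
move=> sw sv; have := kden_neq0 sw; have := kden_neq0 sv.
have := kmean_sub sw sv; rewrite /Kratio.
rewrite mulrBr => <-; rewrite /kden => h1 h2.
by field; rewrite h1 h2.
Qed.

Lemma kcovariance_le w v : slit w -> slit v ->
  normc ((kcorr w v - kmean w * kmean v) / (kden w * kden v)) ^+ 2 <=
  slopeA w * slopeA v.
Proof.
move=> sw sv; rewrite normcM normcV normcM exprMn exprVn exprMn.
rewrite /slopeA [leRHS]mulrACA -[X in _ <= _ * X]invfM.
apply: ler_wpM2r; first by rewrite invr_ge0 mulr_ge0 ?sqr_ge0.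
exact: (covariance_le hmu (cbmeas_kernel sw) (cbmeas_kernel sv)).
Qed.

(** The Schwarz-Pick inequality for h, from Cauchy-Schwarz. *)
Lemma Kratio_SchwarzPick w v : slit w -> slit v ->
  normc (Kratio w - Kratio v) ^+ 2 <=
  normc (w - v) ^+ 2 * (slopeA w * slopeA v).
Proof.
move=> sw sv; rewrite Kratio_sub// -mulrA normcM exprMn.
by rewrite ler_wpM2l ?sqr_ge0// kcovariance_le.
Qed.

(** The Taylor coefficients of [kmean] at w: the kernel expands as a geometric
    series, kernel (w + x) = kernel w / (1 - x kernel w). *)
Definition kcoef w (n : nat) : R[i] := CE (fun xi => kernel w xi ^+ n.+1).

Lemma kcoef0 w : kcoef w 0 = kmean w.
Proof. by apply: eq_cexpect => xi _; rewrite expr1. Qed.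

Lemma kcoef1 w : kcoef w 1 = kcorr w w.
Proof. by apply: eq_cexpect => xi _; rewrite expr2. Qed.

Lemma kcoef_le w C n : kernel_bound w C -> normc (kcoef w n) <= 2 * C ^+ n.+1.
Proof.
move=> kC; have sw := kernel_bound_slit kC; apply: cexpect_norm_le => //.
  by apply: cbmeasX; exact: cbmeas_kernel.
move=> xi xi0; rewrite normcX lerXn2r ?nnegrE ?normc_ge0 ?kernel_le//.
exact: ltW kC.1.
Qed.

Lemma kernel_taylor w x N xi : slit w -> slit (w + x) -> 0 <= xi ->
  kernel (w + x) xi = \sum_(n < N) x ^+ n * kernel w xi ^+ n.+1 +
    x ^+ N * (kernel w xi ^+ N * kernel (w + x) xi).
Proof.
move=> sw sx xi0; elim: N => [|N IH]; first by rewrite big_ord0 !expr0 !mul1r add0r.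
rewrite big_ord_recr /= {1}IH -addrA; congr (_ + _).
have H : kernel (w + x) xi =
    kernel w xi + x * (kernel (w + x) xi * kernel w xi).
  have := kernel_sub sx sw xi0; have -> : w + x - w = x by ring.
  by move=> <-; ring.
by rewrite {1}H !exprS; ring.
Qed.

Lemma kmean_taylor w C x N : kernel_bound w C -> kernel_bound (w + x) (2 * C) ->
  normc (kmean (w + x) - \sum_(n < N) x ^+ n * kcoef w n) <=
  4 * C * (normc x * C) ^+ N.
Proof.
move=> kC kC2; have sw := kernel_bound_slit kC; have sx := kernel_bound_slit kC2.
have hw := cbmeas_kernel sw; have hx := cbmeas_kernel sx; have C0 := kC.1.
have hrem : cbounded_measurable
    (fun xi => x ^+ N * (kernel w xi ^+ N * kernel (w + x) xi)).
  by apply: cbmeasM (cbmeas_cst _) (cbmeasM _ hx); exact: cbmeasX.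
have hterm n : cbounded_measurable (fun xi => x ^+ n * kernel w xi ^+ n.+1).
  by apply: cbmeasM (cbmeas_cst _) _; exact: cbmeasX.
have hsum M : cbounded_measurable
      (fun xi => \sum_(n < M) x ^+ n * kernel w xi ^+ n.+1) /\
    CE (fun xi => \sum_(n < M) x ^+ n * kernel w xi ^+ n.+1) =
      \sum_(n < M) x ^+ n * kcoef w n.
  elim: M => [|M [IH1 IH2]].
    rewrite big_ord0; have -> : (fun xi => \sum_(n < 0) x ^+ n * kernel w xi ^+ n.+1)
      = fun=> 0 by apply/funext => xi; rewrite big_ord0.
    by split; [exact: cbmeas_cst | exact: cexpect_cst].
  have -> : (fun xi => \sum_(n < M.+1) x ^+ n * kernel w xi ^+ n.+1) =
      fun xi => \sum_(n < M) x ^+ n * kernel w xi ^+ n.+1 +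
        x ^+ M * kernel w xi ^+ M.+1.
    by apply/funext => xi; rewrite big_ord_recr.
  split; first exact: cbmeasD.
  by rewrite cexpectD// IH2 cexpectZ ?big_ord_recr//; exact: cbmeasX.
have [s1 s2] := hsum N.
have -> : kmean (w + x) - \sum_(n < N) x ^+ n * kcoef w n =
    CE (fun xi => x ^+ N * (kernel w xi ^+ N * kernel (w + x) xi)).
  rewrite -s2 -cexpectB//; apply: eq_cexpect => xi xi0.
  by rewrite {1}(kernel_taylor N sw sx xi0) addrC addKr.
have -> : 4 * C * (normc x * C) ^+ N = 2 * ((normc x) ^+ N * (C ^+ N * (2 * C))).
  by rewrite exprMn; ring.
apply: cexpect_norm_le => // xi xi0; rewrite normcM normcX normcM normcX.
rewrite ler_wpM2l ?exprn_ge0 ?normc_ge0// ler_pM ?exprn_ge0 ?normc_ge0//.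
  by rewrite lerXn2r ?nnegrE ?normc_ge0 ?kernel_le//; exact: ltW.
exact: kernel_le.
Qed.

End KRatio.

(** * Monotonicity on the negative half-line *)

Section RealAxis.
Context {R : realType} (mu : probability (measurableTypeR R) R).
Implicit Types (s t xi : R).
Local Notation E u := (\int[mu]_(x in halfline) u x).

(** [rkernel] and [rmean] are the real numbers xi / (1 + s xi) and p(-s). *)
Definition rkernel s xi : R := Re (kernel (- s)%:C xi).
Definition rmean s : R := Re (kmean mu (- s)%:C).
Definition Kratio_neg s : R := rmean s / (1 - s * rmean s).

Hypothesis hmu : Mplus mu.

Lemma slit_neg s : 0 < s -> slit (- s)%:C.
Proof. by move=> s0; rewrite /slit /= oppr_lt0 s0 orbT. Qed.

Lemma kernel_neg s xi : 0 < s -> 0 <= xi ->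
  kernel (- s)%:C xi = (xi / (1 + s * xi))%:C.
Proof.
move=> s0 xi0.
by rewrite /kernel rmorphM fmorphV rmorphD rmorph1 rmorphM rmorphN mulNr opprK.
Qed.

Lemma rkernelE s xi : 0 < s -> 0 <= xi -> rkernel s xi = xi / (1 + s * xi).
Proof. by move=> s0 xi0; rewrite /rkernel kernel_neg. Qed.

Lemma bmeas_rkernel s : 0 < s -> bounded_measurable (rkernel s).
Proof. by move=> s0; exact: (cbmeas_kernel (slit_neg s0)).1. Qed.

Lemma kmean_neg s : 0 < s -> kmean mu (- s)%:C = (rmean s)%:C.
Proof.
move=> s0; rewrite /rmean /kmean -[in RHS](cexpect_real hmu).
by apply: eq_cexpect => xi xi0; rewrite !kernel_neg.
Qed.

Lemma Kratio_negE s : 0 < s -> Kratio mu (- s)%:C = (Kratio_neg s)%:C.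
Proof.
move=> s0; rewrite /Kratio /kden kmean_neg// /Kratio_neg.
by rewrite rmorphM fmorphV rmorphB rmorph1 rmorphM rmorphN mulNr.
Qed.

Lemma rmean_gt0 s : 0 < s -> 0 < rmean s.
Proof.
move=> s0; apply: expect_gt0 => //; first exact: bmeas_rkernel.
  by move=> xi xi0; rewrite -/(rkernel s xi) rkernelE// divr_ge0//; nra.
by move=> xi xi0; rewrite -/(rkernel s xi) rkernelE ?ltW// divr_gt0//; nra.
Qed.

Lemma bmeas_sub_rkernel s : 0 < s ->
  bounded_measurable (fun xi => 1 - s * rkernel s xi).
Proof.
move=> s0; apply: bmeasB; first exact: bmeas_cst.
by apply: bmeasM; [exact: bmeas_cst | exact: bmeas_rkernel].
Qed.

Lemma rdenE s : 0 < s -> 1 - s * rmean s = E (fun xi => 1 - s * rkernel s xi).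
Proof.
move=> s0; rewrite expectB ?expectZ ?(expect_cst hmu)//.
- exact: bmeas_rkernel.
- exact: bmeas_cst.
- by apply: bmeasM; [exact: bmeas_cst | exact: bmeas_rkernel].
Qed.

Lemma sub_rkernelE s xi : 0 < s -> 0 <= xi ->
  1 - s * rkernel s xi = (1 + s * xi)^-1.
Proof.
move=> s0 xi0; rewrite rkernelE//; field.
by rewrite gt_eqF//; nra.
Qed.

Lemma rden_gt0 s : 0 < s -> 0 < 1 - s * rmean s.
Proof.
move=> s0; rewrite rdenE//; apply: expect_gt0 => //.
- exact: bmeas_sub_rkernel.
- by move=> xi xi0; rewrite sub_rkernelE// invr_ge0; nra.
- by move=> xi xi0; rewrite sub_rkernelE ?ltW// invr_gt0; nra.
Qed.

Lemma Kratio_neg_gt0 s : 0 < s -> 0 < Kratio_neg s.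
Proof. by move=> s0; rewrite divr_gt0 ?rmean_gt0 ?rden_gt0. Qed.

Lemma rmean_sub s t : 0 < s -> 0 < t ->
  rmean s - rmean t = (t - s) * E (fun xi => rkernel s xi * rkernel t xi).
Proof.
move=> s0 t0; have hs := bmeas_rkernel s0; have ht := bmeas_rkernel t0.
rewrite -expectB// -expectZ; last exact: bmeasM.
apply: eq_expect => xi xi0; rewrite -/(rkernel s xi) -/(rkernel t xi) !rkernelE//.
by field; rewrite !gt_eqF//; nra.
Qed.

(** Both kernels increase with xi, hence are nonnegatively correlated. *)
Lemma rkernel_Chebyshev s t : 0 < s -> 0 < t ->
  rmean s * rmean t <= E (fun xi => rkernel s xi * rkernel t xi).
Proof.
move=> s0 t0; have hs := bmeas_rkernel s0; have ht := bmeas_rkernel t0.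
(* x0 is the point where the first kernel takes its mean value. *)
set x0 := Kratio_neg s; have x00 : 0 < x0 by exact: Kratio_neg_gt0.
have Js : rmean s = x0 / (1 + s * x0).
  rewrite /x0 /Kratio_neg; have := rden_gt0 s0 => d0.
  field; rewrite gt_eqF//= ?andbT.
  by have -> : 1 - s * rmean s + s * rmean s = 1 by ring; exact: oner_neq0.
set c := x0 / (1 + t * x0).
have : 0 <= E (fun xi => (rkernel s xi - rmean s) * (rkernel t xi - c)).
  apply: expect_ge0 => xi xi0; rewrite !rkernelE// Js /c.
  have -> : (xi / (1 + s * xi) - x0 / (1 + s * x0)) *
      (xi / (1 + t * xi) - x0 / (1 + t * x0)) =
      (xi - x0) ^+ 2 /
      ((1 + s * xi) * (1 + s * x0) * ((1 + t * xi) * (1 + t * x0))).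
    by field; rewrite !gt_eqF//; nra.
  by rewrite divr_ge0 ?sqr_ge0// !mulr_ge0//; nra.
have -> : E (fun xi => (rkernel s xi - rmean s) * (rkernel t xi - c)) =
    E (fun xi => rkernel s xi * rkernel t xi - rmean s * rkernel t xi
                 - c * rkernel s xi + c * rmean s).
  by apply: eq_expect => xi _; ring.
have h1 := bmeasM hs ht; have h2 := bmeasM (bmeas_cst (rmean s)) ht.
have h3 := bmeasM (bmeas_cst c) hs; have h4 := bmeas_cst (c * rmean s).
rewrite expectD// ?expectB// ?expectZ// ?(expect_cst hmu).
- have -> : E (rkernel t) = rmean t by [].
  have -> : E (rkernel s) = rmean s by [].
  lra.
- exact: bmeas_cst.
- exact: bmeasB.
- by apply: bmeasB => //; exact: bmeasB.
Qed.

(** Cross-multiplied and rewritten by the resolvent identity, the claim is the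
    correlation inequality times t - s. *)
Lemma Kratio_neg_le s t : 0 < s -> s <= t -> Kratio_neg t <= Kratio_neg s.
Proof.
move=> s0 st; have t0 := lt_le_trans s0 st.
have ds := rden_gt0 s0; have dt := rden_gt0 t0.
rewrite /Kratio_neg ler_pdivrMr// mulrAC ler_pdivlMr//.
have := rmean_sub s0 t0; have := rkernel_Chebyshev s0 t0.
set S : R := Rintegral _ _ _ => h1 h2.
have : (t - s) * (rmean s * rmean t) <= (t - s) * S by rewrite ler_wpM2l// subr_ge0.
rewrite -h2; nra.
Qed.

Lemma mul_rmean_sub s t : 0 < s -> 0 < t ->
  t * rmean t - s * rmean s =
  (t - s) * E (fun xi => rkernel t xi * (1 - s * rkernel s xi)).
Proof.
move=> s0 t0; have hs := bmeas_rkernel s0; have ht := bmeas_rkernel t0.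
have h1 := bmeasM (bmeas_cst s) hs; have h2 := bmeasM (bmeas_cst t) ht.
rewrite -expectZ; last by apply: bmeasM => //; exact: bmeas_sub_rkernel.
rewrite -!expectZ// -expectB//; apply: eq_expect => xi xi0.
rewrite -/(rkernel s xi) -/(rkernel t xi) sub_rkernelE// !rkernelE//.
by field; rewrite !gt_eqF//; nra.
Qed.

(** That s p(-s) increases gives the monotonicity of s h(-s); the Lipschitz
    bound gives its continuity. *)
Lemma mul_rmean_lip a s t : 0 < a -> a <= s -> s <= t ->
  0 <= t * rmean t - s * rmean s <= (t - s) * a^-1.
Proof.
move=> a0 as_ st; have s0 := lt_le_trans a0 as_; have t0 := lt_le_trans s0 st.
have ht := bmeas_rkernel t0.
rewrite mul_rmean_sub// mulr_ge0 ?subr_ge0//=; last first.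
  apply: expect_ge0 => xi xi0; rewrite sub_rkernelE// rkernelE//.
  by rewrite divr_ge0 ?divr_ge0//; nra.
apply: ler_wpM2l; first by rewrite subr_ge0.
rewrite -(expect_cst hmu a^-1); apply: expect_le.
- by apply: bmeasM => //; exact: bmeas_sub_rkernel.
- exact: bmeas_cst.
move=> xi xi0; rewrite sub_rkernelE// rkernelE//.
rewrite -mulrA -invfM ler_pdivrMr ?mulr_gt0//; try nra.
rewrite mulrC ler_pdivlMr//.
have : xi * a <= xi * t by rewrite ler_wpM2l//; exact: le_trans st.
have : 0 <= s * xi * (1 + t * xi) by rewrite mulr_ge0//; nra.
nra.
Qed.

Lemma mul_Kratio_negE s : 0 < s ->
  s * Kratio_neg s = s * rmean s / (1 - s * rmean s).
Proof. by move=> s0; rewrite /Kratio_neg mulrA. Qed.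

Lemma mul_Kratio_neg_le s t : 0 < s -> s <= t ->
  s * Kratio_neg s <= t * Kratio_neg t.
Proof.
move=> s0 st; have t0 := lt_le_trans s0 st.
rewrite !mul_Kratio_negE// ler_pdivrMr ?rden_gt0// mulrAC ler_pdivlMr ?rden_gt0//.
have /andP[+ _] := mul_rmean_lip s0 (lexx s) st; nra.
Qed.

End RealAxis.

(** * Comparison with the negative half-line *)

Section KRatioBounds.
Context {R : realType} (mu : probability (measurableTypeR R) R).
Implicit Types (w e : R[i]) (s t xi c k : R).
Local Notation E u := (\int[mu]_(x in halfline) u x).
Local Notation CE f := (cintegral mu halfline f).
Local Notation rmean := (rmean mu).
Local Notation Kratio_neg := (Kratio_neg mu).

Hypothesis hmu : Mplus mu.

(** a p(-a) tends to 0 with a, by dominated convergence: xi a / (1 + a xi) <= 1. *)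
Lemma mul_rmean_small k : 0 < k -> exists a, [/\ 0 < a, a <= 1 & a * rmean a <= k].
Proof.
move=> k0; pose u n : R := n.+1%:R^-1.
have u0 n : 0 < u n by rewrite invr_gt0.
have u1 n : u n <= 1 by rewrite invf_le1 ?ler1n.
pose f n xi : \bar R := (u n * rkernel (u n) xi)%:E.
have fb n xi : 0 <= xi -> (0 <= u n * rkernel (u n) xi <= 1)%R.
  move=> xi0; have := sub_rkernelE (u0 n) xi0 => h.
  have p : 0 < 1 + u n * xi by have := u0 n; nra.
  have h1 : 0 <= (1 + u n * xi)^-1 by rewrite invr_ge0 ltW.
  rewrite -h in h1.
  rewrite rkernelE// mulr_ge0 ?divr_ge0// ?(ltW (u0 n)) ?(ltW p)//=.
  by rewrite -rkernelE//; lra.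
have bf n : bounded_measurable (fun xi => u n * rkernel (u n) xi).
  by apply: bmeasM; [exact: bmeas_cst | exact: bmeas_rkernel].
have cv : (\int[mu]_(x in halfline) f n x)%E @[n --> \oo] -->
    (\int[mu]_(x in halfline) 0)%E.
  apply: (@dominated_cvg _ _ _ mu halfline measurable_halfline f (fun=> 0%E) (fun=> 1%E)).
  - by move=> n; apply/measurable_EFinP; exact: (bf n).1.
  - move=> x /halflineP x0; apply: cvg_EFin; first exact: nearW.
    apply: (@squeeze_cvgr _ _ _ _ (fun=> 0) (fun n => u n * x)).
    + near=> n; have /andP[-> _] := fb n _ x0; rewrite /=.
      rewrite ler_wpM2l ?(ltW (u0 n))// rkernelE// ler_pdivrMr; last by have := u0 n; nra.
      by rewrite ler_peMr// lerDl mulr_ge0// ltW.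
    + exact: cvg_cst.
    + rewrite -[X in _ --> X](mul0r (x : R)); apply: cvgMr_tmp.
      exact: cvg_harmonic.
  - by [].
  - exact: (bmeas_integrable mu (bmeas_cst 1)).
  - move=> n x /halflineP x0; have /andP[h1 h2] := fb n _ x0.
    by rewrite /f abse_EFin lee_fin ger0_norm.
rewrite integral0 in cv.
have := cv => /fine_cvgP [_] /cvgrPdist_lt /(_ _ k0) [N _ /(_ N (leqnn N))] /=.
rewrite sub0r normrN => H; exists (u N); split => //.
apply: ltW; apply: le_lt_trans H; apply: le_trans (ler_norm _).
suff -> : u N * rmean (u N) = E (fun xi => u N * rkernel (u N) xi) by [].
by rewrite expectZ//; exact: bmeas_rkernel.
Unshelve. all: by end_near.
Qed.

(** Since s h(-s) = u / (1 - u) with u = s p(-s), the equation s h(-s) = k is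
    u = k / (1 + k), to which the intermediate value theorem applies. *)
Lemma mul_Kratio_neg_surj k : 0 < k -> k <= Kratio_neg 1 ->
  exists s, [/\ 0 < s, s <= 1 & s * Kratio_neg s = k].
Proof.
move=> k0 k1; pose k' := k / (1 + k); have k'0 : 0 < k' by rewrite divr_gt0//; lra.
have [a [a0 a1 ak]] := mul_rmean_small k'0.
pose f s := s * rmean s.
have fc : {within `[a, 1], continuous f}.
  apply/subspace_continuousP => x /=; rewrite in_itv /= => /andP[ax x1].
  apply/cvgrPdist_lt => e e0; rewrite near_withinE; near=> t.
  rewrite /= in_itv /= => /andP[at_ t1].
  have h : `|x - t| < e * a by near: t; apply: cvgr_dist_lt; rewrite ?mulr_gt0//.
  have hx : `|x - t| * a^-1 < e by rewrite ltr_pdivrMr.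
  apply: le_lt_trans hx; case: (leP x t) => [xt|/ltW tx].
    have /andP[h1 h2] := mul_rmean_lip hmu a0 ax xt.
    by rewrite -normrN opprB (distrC x) !ger0_norm// subr_ge0.
  have /andP[h1 h2] := mul_rmean_lip hmu a0 at_ tx.
  by rewrite !ger0_norm// subr_ge0.
have k1' : k' <= f 1.
  have := k1; have d1 := rden_gt0 hmu ltr01.
  rewrite /f /Kratio_neg /k' ler_pdivlMr// ler_pdivrMr; lra.
have [s] : exists2 s, s \in `[a, 1] & f s = k'.
  by apply: IVT => //; rewrite ge_min le_max ak k1' orbT.
rewrite in_itv /= => /andP[as_ s1] fs; have s0 := lt_le_trans a0 as_.
exists s; split=> //; rewrite mul_Kratio_negE// -/(f s) fs /k'.
by field; lra.
Unshelve. all: by end_near.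
Qed.

(** A closed cone around the direction -e, of opening less than pi, whose
    second condition puts -1 in it; so it misses the positive half-line. *)
Definition sector e c w : Prop :=
  [/\ 0 < c, c <= Re e & c * normc w <= Re (- e * w^*)].

Section InSector.
Context (e w : R[i]) (c : R).
Hypotheses (sec : sector e c w) (w0 : w != 0).

Lemma sector_slit : slit w.
Proof.
case: sec => c0 ce cw; apply/slitP => -[x /= x0 xw].
have wp : 0 < normc w by rewrite normc_gt0.
have : 0 < c * normc w by exact: mulr_gt0.
move: cw; rewrite -xw !ReIm_simp; nra.
Qed.

Let s := normc w.
Let s0 : 0 < s. Proof. by rewrite /s normc_gt0. Qed.

Lemma sector_e_gt0 : 0 < normc e.
Proof.
case: sec => c0 ce _; apply: (lt_le_trans c0); apply: le_trans (normc_Re e).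
exact: le_trans ce (ler_norm _).
Qed.

Lemma sector_den_ge xi : 0 <= xi ->
  c * (1 + s * xi) <= Re (e * (1 - w^* * xi%:C)).
Proof.
case: sec => c0 ce cw xi0.
have : c * normc w * xi <= Re (- e * w^*) * xi by rewrite ler_wpM2r.
rewrite !ReIm_simp /s; lra.
Qed.

Lemma normc_den_le xi : 0 <= xi -> normc (1 - w * xi%:C) <= 1 + s * xi.
Proof.
move=> xi0; apply: le_trans (normcB _ _) _.
by rewrite normc1 normcM normc_real (ger0_norm xi0).
Qed.

Lemma normc_den_ge xi : 0 <= xi ->
  c * (1 + s * xi) <= normc e * normc (1 - w * xi%:C).
Proof.
move=> xi0; apply: le_trans (sector_den_ge xi0) _.
have -> : normc (1 - w * xi%:C) = normc (1 - w^* * xi%:C).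
  rewrite -normc_conj; congr normc; apply: complexP; rewrite !ReIm_simp; ring.
by rewrite -normcM; apply: le_trans (ler_norm _) (normc_Re _).
Qed.

(** For w in a sector all values of 1 / (1 - w xi), rotated by e, lie in one
    cone around the positive half-line. So the integrals p and q do not suffer
    from cancellation, and are comparable to those at -|w|. *)
Lemma sector_inv_ge xi : 0 <= xi ->
  c / (1 + s * xi) <= Re (e / (1 - w * xi%:C)).
Proof.
move=> xi0; have n0 := slit_den_neq0 sector_slit xi0; case: (sec) => c0 _ _.
have p : 0 < 1 + s * xi by have := s0; nra.
have np : 0 < normc (1 - w * xi%:C) by rewrite normc_gt0.
rewrite invc_conj// mulrA.
set m := normc _; have -> : Re (e * (1 - w * xi%:C)^* * (m ^+ 2)^-1%:C) =
   Re (e * (1 - w^* * xi%:C)) / m ^+ 2 by rewrite !ReIm_simp; ring.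
rewrite ler_pdivlMr ?exprn_gt0// mulrAC ler_pdivrMr//.
apply: le_trans (ler_wpM2r (ltW p) (sector_den_ge xi0)).
have ml : m <= 1 + s * xi := normc_den_le xi0.
have : m ^+ 2 <= (1 + s * xi) ^+ 2.
  by rewrite lerXn2r// nnegrE; apply: ltW.
by move=> h; rewrite -mulrA ler_wpM2l ?(ltW c0)// -expr2.
Qed.

Lemma sector_inv_le xi : 0 <= xi ->
  normc (1 - w * xi%:C)^-1 <= normc e / c * (1 + s * xi)^-1.
Proof.
move=> xi0; have n0 := slit_den_neq0 sector_slit xi0; case: (sec) => c0 _ _.
have p : 0 < 1 + s * xi by have := s0; nra.
have np : 0 < normc (1 - w * xi%:C) by rewrite normc_gt0.
rewrite normcV; set m := normc _ in np *.
have -> : normc e / c * (1 + s * xi)^-1 = normc e * m / (c * (1 + s * xi)) / m.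
  by field; rewrite !gt_eqF.
rewrite -[leLHS]mul1r ler_pM2r ?invr_gt0// ler_pdivlMr ?mulr_gt0// mul1r.
exact: normc_den_ge.
Qed.

(** The integrand of q = 1 + w p is 1 / (1 - w xi). *)
Lemma den_kernelE xi : 0 <= xi -> 1 + w * kernel w xi = (1 - w * xi%:C)^-1.
Proof.
move=> xi0; have := slit_den_neq0 sector_slit xi0.
by rewrite /kernel => h; field.
Qed.

Let hk : cbounded_measurable (kernel w) := cbmeas_kernel sector_slit.

Lemma cbmeas_den : cbounded_measurable (fun xi => 1 + w * kernel w xi).
Proof. by apply: cbmeasD (cbmeas_cst _) (cbmeasM (cbmeas_cst _) hk). Qed.

Lemma kden_expect : kden mu w = CE (fun xi => 1 + w * kernel w xi).
Proof.
rewrite cexpectD; [|exact: cbmeas_cst|exact: cbmeasM (cbmeas_cst _) hk].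
by rewrite cexpect_cst// cexpectZ.
Qed.

Lemma normc_kmean_ge : c * rmean s <= normc e * normc (kmean mu w).
Proof.
case: (sec) => c0 _ _; rewrite -normcM.
apply: le_trans (normc_Re _); apply: le_trans (ler_norm _).
rewrite -cexpectZ// -expectZ; last exact: bmeas_rkernel.
apply: expect_le.
- by apply: bmeasM; [exact: bmeas_cst | exact: bmeas_rkernel].
- exact: (cbmeasM (cbmeas_cst _) hk).1.
move=> xi xi0; rewrite -/(rkernel s xi) rkernelE//.
have -> : Re (e * kernel w xi) = xi * Re (e / (1 - w * xi%:C)).
  by rewrite /kernel !ReIm_simp; ring.
by rewrite mulrCA ler_wpM2l// sector_inv_ge.
Qed.

Lemma normc_kmean_le : normc (kmean mu w) <= 2 * (normc e / c * rmean s).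
Proof.
rewrite -expectZ; last exact: bmeas_rkernel.
apply: cexpect_norm_le_fun => //.
  by apply: bmeasM; [exact: bmeas_cst | exact: bmeas_rkernel].
move=> xi xi0; rewrite -/(rkernel s xi) rkernelE// /kernel normcM normc_real.
by rewrite ger0_norm// mulrCA ler_wpM2l// sector_inv_le.
Qed.

Lemma normc_kden_ge : c * (1 - s * rmean s) <= normc e * normc (kden mu w).
Proof.
case: (sec) => c0 _ _; rewrite -normcM.
apply: le_trans (normc_Re _); apply: le_trans (ler_norm _).
rewrite kden_expect -cexpectZ; last exact: cbmeas_den.
rewrite rdenE// -expectZ; last exact: bmeas_sub_rkernel.
apply: expect_le.
- by apply: bmeasM; [exact: bmeas_cst | exact: bmeas_sub_rkernel].
- exact: (cbmeasM (cbmeas_cst _) cbmeas_den).1.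
by move=> xi xi0; rewrite sub_rkernelE// den_kernelE// sector_inv_ge.
Qed.

Lemma normc_kden_le : normc (kden mu w) <= 2 * (normc e / c * (1 - s * rmean s)).
Proof.
rewrite kden_expect rdenE// -expectZ; last exact: bmeas_sub_rkernel.
apply: cexpect_norm_le_fun; first exact: cbmeas_den.
  by apply: bmeasM; [exact: bmeas_cst | exact: bmeas_sub_rkernel].
by move=> xi xi0; rewrite sub_rkernelE// den_kernelE// sector_inv_le.
Qed.

(** In a closed sector off the half-line, |h(w)| is comparable to h(-|w|). *)
Lemma normc_Kratio_le :
  normc (Kratio mu w) <= 2 * (normc e / c) ^+ 2 * Kratio_neg s.
Proof.
case: (sec) => c0 _ _; have e0 := sector_e_gt0; have d0 := rden_gt0 hmu s0.
have J0 := rmean_gt0 hmu s0; have q0 := normc_kden_gt0 hmu sector_slit.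
rewrite /Kratio normcM normcV ler_pdivrMr//; apply: le_trans normc_kmean_le _.
have -> : 2 * (normc e / c) ^+ 2 * Kratio_neg s * normc (kden mu w) =
  2 * (normc e / c ^+ 2) * rmean s / (1 - s * rmean s) * (normc e * normc (kden mu w)).
  by rewrite /Kratio_neg; field; rewrite !gt_eqF.
apply: le_trans (ler_wpM2l _ normc_kden_ge); last first.
  by rewrite !mulr_ge0 ?invr_ge0// ?ltW// mulr_gt0.
by rewrite le_eqVlt; apply/orP; left; apply/eqP; field; rewrite !gt_eqF.
Qed.

Lemma normc_Kratio_ge :
  Kratio_neg s <= 2 * (normc e / c) ^+ 2 * normc (Kratio mu w).
Proof.
case: (sec) => c0 _ _; have e0 := sector_e_gt0; have d0 := rden_gt0 hmu s0.
have J0 := rmean_gt0 hmu s0; have q0 := normc_kden_gt0 hmu sector_slit.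
rewrite /Kratio normcM normcV mulrA ler_pdivlMr//.
apply: le_trans (ler_wpM2l (ltW (Kratio_neg_gt0 hmu s0)) normc_kden_le) _.
have -> : Kratio_neg s * (2 * (normc e / c * (1 - s * rmean s))) =
  2 * normc e / c ^+ 2 * (c * rmean s).
  by rewrite /Kratio_neg; field; rewrite !gt_eqF.
apply: le_trans (ler_wpM2l _ normc_kmean_ge) _.
  by rewrite !mulr_ge0 ?invr_ge0 ?exprn_ge0// ltW.
by rewrite le_eqVlt; apply/orP; left; apply/eqP; field; rewrite !gt_eqF.
Qed.

End InSector.

End KRatioBounds.

(** * Uniqueness of solutions *)

Section Solutions.
Context {R : realType}.
Implicit Types (z w v e : R[i]) (mu : probability (measurableTypeR R) R).

(** The upper half-plane and the part of its boundary on which the system makes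
    sense; conjugation gives the rest of the slit plane. *)
Definition upper_slit z : bool := (0 < Im z) || ((Im z == 0) && (Re z < 0)).

Lemma upper_slit_slit z : upper_slit z -> slit z.
Proof. by rewrite /slit => /orP[/gt_eqF ->//|/andP[_ ->]]; rewrite orbT. Qed.

Lemma upper_slit_Im_ge0 z : upper_slit z -> 0 <= Im z.
Proof. by move=> /orP[/ltW//|/andP[/eqP -> _]]. Qed.

Lemma upper_slit_neq0 z : upper_slit z -> z != 0.
Proof.
by move=> h; apply/eqP => z0; move: h; rewrite z0 /upper_slit /= ltxx eqxx.
Qed.

Definition solution mu1 mu2 z w1 w2 : Prop :=
  [/\ upper_slit w1, upper_slit w2,
      w2 = z * Kratio mu1 w1 & w1 = z * Kratio mu2 w2].

Lemma solution_sym mu1 mu2 z w1 w2 :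
  solution mu1 mu2 z w1 w2 -> solution mu2 mu1 z w2 w1.
Proof. by case. Qed.

Context (mu1 mu2 : probability (measurableTypeR R) R).
Hypotheses (hmu1 : Mplus mu1) (hmu2 : Mplus mu2).

(** Both sides are the imaginary part of K1(w1) = K2(w2). *)
Lemma subordination_Im z w1 w2 : z != 0 -> slit w1 -> slit w2 ->
  w2 = z * Kratio mu1 w1 -> w1 = z * Kratio mu2 w2 ->
  slopeB mu1 w1 * Im w1 = slopeB mu2 w2 * Im w2.
Proof.
move=> z0 s1 s2 e2 e1.
have : w1 * Kratio mu1 w1 = w2 * Kratio mu2 w2.
  by apply: (mulfI z0); rewrite [LHS]mulrCA -e2 [RHS]mulrCA -e1 mulrC.
rewrite (KratioE hmu1 s1) (KratioE hmu2 s2).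
move/(congr1 (@complex.Im _)); rewrite !ReIm_simp; lra.
Qed.

(** The system in real form, from h = B - w^* A. *)
Lemma KratioRe (mu : probability (measurableTypeR R) R) z w w' :
  Mplus mu -> slit w -> w' = z * Kratio mu w ->
  Re w' = Re z * (slopeB mu w - Re w * slopeA mu w) - Im z * (Im w * slopeA mu w).
Proof. by move=> hmu sw ->; rewrite (KratioE hmu sw) !ReIm_simp; ring. Qed.

Lemma KratioIm (mu : probability (measurableTypeR R) R) z w w' :
  Mplus mu -> slit w -> w' = z * Kratio mu w ->
  Im w' = Re z * (Im w * slopeA mu w) + Im z * (slopeB mu w - Re w * slopeA mu w).
Proof. by move=> hmu sw ->; rewrite (KratioE hmu sw) !ReIm_simp; ring. Qed.

Section OneSolution.
Context (z w1 w2 : R[i]) (uz : upper_slit z) (sol : solution mu1 mu2 z w1 w2).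
Local Notation A1 := (slopeA mu1 w1).
Local Notation A2 := (slopeA mu2 w2).
Local Notation B1 := (slopeB mu1 w1).
Local Notation B2 := (slopeB mu2 w2).

Let u1 : upper_slit w1. Proof. by case: sol. Qed.
Let u2 : upper_slit w2. Proof. by case: sol. Qed.
Let s1 : slit w1. Proof. exact: upper_slit_slit. Qed.
Let s2 : slit w2. Proof. exact: upper_slit_slit. Qed.
Let eq2 : w2 = z * Kratio mu1 w1. Proof. by case: sol. Qed.
Let eq1 : w1 = z * Kratio mu2 w2. Proof. by case: sol. Qed.
Let ImE : B1 * Im w1 = B2 * Im w2.
Proof. exact: (subordination_Im (upper_slit_neq0 uz) s1 s2 eq2 eq1). Qed.
Let A1_ge0 : 0 <= A1. Proof. exact: slopeA_ge0. Qed.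
Let A2_ge0 : 0 <= A2. Proof. exact: slopeA_ge0. Qed.
Let B1_gt0 : 0 < B1. Proof. exact: slopeB_gt0. Qed.
Let B2_gt0 : 0 < B2. Proof. exact: slopeB_gt0. Qed.

Lemma solution_upper : 0 < Im z -> 0 < Im w1 /\ 0 < Im w2.
Proof.
move=> y0; have b1 := upper_slit_Im_ge0 u1; have b2 := upper_slit_Im_ge0 u2.
have p1 : 0 < Im w1.
  rewrite lt_def b1 andbT; apply/eqP => b10.
  have b20 : Im w2 = 0.
    by move: ImE; rewrite b10 mulr0 => /esym/eqP; rewrite mulf_eq0 gt_eqF// => /eqP.
  have a1 : Re w1 < 0 by move: u1; rewrite /upper_slit b10 ltxx eqxx.
  have := KratioIm hmu1 s1 eq2; rewrite b20 b10 mul0r mulr0 add0r.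
  have : 0 < B1 - Re w1 * A1.
    by rewrite subr_gt0 (le_lt_trans _ B1_gt0)// mulr_le0_ge0// ltW.
  by move=> h /esym/eqP; rewrite mulf_eq0 !gt_eqF.
split=> //; have : 0 < B2 * Im w2 by rewrite -ImE; exact: mulr_gt0.
by rewrite pmulr_rgt0.
Qed.

Lemma solution_real : Im z = 0 -> [/\ Im w1 = 0, Im w2 = 0, Re w1 < 0 & Re w2 < 0].
Proof.
move=> y0; have b1 := upper_slit_Im_ge0 u1; have b2 := upper_slit_Im_ge0 u2.
have x0 : Re z < 0 by move: uz; rewrite /upper_slit y0 ltxx eqxx.
have b20 : Im w2 = 0.
  apply/eqP; rewrite eq_le b2 andbT (KratioIm hmu1 s1 eq2) y0 mul0r addr0.
  by rewrite nmulr_rle0// mulr_ge0.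
have b10 : Im w1 = 0.
  by move: ImE; rewrite b20 mulr0 => /eqP; rewrite mulf_eq0 gt_eqF// => /eqP.
split=> //; first by move: u1; rewrite /upper_slit b10 ltxx eqxx.
by move: u2; rewrite /upper_slit b20 ltxx eqxx.
Qed.

(** Infinitesimally, the map w1 |-> z h2(z h1(w1)) is a strict contraction at a
    solution. In the upper half-plane this comes from the identity
    |z|^2 Im w1 Im w2 - Im (w1 z^* ) Im (w2 z^* ) = Im z Im (w1 w2 z^* ),
    whose right-hand side is positive since K1(w1) = w1 w2 / z lies in the
    upper half-plane. *)
Lemma solution_slopes_lt1 : normc z ^+ 2 * (A1 * A2) < 1.
Proof.
have r2 := KratioRe hmu1 s1 eq2; have i2 := KratioIm hmu1 s1 eq2.
have r1 := KratioRe hmu2 s2 eq1; have i1 := KratioIm hmu2 s2 eq1.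
have [y0|y0] : 0 < Im z \/ Im z = 0.
  by move: uz; rewrite /upper_slit => /orP[|/andP[/eqP]]; tauto.
  have [b1 b2] := solution_upper y0.
  set N := normc z ^+ 2; have NE : N = Re z ^+ 2 + Im z ^+ 2 by rewrite /N normc_sqr.
  have N0 : 0 < N by rewrite exprn_gt0// normc_gt0; exact: upper_slit_neq0.
  have h1 : N * (Im w1 * A1) = Im w2 * Re z - Re w2 * Im z.
    by rewrite NE i2 r2; ring.
  have h2 : N * (Im w2 * A2) = Im w1 * Re z - Re w1 * Im z.
    by rewrite NE i1 r1; ring.
  have h3 : N * (B1 * Im w1) =
      (Re w1 * Im w2 + Im w1 * Re w2) * Re z - (Re w1 * Re w2 - Im w1 * Im w2) * Im z.
    by rewrite NE i2 r2; ring.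
  have h4 : N * (Im w1 * Im w2 * (1 - N * (A1 * A2))) = N * (Im z * (B1 * Im w1)).
    rewrite (mulrCA N (Im z)) h3.
    have -> : N * (Im w1 * Im w2 * (1 - N * (A1 * A2))) =
      N * (Im w1 * Im w2) - N * (Im w1 * A1) * (N * (Im w2 * A2)) by ring.
    by rewrite h1 h2 NE; ring.
  have : 0 < Im w1 * Im w2 * (1 - N * (A1 * A2)).
    by rewrite (mulfI (lt0r_neq0 N0) h4); exact: mulr_gt0 y0 (mulr_gt0 B1_gt0 b1).
  by rewrite pmulr_rgt0; [rewrite subr_gt0 | exact: mulr_gt0].
have [b1 b2 a1 a2] := solution_real y0.
have x0 : Re z < 0 by move: uz; rewrite /upper_slit y0 ltxx eqxx.
rewrite y0 b1 b2 in r1 r2; rewrite normc_sqr y0.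
have xB1 : Re z * B1 < 0 by rewrite nmulr_rlt0.
have xB2 : Re z * B2 < 0 by rewrite nmulr_rlt0.
have k1 : Re z * Re w1 * A1 < - Re w2 by rewrite r2; lra.
have k2 : Re z * Re w2 * A2 < - Re w1 by rewrite r1; lra.
have p1 : 0 <= Re z * Re w1 * A1 by rewrite mulr_ge0// mulr_le0// ltW.
have p2 : 0 <= Re z * Re w2 * A2 by rewrite mulr_ge0// mulr_le0// ltW.
have := ltr_pM p1 p2 k1 k2.
have -> : - Re w2 * - Re w1 = Re w1 * Re w2 * 1 by ring.
have -> : Re z * Re w1 * A1 * (Re z * Re w2 * A2) =
  Re w1 * Re w2 * ((Re z ^+ 2 + 0 ^+ 2) * (A1 * A2)) by ring.
by rewrite ltr_pM2l// nmulr_rgt0.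
Qed.

End OneSolution.

(** Two solutions would be moved closer to one another by a strict
    contraction that fixes them. *)
Lemma solution_unique z w1 w2 v1 v2 : upper_slit z ->
  solution mu1 mu2 z w1 w2 -> solution mu1 mu2 z v1 v2 -> w1 = v1 /\ w2 = v2.
Proof.
move=> uz sw sv; have P := solution_slopes_lt1 uz sw.
have Q := solution_slopes_lt1 uz sv.
case: sw => uw1 uw2 ew2 ew1; case: sv => uv1 uv2 ev2 ev1.
have sw1 := upper_slit_slit uw1; have sw2 := upper_slit_slit uw2.
have sv1 := upper_slit_slit uv1; have sv2 := upper_slit_slit uv2.
suff e1 : w1 = v1 by split=> //; rewrite ew2 ev2 e1.
apply/eqP; rewrite -subr_eq0 -normc_eq0 -sqrf_eq0; apply/negPn/negP => dn.
set d1 := normc (w1 - v1) ^+ 2 in dn; set d2 := normc (w2 - v2) ^+ 2.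
have d10 : 0 < d1 by rewrite lt_def dn sqr_ge0.
set N := normc z ^+ 2 in P Q; have N0 : 0 <= N by exact: sqr_ge0.
have h1 : d2 <= N * (d1 * (slopeA mu1 w1 * slopeA mu1 v1)).
  rewrite /d2 ew2 ev2 -mulrBr normcM exprMn ler_wpM2l//.
  exact: Kratio_SchwarzPick.
have h2 : d1 <= N * (d2 * (slopeA mu2 w2 * slopeA mu2 v2)).
  rewrite /d1 [w1]ew1 [v1]ev1 -mulrBr normcM exprMn ler_wpM2l//.
  exact: Kratio_SchwarzPick.
have A1 := slopeA_ge0 hmu1 sw1; have A2 := slopeA_ge0 hmu2 sw2.
have A1' := slopeA_ge0 hmu1 sv1; have A2' := slopeA_ge0 hmu2 sv2.
move: (slopeA mu1 w1) (slopeA mu2 w2) (slopeA mu1 v1) (slopeA mu2 v2)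
  P Q h1 h2 A1 A2 A1' A2' => a1 a2 b1 b2 P Q h1 h2 a10 a20 b10 b20.
clearbody N d1 d2.
have h3 : d1 <= N * (a1 * a2) * (N * (b1 * b2)) * d1.
  apply: le_trans h2 _.
  have -> : N * (a1 * a2) * (N * (b1 * b2)) * d1 =
            N * (N * (d1 * (a1 * b1)) * (a2 * b2)) by ring.
  by rewrite ler_wpM2l// ler_wpM2r// mulr_ge0.
have : N * (a1 * a2) * (N * (b1 * b2)) < 1 * 1 by rewrite ltr_pM// !mulr_ge0.
rewrite mulr1 ltNge => /negP; apply.
by rewrite -(ler_pM2r d10) mul1r.
Qed.

End Solutions.

(** * A priori bounds, and solutions on the negative half-line *)

Section APrioriBounds.
Context {R : realType}.
Implicit Types (z w e : R[i]) (mu : probability (measurableTypeR R) R).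
Implicit Types (r s c x : R).

(** s h(-s) takes all small values, in particular arbitrarily small ones. *)
Lemma mul_Kratio_neg_small mu (hmu : Mplus mu) (d : R) : 0 < d ->
  exists m, [/\ 0 < m, m <= 1 & m * Kratio_neg mu m < d].
Proof.
move=> d0; have h1 := Kratio_neg_gt0 hmu (@ltr01 R).
pose k := Num.min (d / 2) (Kratio_neg mu 1).
have k0 : 0 < k by rewrite lt_min h1 divr_gt0.
have k1 : k <= Kratio_neg mu 1 by rewrite ge_min lexx orbT.
have [s [s0 s1 sE]] := mul_Kratio_neg_surj hmu k0 k1.
by exists s; split=> //; rewrite sE gt_min; apply/orP; left; lra.
Qed.

Lemma sector_cone e c z w (a b : R) : 0 <= a -> 0 <= b ->
  w = a%:C * z - b%:C -> sector e c z -> sector e c w.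
Proof.
move=> a0 b0 we [c0 ce cz]; split=> //.
have -> : Re (- e * w^*) = a * Re (- e * z^*) + b * Re e.
  by rewrite we !ReIm_simp; ring.
have wl : normc w <= a * normc z + b.
  rewrite we; apply: le_trans (normcB _ _) _.
  by rewrite normcM !normc_real !ger0_norm.
apply: le_trans (ler_wpM2l (ltW c0) wl) _.
have : a * (c * normc z) <= a * Re (- e * z^*) by rewrite ler_wpM2l.
have : b * c <= b * Re e by rewrite ler_wpM2l.
lra.
Qed.

(** As Im h1(w1) >= 0, multiplication by h1(w1) rotates z counterclockwise, if at
    all, to w2 = z h1(w1); as it stays in the upper half-plane, it lies in the
    cone spanned by z and -1. *)
Lemma sector_solution1 mu1 mu2 (hmu1 : Mplus mu1) (hmu2 : Mplus mu2) e c z w1 w2 :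
  upper_slit z -> solution mu1 mu2 z w1 w2 -> sector e c z -> sector e c w2.
Proof.
move=> uz sol sz; have [y0|y0] : 0 < Im z \/ Im z = 0.
  by move: uz; rewrite /upper_slit => /orP[|/andP[/eqP]]; tauto.
  have [b1 b2] := solution_upper hmu1 hmu2 uz sol y0.
  case: sol => u1 u2 e2 e1; have s1 := upper_slit_slit u1.
  have r2 := KratioRe hmu1 s1 e2; have i2 := KratioIm hmu1 s1 e2.
  have A1 := slopeA_ge0 hmu1 s1.
  apply: (@sector_cone e c z w2 (Im w2 / Im z)
    ((Im w2 * Re z - Re w2 * Im z) / Im z)) => //.
  - by rewrite divr_ge0// ltW.
  - rewrite divr_ge0// ?(ltW y0)//.
    have -> : Im w2 * Re z - Re w2 * Im z =
       (Re z ^+ 2 + Im z ^+ 2) * (Im w1 * slopeA mu1 w1) by rewrite r2 i2; ring.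
    by rewrite mulr_ge0 ?addr_ge0 ?sqr_ge0//; exact: mulr_ge0 (ltW b1) A1.
  - by apply: complexP; rewrite !ReIm_simp; field; rewrite gt_eqF.
have [b1 b2 a1 a2] := solution_real hmu1 hmu2 uz sol y0.
apply: (@sector_cone e c z w2 0 (- Re w2)) => //.
- by rewrite oppr_ge0 ltW.
- by apply: complexP; rewrite !ReIm_simp ?b2; ring.
Qed.

Lemma sector_solution2 mu1 mu2 (hmu1 : Mplus mu1) (hmu2 : Mplus mu2) e c z w1 w2 :
  upper_slit z -> solution mu1 mu2 z w1 w2 -> sector e c z -> sector e c w1.
Proof.
move=> uz sol; exact: sector_solution1 hmu2 hmu1 _ _ _ _ _ uz (solution_sym sol).
Qed.

Lemma solution_K mu1 mu2 z w1 w2 : upper_slit z -> solution mu1 mu2 z w1 w2 ->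
  w1 * Kratio mu1 w1 = w2 * Kratio mu2 w2.
Proof.
move=> /upper_slit_neq0 z0 [_ _ e2 e1]; apply: (mulfI z0).
by rewrite [LHS]mulrCA -e2 [RHS]mulrCA -e1 mulrC.
Qed.

(** Were w1 close to 0, then K2(w2) = K1(w1) would be small, hence w2 small;
    but w2 / z = h1(w1) is bounded away from 0 when w1 is close to 0. *)
Lemma solution_lower_bound mu1 mu2 (hmu1 : Mplus mu1) (hmu2 : Mplus mu2) e c r :
  0 < r -> exists2 m, 0 < m & forall z w1 w2, upper_slit z -> sector e c z ->
    r <= normc z -> solution mu1 mu2 z w1 w2 -> m <= normc w1.
Proof.
move=> r0.
have [[c0 e0]|ce] := pselect (0 < c /\ 0 < normc e); last first.
  exists 1 => // z w1 w2 uz sz; exfalso; apply: ce; split; first by case: sz.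
  exact: sector_e_gt0 sz.
pose k := 2 * (normc e / c) ^+ 2.
have k0 : 0 < k by rewrite mulr_gt0// exprn_gt0// divr_gt0.
have h10 := Kratio_neg_gt0 hmu1 (@ltr01 R).
pose eps := r * Kratio_neg mu1 1 / k.
have eps0 : 0 < eps by rewrite divr_gt0// mulr_gt0.
have h2e := Kratio_neg_gt0 hmu2 eps0.
pose d := eps * Kratio_neg mu2 eps / k ^+ 2.
have d0 : 0 < d by rewrite divr_gt0 ?exprn_gt0// mulr_gt0.
have [m [m0 m1 md]] := mul_Kratio_neg_small hmu1 d0.
exists m => // z w1 w2 uz sz rz sol; rewrite leNgt; apply/negP => wm.
have [u1 u2 e2 e1] := sol.
have n1 := upper_slit_neq0 u1; have n2 := upper_slit_neq0 u2.
have p1 : 0 < normc w1 by rewrite normc_gt0.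
have p2 : 0 < normc w2 by rewrite normc_gt0.
have sw1 := sector_solution2 hmu1 hmu2 uz sol sz.
have sw2 := sector_solution1 hmu1 hmu2 uz sol sz.
have le1 := normc_Kratio_le hmu1 sw1 n1; have ge1 := normc_Kratio_ge hmu1 sw1 n1.
have ge2 := normc_Kratio_ge hmu2 sw2 n2.
rewrite -/k in le1 ge1 ge2.
have w2e : eps <= normc w2.
  rewrite e2 normcM /eps ler_pdivrMr// -mulrA.
  apply: ler_pM => //; [exact: ltW|exact: ltW|rewrite mulrC]; apply: le_trans ge1.
  by apply: Kratio_neg_le => //; apply: le_trans m1; exact: ltW.
have : eps * Kratio_neg mu2 eps <= normc w2 * Kratio_neg mu2 (normc w2).
  exact: mul_Kratio_neg_le.
have KE : normc w1 * normc (Kratio mu1 w1) = normc w2 * normc (Kratio mu2 w2).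
  by rewrite -!normcM (solution_K uz sol).
have t1 : normc w1 * normc (Kratio mu1 w1) <= normc w1 * (k * Kratio_neg mu1 (normc w1)).
  by rewrite ler_pM2l.
have t2 : normc w2 * Kratio_neg mu2 (normc w2) <= normc w2 * (k * normc (Kratio mu2 w2)).
  by rewrite ler_pM2l.
have t3 : normc w1 * Kratio_neg mu1 (normc w1) < d.
  by apply: le_lt_trans md; apply: mul_Kratio_neg_le => //; exact: ltW.
have t4 : k ^+ 2 * (normc w1 * Kratio_neg mu1 (normc w1)) < eps * Kratio_neg mu2 eps.
  by move: t3; rewrite /d ltr_pdivlMr ?exprn_gt0// mulrC.
have t5 : k * (normc w1 * normc (Kratio mu1 w1)) <=
   k * (normc w1 * (k * Kratio_neg mu1 (normc w1))) by rewrite ler_pM2l.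
rewrite KE in t5; clear - t2 t4 t5; move=> t6; lra.
Qed.

(** The upper bounds follow from the lower ones: |w2| = |z| |h1(w1)|, and h1 is
    bounded in a sector away from 0. *)
Lemma solution_bounds mu1 mu2 (hmu1 : Mplus mu1) (hmu2 : Mplus mu2) e c r r' :
  0 < r -> exists m M, 0 < m /\ forall z w1 w2, upper_slit z -> sector e c z ->
    r <= normc z -> normc z <= r' -> solution mu1 mu2 z w1 w2 ->
    [/\ m <= normc w1, m <= normc w2, normc w1 <= M & normc w2 <= M].
Proof.
move=> r0.
have [m1 m10 H1] := solution_lower_bound hmu1 hmu2 e c r0.
have [m2 m20 H2] := solution_lower_bound hmu2 hmu1 e c r0.
pose k := 2 * (normc e / c) ^+ 2.
exists (Num.min m1 m2), (Num.max (r' * (k * Kratio_neg mu1 m1)) (r' * (k * Kratio_neg mu2 m2))).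
split; first by rewrite lt_min m10.
move=> z w1 w2 uz sz rz zr sol.
have b1 := H1 _ _ _ uz sz rz sol.
have b2 := H2 _ _ _ uz sz rz (solution_sym sol).
have [u1 u2 e2 e1] := sol.
have n1 := upper_slit_neq0 u1; have n2 := upper_slit_neq0 u2.
have sw1 := sector_solution2 hmu1 hmu2 uz sol sz.
have sw2 := sector_solution1 hmu1 hmu2 uz sol sz.
have le1 := normc_Kratio_le hmu1 sw1 n1; have le2 := normc_Kratio_le hmu2 sw2 n2.
rewrite -/k in le1 le2.
have k0 : 0 <= k by rewrite mulr_ge0// sqr_ge0.
split; rewrite ?ge_min ?b1 ?b2 ?orbT// le_max; apply/orP; [right|left].
  rewrite e1 normcM; apply: ler_pM; rewrite ?normc_ge0//.
  by apply: le_trans le2 _; rewrite ler_wpM2l// Kratio_neg_le.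
rewrite e2 normcM; apply: ler_pM; rewrite ?normc_ge0//.
by apply: le_trans le1 _; rewrite ler_wpM2l// Kratio_neg_le.
Qed.

Lemma sector_negative (x : R) : x < 0 -> sector 1 1 x%:C.
Proof.
by move=> x0; split=> //; rewrite mul1r normc_real ltr0_norm// !ReIm_simp; lra.
Qed.

(** If |w1| >= eps, then K2(w2) = K1(w1) is bounded below, hence so is |w2|;
    then h2(w2) is bounded, and w1 = z h2(w2) is small with z. *)
Lemma solution_small mu1 mu2 (hmu1 : Mplus mu1) (hmu2 : Mplus mu2) (eps : R) :
  0 < eps -> exists2 d, 0 < d & forall x w1 w2, 0 < x -> x < d ->
    solution mu1 mu2 (- x)%:C w1 w2 -> normc w1 < eps.
Proof.
move=> eps0; pose k : R := 2 * (normc (1 : R[i]) / 1) ^+ 2.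
have k0 : 0 < k by rewrite /k normc1 divr1 expr1n mulr1.
have h1e := Kratio_neg_gt0 hmu1 eps0.
pose l := eps * Kratio_neg mu1 eps / k ^+ 2.
have l0 : 0 < l by rewrite divr_gt0 ?exprn_gt0// mulr_gt0.
have [m [m0 m1 ml]] := mul_Kratio_neg_small hmu2 l0.
have h2m := Kratio_neg_gt0 hmu2 m0.
exists (eps / (k * Kratio_neg mu2 m)); first by rewrite divr_gt0// mulr_gt0.
move=> x w1 w2 x0 xd sol; rewrite ltNge; apply/negP => we.
have xn : - x < 0 by rewrite oppr_lt0.
have uz : upper_slit (- x)%:C by rewrite /upper_slit /= eqxx xn orbT.
have sz := sector_negative xn.
have [u1 u2 e2 e1] := sol.
have n1 := upper_slit_neq0 u1; have n2 := upper_slit_neq0 u2.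
have p2 : 0 < normc w2 by rewrite normc_gt0.
have sw1 := sector_solution2 hmu1 hmu2 uz sol sz.
have sw2 := sector_solution1 hmu1 hmu2 uz sol sz.
have ge1 := normc_Kratio_ge hmu1 sw1 n1; have le2 := normc_Kratio_le hmu2 sw2 n2.
rewrite -/k in ge1 le2; clearbody k.
have p1 : 0 < normc w1 by rewrite normc_gt0.
have KE : normc w1 * normc (Kratio mu1 w1) = normc w2 * normc (Kratio mu2 w2).
  by rewrite -!normcM (solution_K uz sol).
have t1 := mul_Kratio_neg_le hmu1 eps0 we.
have t2 : normc w1 * Kratio_neg mu1 (normc w1) <= normc w1 * (k * normc (Kratio mu1 w1)).
  by rewrite ler_pM2l.
have t3 : k * (normc w2 * normc (Kratio mu2 w2)) <=
    k * (normc w2 * (k * Kratio_neg mu2 (normc w2))).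
  by rewrite !ler_pM2l.
have t4 : l <= normc w2 * Kratio_neg mu2 (normc w2).
  rewrite /l ler_pdivrMr ?exprn_gt0//; clear - t1 t2 t3 KE.
  by rewrite -KE in t3; lra.
have mw : m <= normc w2.
  rewrite leNgt; apply/negP => wm; have := mul_Kratio_neg_le hmu2 p2 (ltW wm).
  by rewrite leNgt => /negP; apply; exact: lt_le_trans ml t4.
have t5 : Kratio_neg mu2 (normc w2) <= Kratio_neg mu2 m by apply: Kratio_neg_le.
have : normc w1 <= x * (k * Kratio_neg mu2 m).
  rewrite e1 normcM normc_real normrN gtr0_norm//; apply: ler_wpM2l (ltW x0) _ _ _.
  by apply: le_trans le2 _; rewrite ler_pM2l.
have kh0 : 0 < k * Kratio_neg mu2 m by exact: mulr_gt0.
move: xd; rewrite ltr_pdivlMr// => h1 h2.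
by have := lt_le_trans (le_lt_trans h2 h1) we; rewrite ltxx.
Qed.

(** If h1(-1) <= h2(-1), put w1 = -1: by monotonicity K1(w1) = K2(w2) can be
    solved for w2 in [-1, 0[, and these two determine z. *)
Lemma solution_exists_negative mu1 mu2 (hmu1 : Mplus mu1) (hmu2 : Mplus mu2) :
  exists x w1 w2, x < 0 /\ solution mu1 mu2 x%:C w1 w2.
Proof.
wlog : mu1 mu2 hmu1 hmu2 / Kratio_neg mu1 1 <= Kratio_neg mu2 1.
  move=> H; have [/H|/ltW /H] := leP (Kratio_neg mu1 1) (Kratio_neg mu2 1).
    exact.
  move=> /(_ hmu2 hmu1) [x [w1 [w2 [x0 sol]]]].
  by exists x, w2, w1; split=> //; exact: solution_sym.
move=> le12; have h1 := Kratio_neg_gt0 hmu1 (@ltr01 R).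
have [s [s0 s1 sE]] := mul_Kratio_neg_surj hmu2 h1 le12.
exists (- (s / Kratio_neg mu1 1)), (-1)%:C, (- s)%:C; split.
  by rewrite oppr_lt0 divr_gt0.
have neg (t : R) : 0 < t -> upper_slit (- t)%:C.
  by move=> t0; rewrite /upper_slit /= eqxx oppr_lt0 t0 orbT.
have h2 := Kratio_neg_gt0 hmu2 s0.
split; [exact: neg|exact: neg| |]; rewrite Kratio_negE// -rmorphM /=; congr (_%:C).
  by field; rewrite gt_eqF.
by rewrite -sE; field; rewrite !gt_eqF.
Qed.

End APrioriBounds.

(** * A weighted norm on polynomials *)

Section PolynomialNorm.
Context {R : realType}.
Local Notation C := R[i].
Implicit Types (p q : {poly C}) (r : R).

(** The norm sum |a_n| r^n dominates the values on the disc of radius r, and is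
    submultiplicative. *)
Definition pnorm r p : R := \sum_(i < size p) normc p`_i * r ^+ i.

Lemma pnormE r p n : (size p <= n)%N ->
  pnorm r p = \sum_(i < n) normc p`_i * r ^+ i.
Proof.
move=> pn; rewrite /pnorm (big_ord_widen n (fun i => normc p`_i * r ^+ i) pn).
rewrite big_mkcond /=; apply: eq_bigr => i _; case: ifPn => //.
by rewrite -leqNgt => sp; rewrite nth_default// normc0 mul0r.
Qed.

Context (r : R) (r0 : 0 <= r).

Lemma pnorm_ge0 p : 0 <= pnorm r p.
Proof. by apply: sumr_ge0 => i _; rewrite mulr_ge0 ?normc_ge0 ?exprn_ge0. Qed.

Lemma pnormD p q : pnorm r (p + q) <= pnorm r p + pnorm r q.
Proof.
set n := maxn (size p) (size q).
rewrite (@pnormE r (p + q) n) ?size_polyD// (@pnormE r p n) ?leq_maxl//.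
rewrite (@pnormE r q n) ?leq_maxr// -big_split /=; apply: ler_sum => i _.
by rewrite -mulrDl ler_wpM2r ?exprn_ge0// coefD normcD.
Qed.

Lemma pnormZ (c : C) p : pnorm r (c *: p) <= normc c * pnorm r p.
Proof.
rewrite (@pnormE r (c *: p) (size p)) ?size_scale_leq// mulr_sumr.
by apply: ler_sum => i _; rewrite coefZ normcM mulrA.
Qed.

Lemma pnormMXn p n : pnorm r (p * 'X^n) <= pnorm r p * r ^+ n.
Proof.
have [->|p0] := eqVneq p 0.
  by rewrite mul0r /pnorm size_poly0 big_ord0 mul0r.
rewrite (@pnormE r (p * 'X^n) (n + size p)); last by rewrite size_mulXn.
rewrite big_split_ord /= [X in X + _]big1 ?add0r; last first.
  by move=> i _; rewrite coefMXn ltn_ord normc0 mul0r.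
rewrite mulr_suml; apply: ler_sum => i _.
by rewrite coefMXn ltnNge leq_addr /= addKn exprD mulrA mulrAC.
Qed.

Lemma pnorm_sum (I : Type) (s : seq I) (F : I -> {poly C}) :
  pnorm r (\sum_(i <- s) F i) <= \sum_(i <- s) pnorm r (F i).
Proof.
elim/big_ind2: _ => [|p1 x1 p2 x2 h1 h2|//].
  by rewrite /pnorm size_poly0 big_ord0.
by rewrite (le_trans (pnormD _ _))// lerD.
Qed.

Lemma pnormM p q : pnorm r (p * q) <= pnorm r p * pnorm r q.
Proof.
have -> : p * q = \sum_(i <- index_iota 0 (size q)) q`_i *: (p * 'X^i).
  rewrite -[in LHS](coefK q) poly_def mulr_sumr big_mkord.
  by apply: eq_bigr => i _; rewrite scalerAr.
apply: le_trans (pnorm_sum _ _) _; rewrite {3}/pnorm mulr_sumr big_mkord.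
apply: ler_sum => i _; apply: le_trans (pnormZ _ _) _.
by rewrite mulrCA ler_wpM2l ?normc_ge0// pnormMXn.
Qed.

Lemma pnormX p n : pnorm r (p ^+ n.+1) <= pnorm r p ^+ n.+1.
Proof.
elim: n => [|n IH]; first by rewrite !expr1.
rewrite exprS [leRHS]exprS; apply: le_trans (pnormM _ _) _.
by rewrite ler_wpM2l ?pnorm_ge0.
Qed.

Lemma pnorm_X : pnorm r 'X <= r.
Proof.
rewrite (@pnormE r 'X 2) ?size_polyX// !big_ord_recr big_ord0 /= !coefX /=.
by rewrite normc0 normc1 mul0r !add0r mul1r expr1.
Qed.

Lemma pnorm_take p n : pnorm r (take_poly n p) <= pnorm r p.
Proof.
rewrite (@pnormE r p (maxn n (size p))) ?leq_maxr//.
rewrite (@pnormE r (take_poly n p) (maxn n (size p))); last first.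
  by rewrite (leq_trans (size_take_poly _ _)) ?leq_maxl.
apply: ler_sum => i _; rewrite coef_take_poly ler_wpM2r ?exprn_ge0//.
by case: ifP => // _; rewrite normc0 normc_ge0.
Qed.

Lemma normc_horner_le p (t : C) : normc t <= r -> normc p.[t] <= pnorm r p.
Proof.
move=> tr; rewrite horner_coef /pnorm.
apply: (@le_trans _ _ (\sum_(i < size p) normc (p`_i * t ^+ i))).
  by elim/big_ind2: _ => [|x1 x2 y1 y2 h1 h2|//];
    [rewrite normc0 | rewrite (le_trans (normcD _ _))// lerD].
apply: ler_sum => i _; rewrite normcM normcX ler_wpM2l ?normc_ge0//.
by rewrite lerXn2r// ?nnegrE ?normc_ge0.
Qed.

(** On the disc of half the radius the term of degree i gains a factor 2^-i. *)
Lemma normc_horner_dvdXn p (t : C) n : normc t * 2 <= r -> 'X^n %| p ->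
  normc p.[t] <= pnorm r p * 2^-1 ^+ n.
Proof.
move=> tr /dvdpP [q pE].
have p0 i : (i < n)%N -> p`_i = 0 by move=> ni; rewrite pE coefMXn ni.
rewrite horner_coef /pnorm mulr_suml.
apply: (@le_trans _ _ (\sum_(i < size p) normc (p`_i * t ^+ i))).
  by elim/big_ind2: _ => [|x1 x2 y1 y2 h1 h2|//];
    [rewrite normc0 | rewrite (le_trans (normcD _ _))// lerD].
apply: ler_sum => i _; rewrite normcM normcX.
have [ni|ni] := ltnP i n; first by rewrite p0// normc0 !mul0r.
rewrite -mulrA ler_wpM2l ?normc_ge0//.
apply: (@le_trans _ _ ((r / 2) ^+ i)).
  by rewrite lerXn2r ?nnegrE ?normc_ge0 ?divr_ge0// ler_pdivlMr.
rewrite exprMn ler_wpM2l ?exprn_ge0// ler_wiXn2l//.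
by rewrite invf_le1// ler1n.
Qed.

End PolynomialNorm.

(** * Fixed points for the X-adic distance *)

Section AdicOperators.
Context {R : realType}.
Local Notation C := R[i].
Implicit Types (X Y : {poly C}) (T S : {poly C} -> {poly C} -> {poly C}).

(** X and Y are at X-adic distance at most 2^-m. *)
Definition agree m X Y : Prop := 'X^m %| (X - Y).

Lemma agree_refl m X : agree m X X.
Proof. by rewrite /agree subrr dvdp0. Qed.

Lemma agree_sym m X Y : agree m X Y -> agree m Y X.
Proof. by rewrite /agree -dvdpNr opprB. Qed.

Lemma agree_trans m X Y Z : agree m X Y -> agree m Y Z -> agree m X Z.
Proof. by move=> h1 h2; rewrite /agree -(subrKA Y); exact: dvdp_add. Qed.

Lemma agree_le m n X Y : (n <= m)%N -> agree m X Y -> agree n X Y.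
Proof. by move=> nm; apply: dvdp_trans; exact: dvdp_exp2l. Qed.

Lemma agree_take m X : agree m (take_poly m X) X.
Proof.
apply: agree_sym; rewrite /agree -{1}(poly_take_drop m X) addrAC subrr add0r.
exact: dvdp_mull.
Qed.

Lemma agree_coef m X Y i : agree m X Y -> (i < m)%N -> X`_i = Y`_i.
Proof.
move=> /dvdpP [q qE] im; apply/eqP; rewrite -subr_eq0 -coefB qE coefMXn im.
by [].
Qed.

(** Operators on pairs of polynomials without constant term: a lipschitz one
    does not increase the X-adic distance, a contracting one decreases it. *)
Definition adic_op (g : nat) T : Prop :=
  forall X Y, 'X %| X -> 'X %| Y -> 'X %| T X Y /\
  forall m X' Y', 'X %| X' -> 'X %| Y' -> agree m X X' -> agree m Y Y' ->
    agree (g + m) (T X Y) (T X' Y').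
Notation lipschitz_op := (adic_op 0).
Notation contracting_op := (adic_op 1).

Lemma contracting_lipschitz T : contracting_op T -> lipschitz_op T.
Proof.
move=> hT X Y X0 Y0; have [h1 h2] := hT X Y X0 Y0; split=> // m X' Y' *.
by apply: (@agree_le m.+1) => //; exact: h2.
Qed.

Lemma lipschitz_fst : lipschitz_op (fun X _ => X).
Proof. by []. Qed.

Lemma lipschitz_snd : lipschitz_op (fun _ Y => Y).
Proof. by []. Qed.

Lemma adic_cst g (P : {poly C}) : 'X %| P -> adic_op g (fun _ _ => P).
Proof. by move=> P0 X Y _ _; split=> // *; exact: agree_refl. Qed.

Lemma adic_opD g T S : adic_op g T -> adic_op g S ->
  adic_op g (fun X Y => T X Y + S X Y).
Proof.
move=> hT hS X Y X0 Y0; have [t1 t2] := hT X Y X0 Y0.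
have [s1 s2] := hS X Y X0 Y0; split; first exact: dvdp_add.
move=> m X' Y' X'0 Y'0 hX hY.
rewrite /agree opprD addrACA; apply: dvdp_add; first exact: t2.
exact: s2.
Qed.

Lemma adic_opZ g (c : C) T : adic_op g T -> adic_op g (fun X Y => c *: T X Y).
Proof.
move=> hT X Y X0 Y0; have [t1 t2] := hT X Y X0 Y0.
split; first by rewrite -mul_polyC; exact: dvdp_mull.
move=> m X' Y' X'0 Y'0 hX hY; rewrite /agree -scalerBr -mul_polyC.
by apply: dvdp_mull; exact: t2.
Qed.

(** The gain comes from the other factor, which is divisible by 'X. *)
Lemma contracting_opM T S : lipschitz_op T -> lipschitz_op S ->
  contracting_op (fun X Y => T X Y * S X Y).
Proof.
move=> hT hS X Y X0 Y0; have [t1 t2] := hT X Y X0 Y0.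
have [s1 s2] := hS X Y X0 Y0; split; first exact: dvdp_mulr.
move=> m X' Y' X'0 Y'0 hX hY; rewrite /agree.
have -> : T X Y * S X Y - T X' Y' * S X' Y' =
  S X Y * (T X Y - T X' Y') + T X' Y' * (S X Y - S X' Y') by ring.
have [t1' _] := hT X' Y' X'0 Y'0.
by rewrite add1n exprS; apply: dvdp_add; apply: dvdp_mul => //; [exact: t2|exact: s2].
Qed.

Lemma adic_op_sum g (I : Type) (s : seq I) (T : I -> {poly C} -> {poly C} -> {poly C}) :
  (forall i, adic_op g (T i)) -> adic_op g (fun X Y => \sum_(i <- s) T i X Y).
Proof.
move=> hT; elim: s => [|i s IH].
  rewrite (_ : (fun _ _ => _) = fun _ _ => 0); last first.
    by apply/funext => X; apply/funext => Y; rewrite big_nil.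
  by apply: adic_cst; exact: dvdp0.
rewrite (_ : (fun X Y => \sum_(j <- i :: s) T j X Y) =
  fun X Y => T i X Y + \sum_(j <- s) T j X Y); last first.
  by apply/funext => X; apply/funext => Y; rewrite big_cons.
exact: adic_opD.
Qed.

End AdicOperators.
Notation lipschitz_op := (adic_op 0).
Notation contracting_op := (adic_op 1).

Section AdicFixpoint.
Context {R : realType}.
Local Notation C := R[i].
Context (T1 T2 : nat -> {poly C} -> {poly C} -> {poly C}) (r rho : R).
Hypotheses (r0 : 0 <= r) (rho0 : 0 <= rho).
Hypotheses (cT1 : forall k, contracting_op (T1 k))
           (cT2 : forall k, contracting_op (T2 k)).
Hypotheses
  (aT1 : forall k X Y, 'X %| X -> 'X %| Y -> agree k.+1 (T1 k X Y) (T1 k.+1 X Y))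
  (aT2 : forall k X Y, 'X %| X -> 'X %| Y -> agree k.+1 (T2 k X Y) (T2 k.+1 X Y)).
Hypothesis nT : forall k X Y, pnorm r X <= rho -> pnorm r Y <= rho ->
  pnorm r (T1 k X Y) <= rho /\ pnorm r (T2 k X Y) <= rho.

(** The iterate of order k has the right coefficients up to degree k; the
    truncation makes it a polynomial of that degree. *)
Fixpoint adic_iter k : {poly C} * {poly C} :=
  if k is k'.+1 then
    let: (X, Y) := adic_iter k' in
    (take_poly k'.+2 (T1 k'.+1 X Y), take_poly k'.+2 (T2 k'.+1 X Y))
  else (0, 0).

Let X_ k := (adic_iter k).1.
Let Y_ k := (adic_iter k).2.

Let X_S k : X_ k.+1 = take_poly k.+2 (T1 k.+1 (X_ k) (Y_ k)).
Proof. by rewrite /X_ /Y_ /=; case: (adic_iter k). Qed.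

Let Y_S k : Y_ k.+1 = take_poly k.+2 (T2 k.+1 (X_ k) (Y_ k)).
Proof. by rewrite /X_ /Y_ /=; case: (adic_iter k). Qed.

Lemma dvdX_take m (P : {poly C}) : 'X %| P -> 'X %| take_poly m.+1 P.
Proof.
move=> XP; rewrite -(subrK P (take_poly m.+1 P)); apply: dvdp_add => //.
by apply: dvdp_trans (agree_take m.+1 P); rewrite exprS dvdp_mulr.
Qed.

Let XY0 k : 'X %| X_ k /\ 'X %| Y_ k.
Proof.
elim: k => [|k [h1 h2]]; first by split; exact: dvdp0.
rewrite X_S Y_S; split; apply: dvdX_take.
  exact: (cT1 _ h1 h2).1.
exact: (cT2 _ h1 h2).1.
Qed.

Let XY_norm k : pnorm r (X_ k) <= rho /\ pnorm r (Y_ k) <= rho.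
Proof.
elim: k => [|k [h1 h2]].
  by rewrite /X_ /Y_ /= /pnorm size_poly0 big_ord0.
have [n1 n2] := nT k.+1 h1 h2.
by rewrite X_S Y_S; split; apply: le_trans (pnorm_take _ _ _) _.
Qed.

Let X_agree k : agree k.+2 (X_ k.+1) (T1 k.+1 (X_ k) (Y_ k)).
Proof. by rewrite X_S; exact: agree_take. Qed.

Let Y_agree k : agree k.+2 (Y_ k.+1) (T2 k.+1 (X_ k) (Y_ k)).
Proof. by rewrite Y_S; exact: agree_take. Qed.

Let XY_step k : agree k.+1 (X_ k.+1) (X_ k) /\ agree k.+1 (Y_ k.+1) (Y_ k).
Proof.
elim: k => [|k [h1 h2]].
  have [a1 a2] := XY0 1; have [b1 b2] := XY0 0.
  by rewrite /agree expr1; split; rewrite dvdp_sub.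
have [a1 a2] := XY0 k; have [b1 b2] := XY0 k.+1; split.
  apply: agree_trans (agree_le (leqnSn _) (X_agree _)) _.
  apply: agree_trans _ (agree_sym (X_agree _)).
  apply: agree_trans _ (agree_sym (aT1 _ a1 a2)).
  exact: ((cT1 _ b1 b2).2 _ _ _ a1 a2 h1 h2).
apply: agree_trans (agree_le (leqnSn _) (Y_agree _)) _.
apply: agree_trans _ (agree_sym (Y_agree _)).
apply: agree_trans _ (agree_sym (aT2 _ a1 a2)).
exact: ((cT2 _ b1 b2).2 _ _ _ a1 a2 h1 h2).
Qed.

Let XY_size k : (size (X_ k) <= k.+1)%N /\ (size (Y_ k) <= k.+1)%N.
Proof.
case: k => [|k]; first by rewrite /X_ /Y_ /= size_poly0.
by rewrite X_S Y_S !size_take_poly.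
Qed.

Let coef_stable (Z_ : nat -> {poly C}) :
  (forall k, agree k.+1 (Z_ k.+1) (Z_ k)) -> (forall k, (size (Z_ k) <= k.+1)%N) ->
  forall k, Z_ k = \poly_(n < k.+1) (Z_ n)`_n.
Proof.
move=> st sz k; apply/polyP => n; rewrite coef_poly ltnS.
case: leqP => [nk|kn]; last by rewrite nth_default// (leq_trans (sz k)).
have [d ->] : exists d, k = (n + d)%N by exists (k - n)%N; rewrite subnKC.
elim: d => [|d IH]; first by rewrite addn0.
by rewrite addnS (agree_coef (st _)) ?IH// ltnS leq_addr.
Qed.

Let XY_residual k :
  agree k.+1 (X_ k) (T1 k (X_ k) (Y_ k)) /\ agree k.+1 (Y_ k) (T2 k (X_ k) (Y_ k)).
Proof.
have [a1 a2] := XY0 k; case: k a1 a2 => [|k] a1 a2.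
  have [t1 _] := cT1 0 a1 a2; have [t2 _] := cT2 0 a1 a2.
  by rewrite /agree expr1; split; rewrite dvdp_sub.
have [b1 b2] := XY0 k; have [h1 h2] := XY_step k.
split.
  apply: agree_trans (X_agree _) _.
  by apply: ((cT1 _ b1 b2).2 _ _ _ a1 a2); exact: agree_sym.
apply: agree_trans (Y_agree _) _.
by apply: ((cT2 _ b1 b2).2 _ _ _ a1 a2); exact: agree_sym.
Qed.

(** Formal power series solving (X, Y) = (T1 (X, Y), T2 (X, Y)), with a bound
    on the weighted sum of their coefficients. The coefficients are determined
    one after the other, since the operators contract the X-adic distance; the
    bound holds because the iteration starts, and so stays, in an invariant ball.
    The operators T1 k and T2 k are polynomial approximations, exact up to
    degree k, of operators given by power series. *)
Lemma adic_fixpoint : exists x y : nat -> C, forall k,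
  let X := \poly_(n < k.+1) x n in let Y := \poly_(n < k.+1) y n in
  [/\ pnorm r X <= rho, pnorm r Y <= rho,
      agree k.+1 X (T1 k X Y) & agree k.+1 Y (T2 k X Y)].
Proof.
exists (fun n => (X_ n)`_n), (fun n => (Y_ n)`_n) => k /=.
rewrite -(coef_stable (fun k => (XY_step k).1) (fun k => (XY_size k).1)).
rewrite -(coef_stable (fun k => (XY_step k).2) (fun k => (XY_size k).2)).
by have [n1 n2] := XY_norm k; have [s1 s2] := XY_residual k.
Qed.

End AdicFixpoint.

Section GeometricSeries.
Context {R : realType}.

Lemma tends_geometric_series (a : nat -> R[i]) (M : R) :
  (forall n, normc (a n) <= M * 2^-1 ^+ n) ->
  exists l : R[i], tends (fun N => \sum_(n < N) a n) l.
Proof.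
move=> aM.
have half : `|2^-1 : R| < 1 by rewrite ger0_norm ?invr_ge0// invf_lt1// ltr1n.
have cvR (u : nat -> R) : (forall n, `|u n| <= M * 2^-1 ^+ n) -> cvgn (series u).
  move=> uM; apply: normed_cvg.
  apply: (@series_le_cvg _ _ (geometric M 2^-1)) => //; first by move=> n /=.
    by move=> n /=; exact: le_trans (uM n).
  exact: is_cvg_geometric_series.
have /cvg_ex[/= lr cr] : cvgn (series (fun n => complex.Re (a n))).
  by apply: cvR => n; exact: le_trans (normc_Re _) (aM n).
have /cvg_ex[/= li ci] : cvgn (series (fun n => complex.Im (a n))).
  by apply: cvR => n; exact: le_trans (normc_Im _) (aM n).
exists (lr +i* li) => e e0.
have e2 : 0 < e / 2 by rewrite divr_gt0.
have ReS n : complex.Re (\sum_(k < n) a k) = series (fun n => complex.Re (a n)) n.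
  rewrite seriesEnat /= big_mkord.
  by elim/big_ind2: _ => // x1 x2 y1 y2 <- <-; exact: ReD.
have ImS n : complex.Im (\sum_(k < n) a k) = series (fun n => complex.Im (a n)) n.
  rewrite seriesEnat /= big_mkord.
  by elim/big_ind2: _ => // x1 x2 y1 y2 <- <-; exact: ImD.
near=> n; apply: le_lt_trans (normc_le _) _.
rewrite [e]splitr !ReIm_simp ReS ImS /= ltrD//.
  by near: n; move/cvgrPdist_lt: cr; exact.
by near: n; move/cvgrPdist_lt: ci; exact.
Unshelve. all: by end_near.
Qed.

End GeometricSeries.

(** * An analytic implicit function theorem *)

Section ImplicitSystem.
Context {R : realType}.
Local Notation C := R[i].
Implicit Types (X Y Z : {poly C}) (a b u v t z : C) (c d : nat -> C).

(** Quantitative analyticity at a: bounds on the coefficients, on the remainders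
    and on the Lipschitz constant, the latter two on the disc of radius
    1 / (2 L). *)
Definition taylor_at (f : C -> C) a c (M L : R) : Prop :=
  [/\ 0 < L, 0 <= M, forall n, normc (c n) <= M * L ^+ n,
      forall u N, normc u * (2 * L) <= 1 ->
        normc (f (a + u) - \sum_(n < N) u ^+ n * c n) <= M * (normc u * L) ^+ N
    & forall u v, normc u * (2 * L) <= 1 -> normc v * (2 * L) <= 1 ->
        normc (f (a + u) - f (a + v)) <= 2 * L * M * normc (u - v)].

(** If the c n are the Taylor coefficients of f at a, these truncate
    f(a + Z) - f(a) and f(a + Z) - f(a) - f'(a) Z. *)
Definition psum c k Z := \sum_(n < k) c n.+1 *: Z ^+ n.+1.
Definition psum2 c k Z := \sum_(n < k) c n.+2 *: Z ^+ n.+2.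

(** The increment of z0 - a b when (z0, a, b) becomes (z0 + 'X, a + X, b + Y). *)
Definition denop a b X Y : {poly C} :=
  'X + (- a) *: Y + (- b) *: X + (- 1) *: (X * Y).

(** What remains of (z0 + 'X - (a + X) (b + Y)) f(a + Z) when its affine part in
    'X, X, Y and Z is removed. *)
Definition errop z0 a b c k X Y Z : {poly C} :=
  (z0 - a * b) *: psum2 c k Z + (- c 0) *: (X * Y) + denop a b X Y * psum c k Z.

Lemma lipschitz_exp (T : {poly C} -> {poly C} -> {poly C}) n :
  lipschitz_op T -> lipschitz_op (fun X Y => T X Y ^+ n.+1).
Proof.
move=> hT; elim: n => [|n IH]; first exact: hT.
rewrite (_ : (fun _ _ => _) = fun X Y => T X Y * T X Y ^+ n.+1).
  by apply: contracting_lipschitz; exact: contracting_opM.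
by apply/funext => X; apply/funext => Y; rewrite exprS.
Qed.

Section Operator.
Context (T : {poly C} -> {poly C} -> {poly C}) (hT : lipschitz_op T).

Lemma psum_lipschitz c k : lipschitz_op (fun X Y => psum c k (T X Y)).
Proof. by apply: adic_op_sum => n; apply: adic_opZ; exact: lipschitz_exp. Qed.

Lemma psum2_contracting c k : contracting_op (fun X Y => psum2 c k (T X Y)).
Proof.
apply: adic_op_sum => n; apply: adic_opZ.
rewrite (_ : (fun _ _ => _) = fun X Y => T X Y * T X Y ^+ n.+1).
  by apply: contracting_opM => //; exact: lipschitz_exp.
by apply/funext => X; apply/funext => Y; rewrite exprS.
Qed.

Lemma denop_lipschitz a b : lipschitz_op (denop a b).
Proof.
apply: adic_opD; last first.
  apply: adic_opZ; apply: contracting_lipschitz.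
  by apply: contracting_opM; [exact: lipschitz_fst | exact: lipschitz_snd].
apply: adic_opD; last by apply: adic_opZ; exact: lipschitz_fst.
apply: adic_opD; last by apply: adic_opZ; exact: lipschitz_snd.
exact: adic_cst.
Qed.

Lemma errop_contracting z0 a b c k :
  contracting_op (fun X Y => errop z0 a b c k X Y (T X Y)).
Proof.
apply: adic_opD; last first.
  by apply: contracting_opM; [exact: denop_lipschitz | exact: psum_lipschitz].
apply: adic_opD; first by apply: adic_opZ; exact: psum2_contracting.
apply: adic_opZ.
by apply: contracting_opM; [exact: lipschitz_fst | exact: lipschitz_snd].
Qed.

End Operator.

Lemma errop_agree z0 a b c k X Y Z : 'X %| X -> 'X %| Y -> 'X %| Z ->
  agree k.+1 (errop z0 a b c k X Y Z) (errop z0 a b c k.+1 X Y Z).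
Proof.
move=> X0 Y0 Z0; apply: agree_sym; rewrite /agree.
have -> : errop z0 a b c k.+1 X Y Z - errop z0 a b c k X Y Z =
   ((z0 - a * b) * c k.+2) *: (Z ^+ k.+1 * Z) + (denop a b X Y * (c k.+1)%:P) * Z ^+ k.+1.
  rewrite /errop /psum /psum2 !big_ord_recr /= scalerDr scalerA -exprSr.
  by rewrite -!mul_polyC; ring.
have Zk : 'X^(k.+1) %| Z ^+ k.+1 by exact: dvdp_exp2r.
apply: dvdp_add; last exact: dvdp_mull.
by rewrite -mul_polyC; apply: dvdp_mull; exact: dvdp_mulr.
Qed.

Section Norms.
Context (c : nat -> C) (M L rho r : R).
Hypotheses (L0 : 0 < L) (M0 : 0 <= M) (cL : forall n, normc (c n) <= M * L ^+ n).
Hypotheses (r0 : 0 <= r) (r_rho : r <= rho) (rhoL : rho * (2 * L) <= 1) (rho1 : rho <= 1).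

Let rho0 : 0 <= rho. Proof. exact: le_trans r_rho. Qed.

Lemma sum_half_le k : \sum_(n < k) (2^-1 : R) ^+ n <= 2.
Proof.
suff -> : \sum_(n < k) (2^-1 : R) ^+ n = 2 - 2 * 2^-1 ^+ k.
  by rewrite lerBlDr lerDl mulr_ge0// exprn_ge0// invr_ge0.
elim: k => [|k IH]; first by rewrite big_ord0 expr0; ring.
by rewrite big_ord_recr /= IH exprS; field.
Qed.

Lemma pnorm_psum_shift j k Z : pnorm r Z <= rho ->
  pnorm r (\sum_(n < k) c (n + j.+1) *: Z ^+ (n + j.+1)) <=
  2 * M * (L * rho) ^+ j.+1.
Proof.
move=> Zr; apply: le_trans (pnorm_sum r0 _ _) _.
apply: (@le_trans _ _ (\sum_(n < k) M * (L * rho) ^+ j.+1 * 2^-1 ^+ n)).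
  apply: ler_sum => n _; apply: le_trans (pnormZ _ _ _) _.
  apply: (@le_trans _ _ (M * L ^+ (n + j.+1) * rho ^+ (n + j.+1))).
    apply: ler_pM; rewrite ?normc_ge0 ?pnorm_ge0 ?cL//.
    rewrite addnS; apply: le_trans (pnormX r0 _ _) _.
    by rewrite lerXn2r ?nnegrE ?pnorm_ge0.
  rewrite -mulrA -exprMn -mulrA ler_wpM2l// exprD mulrC.
  rewrite ler_wpM2l ?exprn_ge0 ?mulr_ge0 ?(ltW L0)//.
  rewrite lerXn2r ?nnegrE ?mulr_ge0 ?(ltW L0) ?invr_ge0//.
  by rewrite -div1r ler_pdivlMr//; move: rhoL; lra.
rewrite -mulr_sumr.
have -> : 2 * M * (L * rho) ^+ j.+1 = M * (L * rho) ^+ j.+1 * 2 by ring.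
rewrite ler_wpM2l ?sum_half_le// mulr_ge0// exprn_ge0// mulr_ge0//.
exact: ltW.
Qed.

Lemma pnorm_psum k Z : pnorm r Z <= rho -> pnorm r (psum c k Z) <= 2 * M * (L * rho).
Proof.
move=> /(pnorm_psum_shift 0 k); rewrite expr1; congr (pnorm r _ <= _).
by apply: eq_bigr => n _; rewrite addn1.
Qed.

Lemma pnorm_psum2 k Z : pnorm r Z <= rho ->
  pnorm r (psum2 c k Z) <= 2 * M * (L * rho) ^+ 2.
Proof.
move=> /(pnorm_psum_shift 1 k); congr (pnorm r _ <= _).
by apply: eq_bigr => n _; rewrite addn2.
Qed.

Lemma pnorm_denop a b X Y : pnorm r X <= rho -> pnorm r Y <= rho ->
  pnorm r (denop a b X Y) <= (2 + normc a + normc b) * rho.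
Proof.
move=> hX hY; have h1 := pnorm_X r.
have h2 : pnorm r ((- a) *: Y) <= normc a * rho.
  by apply: le_trans (pnormZ _ _ _) _; rewrite normc_opp ler_wpM2l ?normc_ge0.
have h3 : pnorm r ((- b) *: X) <= normc b * rho.
  by apply: le_trans (pnormZ _ _ _) _; rewrite normc_opp ler_wpM2l ?normc_ge0.
have h4 : pnorm r ((-1) *: (X * Y)) <= rho.
  apply: le_trans (pnormZ _ _ _) _; rewrite normc_opp normc1 mul1r.
  apply: le_trans (pnormM r0 _ _) _; rewrite -[leRHS]mulr1.
  by rewrite ler_pM ?pnorm_ge0//; exact: le_trans hY rho1.
rewrite /denop; apply: le_trans (pnormD r0 _ _) _.
apply: le_trans (lerD (pnormD r0 _ _) (lexx _)) _.
apply: le_trans (lerD (lerD (pnormD r0 _ _) (lexx _)) (lexx _)) _.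
by move: h1 h2 h3 h4 r_rho; lra.
Qed.

(** Every term has degree at least two in the small quantities. *)
Lemma pnorm_errop z a b k X Y Z :
  pnorm r X <= rho -> pnorm r Y <= rho -> pnorm r Z <= rho ->
  pnorm r (errop z a b c k X Y Z) <=
  rho ^+ 2 * (normc (z - a * b) * (2 * M * L ^+ 2) + M
              + (2 + normc a + normc b) * (2 * M * L)).
Proof.
move=> hX hY hZ.
have h1 : pnorm r ((z - a * b) *: psum2 c k Z) <=
    normc (z - a * b) * (2 * M * (L * rho) ^+ 2).
  apply: le_trans (pnormZ _ _ _) _.
  by rewrite ler_wpM2l ?normc_ge0 ?pnorm_psum2.
have h2 : pnorm r ((- c 0) *: (X * Y)) <= M * (rho * rho).
  apply: le_trans (pnormZ _ _ _) _; rewrite normc_opp.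
  apply: ler_pM; rewrite ?normc_ge0 ?pnorm_ge0//.
    by have := cL 0; rewrite expr0 mulr1.
  by apply: le_trans (pnormM r0 _ _) _; rewrite ler_pM ?pnorm_ge0.
have h3 : pnorm r (denop a b X Y * psum c k Z) <=
   (2 + normc a + normc b) * rho * (2 * M * (L * rho)).
  apply: le_trans (pnormM r0 _ _) _.
  by rewrite ler_pM ?pnorm_ge0 ?pnorm_denop ?pnorm_psum.
rewrite /errop; apply: le_trans (pnormD r0 _ _) _.
apply: le_trans (lerD (pnormD r0 _ _) (lexx _)) _.
apply: le_trans (lerD (lerD h1 h2) h3) _.
by rewrite le_eqVlt; apply/orP; left; apply/eqP; ring.
Qed.

End Norms.

Lemma horner_psum c k (Z : {poly C}) t :
  (psum c k Z).[t] = \sum_(n < k.+1) Z.[t] ^+ n * c n - c 0.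
Proof.
rewrite /psum horner_sum big_ord_recl expr0 mul1r addrC addKr.
by apply: eq_bigr => n _; rewrite hornerZ horner_exp mulrC.
Qed.

Lemma horner_psum2 c k (Z : {poly C}) t :
  (psum2 c k Z).[t] = \sum_(n < k.+2) Z.[t] ^+ n * c n - c 0 - Z.[t] * c 1.
Proof.
rewrite /psum2 horner_sum.
have -> : \sum_(n < k.+2) Z.[t] ^+ n * c n =
    c 0 + Z.[t] * c 1 + \sum_(n < k) Z.[t] ^+ n.+2 * c n.+2.
  by rewrite 2!big_ord_recl addrA expr0 mul1r expr1.
have -> : \sum_(i < k) (c i.+2 *: Z ^+ i.+2).[t] =
    \sum_(n < k) Z.[t] ^+ n.+2 * c n.+2.
  by apply: eq_bigr => n _; rewrite hornerZ horner_exp mulrC.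
by move: (\sum_(n < k) _) => s; ring.
Qed.

Section Limits.
Context (f : C -> C) (a : C) (c : nat -> C) (M L : R).
Hypothesis tf : taylor_at f a c M L.

(** The truncation order may follow the approximation of u: the tails are
    bounded uniformly by a geometric sequence. *)
Lemma taylor_tends j (u_ : nat -> C) (u : C) :
  (forall k, normc (u_ k) * (2 * L) <= 1) -> normc u * (2 * L) <= 1 ->
  tends u_ u ->
  tends (fun k => \sum_(n < k + j.+1) u_ k ^+ n * c n) (f (a + u)).
Proof.
case: tf => L0 M0 cL T0 lip hu_ hu cu.
apply: (@tends_geometric_dist _ (fun k => f (a + u_ k)) _ _ M).
  have LM : 0 < 2 * L * M + 1 by rewrite ltr_wpDl// !mulr_ge0// ltW.
  move=> e e0; near=> k; apply: le_lt_trans (lip _ _ hu (hu_ k)) _.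
  have : normc (u - u_ k) < e / (2 * L * M + 1).
    by near: k; apply: cu; rewrite divr_gt0.
  rewrite ltr_pdivlMr// mulrDr mulr1 mulrC => h.
  by apply: le_lt_trans h; rewrite lerDl normc_ge0.
move=> k; apply: le_trans (T0 _ (k + j.+1)%N (hu_ k)) _.
rewrite ler_wpM2l//; apply: (@le_trans _ _ (2^-1 ^+ (k + j.+1))).
  rewrite lerXn2r ?nnegrE ?mulr_ge0 ?normc_ge0 ?(ltW L0) ?invr_ge0//.
  by rewrite -div1r ler_pdivlMr//; have := hu_ k; lra.
by rewrite ler_wiXn2l ?leq_addr ?invr_ge0// invf_le1// ler1n.
Unshelve. all: by end_near.
Qed.

End Limits.
End ImplicitSystem.

Section ImplicitSolution.
Context {R : realType}.
Local Notation C := R[i].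
Implicit Types (a b t z x y : C) (c d : nat -> C).

(** Cramer's rule. *)
Lemma linear_system_solution (m1 m2 q1 q2 e1 e2 : C) :
  q1 != 0 -> q2 != 0 -> 1 - m1 / q1 * (m2 / q2) != 0 ->
  let D := 1 - m1 / q1 * (m2 / q2) in
  let x := (m2 / q2 * (e1 / q1) + e2 / q2) / D in
  let y := (m1 / q1 * (e2 / q2) + e1 / q1) / D in
  q1 * y = m1 * x + e1 /\ q2 * x = m2 * y + e2.
Proof.
move=> q10 q20 D0 D x y; rewrite /x /y /D.
have D0' : q1 * q2 - m1 * m2 != 0.
  apply: contra_neq D0 => h; have -> : 1 - m1 / q1 * (m2 / q2) =
    (q1 * q2 - m1 * m2) / (q1 * q2) by field; rewrite q10 q20.
  by rewrite h mul0r.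
by split; field; rewrite q10 q20 D0'.
Qed.

(** A uniform bound on the norms of the partial sums is a bound on the sum of
    all |x_n| r^n. *)
Lemma pnorm_power_series (x : nat -> C) (rho r : R) : 0 <= r ->
  (forall k, pnorm r (\poly_(n < k.+1) x n) <= rho) ->
  forall t, normc t * 2 <= r -> exists xt : C,
    [/\ tends (fun N => \sum_(n < N) x n * t ^+ n) xt, normc xt <= rho &
        tends (fun k => (\poly_(n < k.+1) x n).[t]) xt].
Proof.
move=> r0 nx t tr.
have tr' : normc t <= r by have := normc_ge0 t; lra.
have [n|l cl] := @tends_geometric_series R (fun n => x n * t ^+ n) rho.
  rewrite normcM normcX.
  apply: (@le_trans _ _ (normc (x n) * (r / 2) ^+ n)).
    rewrite ler_wpM2l ?normc_ge0// lerXn2r ?nnegrE ?normc_ge0 ?divr_ge0//.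
    by rewrite ler_pdivlMr.
  rewrite exprMn mulrA ler_wpM2r ?exprn_ge0 ?invr_ge0//.
  apply: le_trans (nx n); rewrite (@pnormE _ r _ n.+1) ?size_poly// big_ord_recr /=.
  rewrite coef_poly ltnSn lerDr sumr_ge0// => i _.
  by rewrite mulr_ge0 ?normc_ge0 ?exprn_ge0.
have cS : tends (fun k => (\poly_(n < k.+1) x n).[t]) l.
  rewrite (_ : (fun k => _) = fun k => \sum_(n < k.+1) x n * t ^+ n).
    exact: tends_shift cl.
  by apply/funext => k; rewrite horner_poly.
exists l; split=> //; apply: tends_normc_le cS _ => k.
exact: le_trans (normc_horner_le r0 _ tr') (nx k).
Qed.

Lemma horner_denop a b (X Y : {poly C}) t :
  (denop a b X Y).[t] = t - a * Y.[t] - b * X.[t] - X.[t] * Y.[t].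
Proof. by rewrite /denop !hornerD !hornerZ hornerM hornerX; ring. Qed.

Lemma horner_errop z a b c k (X Y Z : {poly C}) t :
  (errop z a b c k X Y Z).[t] =
  (z - a * b) * (\sum_(n < k + 2) Z.[t] ^+ n * c n - c 0 - Z.[t] * c 1)
  - c 0 * (X.[t] * Y.[t])
  + (t - a * Y.[t] - b * X.[t] - X.[t] * Y.[t]) *
    (\sum_(n < k + 1) Z.[t] ^+ n * c n - c 0).
Proof.
rewrite /errop !hornerD hornerM !hornerZ horner_denop horner_psum horner_psum2.
by rewrite hornerM addn1 addn2 mulNr.
Qed.

Section Solve.
Context (f g : C -> C) (a b z0 : C) (c d : nat -> C).
Local Notation D := (z0 - a * b).
Local Notation q1 := (1 + a * c 0).
Local Notation q2 := (1 + b * d 0).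
Local Notation m1 := (D * c 1 - b * c 0).
Local Notation m2 := (D * d 1 - a * d 0).
Hypotheses (eb : b = D * c 0) (ea : a = D * d 0).
Hypotheses (q1n : q1 != 0) (q2n : q2 != 0) (Dn : 1 - m1 / q1 * (m2 / q2) != 0).

Let De := 1 - m1 / q1 * (m2 / q2).

(* The remainders of both equations, once their linear parts are removed. *)
Let err1 (t x y : C) := D * (f (a + x) - c 0 - x * c 1) - c 0 * (x * y) +
  (t - a * y - b * x - x * y) * (f (a + x) - c 0).
Let err2 (t x y : C) := D * (g (b + y) - d 0 - y * d 1) - d 0 * (x * y) +
  (t - a * y - b * x - x * y) * (g (b + y) - d 0).

(** The hypotheses are the system with its linear part in (x, y) inverted. *)
Lemma fixpoint_solves t x y :
  x = (m2 / q2 * (c 0 / q1) + d 0 / q2) / De * t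
      + m2 / q2 / q1 / De * err1 t x y + (q2 * De)^-1 * err2 t x y ->
  y = (m1 / q1 * (d 0 / q2) + c 0 / q1) / De * t
      + (q1 * De)^-1 * err1 t x y + m1 / q1 / q2 / De * err2 t x y ->
  b + y = (z0 + t - (a + x) * (b + y)) * f (a + x) /\
  a + x = (z0 + t - (a + x) * (b + y)) * g (b + y).
Proof.
move=> ex ey.
have [] := linear_system_solution (c 0 * t + err1 t x y) (d 0 * t + err2 t x y) q1n q2n Dn.
have <- : x = (m2 / q2 * ((c 0 * t + err1 t x y) / q1) + (d 0 * t + err2 t x y) / q2) / De.
  rewrite {1}ex; move: (err1 t x y) (err2 t x y) (Dn : De != 0) => e1 e2.
  by move: De => de hde; field; rewrite hde q1n q2n.
have <- : y = (m1 / q1 * ((d 0 * t + err2 t x y) / q2) + (c 0 * t + err1 t x y) / q1) / De.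
  rewrite {1}ey; move: (err1 t x y) (err2 t x y) (Dn : De != 0) => e1 e2.
  by move: De => de hde; field; rewrite hde q1n q2n.
rewrite /err1 /err2; move: (f _) (g _) => F G h1 h2; split.
  apply/eqP; rewrite -subr_eq0; apply/eqP.
  transitivity ((b - D * c 0) + (q1 * y - (m1 * x + (c 0 * t + (D * (F - c 0 - x * c 1) -
     c 0 * (x * y) + (t - a * y - b * x - x * y) * (F - c 0)))))); first by ring.
  by rewrite -eb subrr h1 subrr addr0.
apply/eqP; rewrite -subr_eq0; apply/eqP.
transitivity ((a - D * d 0) + (q2 * x - (m2 * y + (d 0 * t + (D * (G - d 0 - y * d 1) -
   d 0 * (x * y) + (t - a * y - b * x - x * y) * (G - d 0)))))); first by ring.
by rewrite -ea subrr h2 subrr addr0.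
Qed.

End Solve.
End ImplicitSolution.

Section ImplicitTheorem.
Context {R : realType}.
Local Notation C := R[i].
Context (f g : C -> C) (a b z0 : C) (c d : nat -> C) (M L : R).
Hypotheses (tf : taylor_at f a c M L) (tg : taylor_at g b d M L).
Local Notation D := (z0 - a * b).
Local Notation q1 := (1 + a * c 0).
Local Notation q2 := (1 + b * d 0).
Local Notation m1 := (D * c 1 - b * c 0).
Local Notation m2 := (D * d 1 - a * d 0).
Hypotheses (eb : b = D * c 0) (ea : a = D * d 0).
Hypotheses (q1n : q1 != 0) (q2n : q2 != 0) (Dn : 1 - m1 / q1 * (m2 / q2) != 0).

Lemma errop_tends (h : C -> C) (s : C) (e : nat -> C) (X_ Y_ Z_ : nat -> {poly C})
    (t x y z : C) : taylor_at h s e M L ->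
  (forall k, normc (Z_ k).[t] * (2 * L) <= 1) -> normc z * (2 * L) <= 1 ->
  tends (fun k => (X_ k).[t]) x -> tends (fun k => (Y_ k).[t]) y ->
  tends (fun k => (Z_ k).[t]) z ->
  tends (fun k => (errop z0 a b e k (X_ k) (Y_ k) (Z_ k)).[t])
    (D * (h (s + z) - e 0 - z * e 1) - e 0 * (x * y) +
     (t - a * y - b * x - x * y) * (h (s + z) - e 0)).
Proof.
move=> te hZ hz cX cY cZ; have cst := @tends_cst R.
have c1 := taylor_tends te 0 hZ hz cZ; have c2 := taylor_tends te 1 hZ hz cZ.
rewrite (_ : (fun k => _) = fun k =>
  D * (\sum_(n < k + 2) (Z_ k).[t] ^+ n * e n - e 0 - (Z_ k).[t] * e 1)
  - e 0 * ((X_ k).[t] * (Y_ k).[t])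
  + (t - a * (Y_ k).[t] - b * (X_ k).[t] - (X_ k).[t] * (Y_ k).[t]) *
    (\sum_(n < k + 1) (Z_ k).[t] ^+ n * e n - e 0)); last first.
  by apply/funext => k; rewrite horner_errop.
apply: tendsD.
  apply: tendsB; last by apply: tendsM => //; exact: tendsM.
  apply: tendsM => //; apply: tendsB; last exact: tendsM.
  exact: tendsB.
apply: tendsM; last exact: tendsB.
apply: tendsB; last exact: tendsM.
by apply: tendsB; [apply: tendsB => //|]; exact: tendsM.
Qed.

(** Analytic implicit function theorem for the system
    b + y = (z0 + t - (a + x) (b + y)) f (a + x),
    a + x = (z0 + t - (a + x) (b + y)) g (b + y),
    solvable for (x, y) because 1 - m1 m2 / (q1 q2) is, up to a nonzero factor,
    the determinant of its linear part. *)
Lemma implicit_system (eta : R) : 0 < eta ->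
  exists (r : R) (x y : nat -> C), 0 < r /\ forall t, normc t < r ->
    exists xt yt : C,
      [/\ tends (fun N => \sum_(n < N) x n * t ^+ n) xt,
          tends (fun N => \sum_(n < N) y n * t ^+ n) yt,
          normc xt <= eta /\ normc yt <= eta,
          b + yt = (z0 + t - (a + xt) * (b + yt)) * f (a + xt)
        & a + xt = (z0 + t - (a + xt) * (b + yt)) * g (b + yt)].
Proof.
move=> eta0; have [L0 M0 cL _ _] := tf; have [_ _ dL _ _] := tg.
pose De := 1 - m1 / q1 * (m2 / q2).
pose A1 := (m2 / q2 * (c 0 / q1) + d 0 / q2) / De.
pose A2 := (m1 / q1 * (d 0 / q2) + c 0 / q1) / De.
pose B11 := m2 / q2 / q1 / De; pose B12 := (q2 * De)^-1.
pose B21 := (q1 * De)^-1; pose B22 := m1 / q1 / q2 / De.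
pose B : R := normc D * (2 * M * L ^+ 2) + M + (2 + normc a + normc b) * (2 * M * L).
have B0 : 0 <= B.
  by rewrite !addr_ge0 ?mulr_ge0 ?addr_ge0 ?normc_ge0 ?exprn_ge0 ?(ltW L0).
pose A : R := 1 + (normc A1 + normc A2) +
  (normc B11 + normc B12 + (normc B21 + normc B22)) * B.
have nn := @normc_ge0 R.
have A0 : 0 < A.
  rewrite /A -addrA ltr_wpDr//.
  by rewrite addr_ge0 ?mulr_ge0// !addr_ge0.
(* In norm the linear terms in t are at most r times a constant, and the errors
   at most rho^2 times a constant. With r = rho^2 and rho A <= 1 the ball of
   radius rho is invariant. *)
pose rho := Num.min (Num.min 1 eta) (Num.min (2 * L)^-1 A^-1).
have rho0 : 0 < rho by rewrite !lt_min ltr01 eta0 !invr_gt0 A0 mulr_gt0.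
have rho1 : rho <= 1 by rewrite !ge_min lexx.
have rho_eta : rho <= eta by rewrite !ge_min lexx orbT.
have rhoL : rho * (2 * L) <= 1.
  by rewrite -ler_pdivlMr ?mulr_gt0// div1r !ge_min lexx !orbT.
have rhoA : rho * A <= 1 by rewrite -ler_pdivlMr// div1r !ge_min lexx !orbT.
pose r := rho ^+ 2; have r0 : 0 < r by rewrite exprn_gt0.
have r_rho : r <= rho by rewrite /r expr2 ler_piMl// ltW.
pose T1 k (X Y : {poly C}) := A1 *: 'X + B11 *: errop z0 a b c k X Y X
                              + B12 *: errop z0 a b d k X Y Y.
pose T2 k (X Y : {poly C}) := A2 *: 'X + B21 *: errop z0 a b c k X Y X
                              + B22 *: errop z0 a b d k X Y Y.
have XX (u : C) : 'X %| u *: 'X by rewrite -mul_polyC dvdp_mull.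
have e1c k := errop_contracting (@lipschitz_fst R) z0 a b c k.
have e2c k := errop_contracting (@lipschitz_snd R) z0 a b d k.
have cT1 k : contracting_op (T1 k).
  by apply: adic_opD; [apply: adic_opD; [exact: adic_cst|]|]; exact: adic_opZ.
have cT2 k : contracting_op (T2 k).
  by apply: adic_opD; [apply: adic_opD; [exact: adic_cst|]|]; exact: adic_opZ.
have aT (P : {poly C}) (u v : C) k (X Y : {poly C}) : 'X %| X -> 'X %| Y ->
    agree k.+1 (P + u *: errop z0 a b c k X Y X + v *: errop z0 a b d k X Y Y)
      (P + u *: errop z0 a b c k.+1 X Y X + v *: errop z0 a b d k.+1 X Y Y).
  move=> X0 Y0; rewrite /agree.
  set e1 := errop _ _ _ c k _ _ _; set e1' := errop _ _ _ c k.+1 _ _ _.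
  set e2 := errop _ _ _ d k _ _ _; set e2' := errop _ _ _ d k.+1 _ _ _.
  have -> : P + u *: e1 + v *: e2 - (P + u *: e1' + v *: e2') =
    u%:P * (e1 - e1') + v%:P * (e2 - e2') by rewrite -!mul_polyC; ring.
  by apply: dvdp_add; apply: dvdp_mull; exact: errop_agree.
have nT (al u v : C) k (X Y : {poly C}) : normc al + (normc u + normc v) * B <= A ->
    pnorm r X <= rho -> pnorm r Y <= rho ->
    pnorm r (al *: 'X + u *: errop z0 a b c k X Y X + v *: errop z0 a b d k X Y Y) <= rho.
  move=> hA hX hY.
  have h1 := pnorm_errop L0 M0 cL (ltW r0) r_rho rhoL rho1 z0 a b k hX hY hX.
  have h2 := pnorm_errop L0 M0 dL (ltW r0) r_rho rhoL rho1 z0 a b k hX hY hY.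
  rewrite -/B in h1 h2.
  apply: le_trans (pnormD (ltW r0) _ _) _.
  apply: le_trans (lerD (pnormD (ltW r0) _ _) (lexx _)) _.
  have k0 : pnorm r (al *: 'X) <= normc al * rho ^+ 2.
    by apply: le_trans (pnormZ _ _ _) _; rewrite ler_wpM2l// pnorm_X.
  have k1 : pnorm r (u *: errop z0 a b c k X Y X) <= normc u * (rho ^+ 2 * B).
    by apply: le_trans (pnormZ _ _ _) _; rewrite ler_wpM2l.
  have k2 : pnorm r (v *: errop z0 a b d k X Y Y) <= normc v * (rho ^+ 2 * B).
    by apply: le_trans (pnormZ _ _ _) _; rewrite ler_wpM2l.
  apply: le_trans (lerD (lerD k0 k1) k2) _.
  have -> : normc al * rho ^+ 2 + normc u * (rho ^+ 2 * B) + normc v * (rho ^+ 2 * B)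
    = rho * (rho * (normc al + (normc u + normc v) * B)) by ring.
  rewrite -[leRHS]mulr1 ler_wpM2l ?(ltW rho0)//; apply: le_trans rhoA.
  by rewrite ler_wpM2l ?(ltW rho0).
have hA1 : normc A1 + (normc B11 + normc B12) * B <= A.
  rewrite /A; have := nn A2; have : 0 <= (normc B21 + normc B22) * B.
    by rewrite mulr_ge0// addr_ge0.
  by clear; lra.
have hA2 : normc A2 + (normc B21 + normc B22) * B <= A.
  rewrite /A; have := nn A1; have : 0 <= (normc B11 + normc B12) * B.
    by rewrite mulr_ge0// addr_ge0.
  by clear; lra.
have nT' k X Y : pnorm r X <= rho -> pnorm r Y <= rho ->
    pnorm r (T1 k X Y) <= rho /\ pnorm r (T2 k X Y) <= rho.
  by move=> hX hY; split; apply: nT.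
have [x [y H]] := adic_fixpoint (ltW r0) (ltW rho0) cT1 cT2
  (fun k X Y => aT _ _ _ k X Y) (fun k X Y => aT _ _ _ k X Y) nT'.
exists (r / 2), x, y; split; first by rewrite divr_gt0.
move=> t; rewrite ltr_pdivlMr// => /ltW tr.
have [xt [sx nx cx]] := pnorm_power_series (ltW r0) (fun k => let: And4 h _ _ _ := H k in h) tr.
have [yt [sy ny cy]] := pnorm_power_series (ltW r0) (fun k => let: And4 _ h _ _ := H k in h) tr.
have tr' : normc t <= r by have := nn t; lra.
pose X_ k := \poly_(n < k.+1) x n; pose Y_ k := \poly_(n < k.+1) y n.
have LL : 0 <= 2 * L by rewrite mulr_ge0// ltW.
have small (P : {poly C}) : pnorm r P <= rho -> normc P.[t] * (2 * L) <= 1.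
  move=> hP; apply: le_trans rhoL; rewrite ler_wpM2r//.
  exact: le_trans (normc_horner_le (ltW r0) _ tr') hP.
have xs : normc xt * (2 * L) <= 1 by apply: le_trans rhoL; rewrite ler_wpM2r.
have ys : normc yt * (2 * L) <= 1 by apply: le_trans rhoL; rewrite ler_wpM2r.
have E1 := errop_tends tf (fun k => small _ (let: And4 h _ _ _ := H k in h)) xs cx cy cx.
have E2 := errop_tends tg (fun k => small _ (let: And4 _ h _ _ := H k in h)) ys cx cy cy.
have cst := @tends_cst R.
have residual (S P : {poly C}) k : pnorm r S <= rho -> pnorm r P <= rho ->
    agree k.+1 S P -> normc (S.[t] - P.[t]) <= (rho + rho) * 2^-1 ^+ k.
  move=> hS hP /(agree_le (leqnSn k)) hd.
  have -> : S.[t] - P.[t] = (S - P).[t] by rewrite hornerD hornerN.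
  apply: le_trans (normc_horner_dvdXn (ltW r0) tr hd) _.
  rewrite ler_wpM2r ?exprn_ge0 ?invr_ge0//; apply: le_trans (pnormD (ltW r0) _ _) _.
  rewrite lerD//; apply: le_trans hP.
  by rewrite -scaleN1r; apply: le_trans (pnormZ _ _ _) _; rewrite normc_opp normc1 mul1r.
have res1 k : normc ((X_ k).[t] - (T1 k (X_ k) (Y_ k)).[t]) <= (rho + rho) * 2^-1 ^+ k.
  by have [h1 h2 h3 _] := H k; apply: residual => //; exact: (nT' k _ _ h1 h2).1.
have res2 k : normc ((Y_ k).[t] - (T2 k (X_ k) (Y_ k)).[t]) <= (rho + rho) * 2^-1 ^+ k.
  by have [h1 h2 _ h4] := H k; apply: residual => //; exact: (nT' k _ _ h1 h2).2.
have lim1 := tends_geometric_dist cx res1.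
have lim2 := tends_geometric_dist cy res2.
have hornerT (al u v : C) (P Q : {poly C}) :
    (al *: 'X + u *: P + v *: Q).[t] = al * t + u * P.[t] + v * Q.[t].
  by rewrite !hornerD !hornerZ hornerX.
have limT (al u v : C) := tendsD (tendsD (cst (al * t)) (tendsM (cst u) E1))
  (tendsM (cst v) E2).
have hx : (fun k => (T1 k (X_ k) (Y_ k)).[t]) = fun k => A1 * t
    + B11 * (errop z0 a b c k (X_ k) (Y_ k) (X_ k)).[t]
    + B12 * (errop z0 a b d k (X_ k) (Y_ k) (Y_ k)).[t].
  by apply/funext => k; exact: hornerT.
have hy : (fun k => (T2 k (X_ k) (Y_ k)).[t]) = fun k => A2 * t
    + B21 * (errop z0 a b c k (X_ k) (Y_ k) (X_ k)).[t]
    + B22 * (errop z0 a b d k (X_ k) (Y_ k) (Y_ k)).[t].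
  by apply/funext => k; exact: hornerT.
have fx : xt = _ := tends_unique lim1 (eq_ind_r (fun u => tends u _) (limT A1 B11 B12) hx).
have fy : yt = _ := tends_unique lim2 (eq_ind_r (fun u => tends u _) (limT A2 B21 B22) hy).
have [s1 s2] := fixpoint_solves eb ea q1n q2n Dn fx fy.
by exists xt, yt; split=> //; split; [exact: le_trans nx _ | exact: le_trans ny _].
Qed.

End ImplicitTheorem.

(** * Local solutions *)

Section LocalSolution.
Context {R : realType}.
Implicit Types (mu : probability (measurableTypeR R) R) (z w u v t : R[i]).

Lemma kernel_bound_le w (C C' : R) : C <= C' -> kernel_bound w C -> kernel_bound w C'.
Proof.
move=> CC' [C0 H]; split=> [|xi xi0]; first exact: lt_le_trans CC'.
by apply: le_trans (H _ xi0) _; rewrite ler_wpM2r ?normc_ge0.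
Qed.

Lemma normc_kcorr_le mu (hmu : Mplus mu) w v (C C' : R) :
  kernel_bound w C -> kernel_bound v C' -> normc (kcorr mu w v) <= 2 * (C * C').
Proof.
move=> hw hv; apply: cexpect_norm_le => //.
  by apply: cbmeasM; apply: cbmeas_kernel; apply: kernel_bound_slit; eassumption.
move=> xi xi0; rewrite normcM ler_pM ?normc_ge0//; exact: kernel_le.
Qed.

Lemma kmean_taylor_at mu (hmu : Mplus mu) w (C : R) : kernel_bound w C ->
  taylor_at (kmean mu) w (kcoef mu w) (4 * C) C.
Proof.
move=> hw; have C0 := hw.1.
have near u : normc u * (2 * C) <= 1 -> kernel_bound (w + u) (2 * C).
  move=> hu; apply: (kernel_bound_near hw).
  by have -> : w + u - w = u by ring.
split=> // [|n|u N hu|u v hu hv].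
- by rewrite mulr_ge0// ltW.
- apply: le_trans (kcoef_le hmu n hw) _; rewrite exprS mulrA.
  by rewrite ler_wpM2r ?exprn_ge0 ?(ltW C0)//; lra.
- exact: kmean_taylor (near _ hu).
have bu := near _ hu; have bv := near _ hv.
rewrite kmean_sub//; [|exact: kernel_bound_slit bu|exact: kernel_bound_slit bv].
have -> : w + u - (w + v) = u - v by ring.
rewrite normcM mulrC ler_wpM2r ?normc_ge0//.
by apply: le_trans (normc_kcorr_le hmu bu bv) _; lra.
Qed.

(** Cleared of the denominator 1 + w p, the equation involves p only, whose
    Taylor coefficients are explicit. *)
Lemma Kratio_eqP mu (hmu : Mplus mu) z w w' : slit w ->
  (w' = z * Kratio mu w) <-> (w' = (z - w * w') * kmean mu w).
Proof.
move=> sw; have := kden_neq0 hmu sw; rewrite /Kratio /kden; move: (kmean mu w) => p q0.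
split=> [->|e]; first by field.
apply: (mulIf q0); rewrite -mulrA divfK//.
by apply/eqP; rewrite -subr_eq0 mulrDr mulr1 {1}e; apply/eqP; ring.
Qed.

(** Both sides are the derivative of w |-> z h(w), by the implicit equation and
    by the difference quotient of h. *)
Lemma derivative_Kratio mu (hmu : Mplus mu) z w w' : slit w -> w' = z * Kratio mu w ->
  ((z - w * w') * kcoef mu w 1 - w' * kcoef mu w 0) / (1 + w * kcoef mu w 0) =
  z * ((kcorr mu w w - kmean mu w * kmean mu w) / (kden mu w * kden mu w)).
Proof.
move=> sw ->; have := kden_neq0 hmu sw; rewrite kcoef0 kcoef1 /Kratio /kden => q0.
by field.
Qed.

(** The determinant 1 - z^2 h1'(w1) h2'(w2) does not vanish, as |h'| <= A and
    |z|^2 A1 A2 < 1. *)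
Lemma local_solution mu1 mu2 (hmu1 : Mplus mu1) (hmu2 : Mplus mu2) z0 w1 w2 (eta : R) :
  upper_slit z0 -> solution mu1 mu2 z0 w1 w2 -> 0 < eta ->
  exists (r : R) (x y : nat -> R[i]), 0 < r /\ forall t, normc t < r ->
    exists xt yt : R[i],
      [/\ tends (fun N => \sum_(n < N) x n * t ^+ n) xt,
          tends (fun N => \sum_(n < N) y n * t ^+ n) yt,
          normc xt <= eta /\ normc yt <= eta, slit (w1 + xt) /\ slit (w2 + yt)
        & w2 + yt = (z0 + t) * Kratio mu1 (w1 + xt) /\
          w1 + xt = (z0 + t) * Kratio mu2 (w2 + yt)].
Proof.
move=> uz sol eta0; have lt1 := solution_slopes_lt1 hmu1 hmu2 uz sol.
have [u1 u2 e2 e1] := sol.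
have s1 := upper_slit_slit u1; have s2 := upper_slit_slit u2.
have [C1 hC1] := slit_kernel_bound s1; have [C2 hC2] := slit_kernel_bound s2.
pose C := Num.max C1 C2.
have b1 : kernel_bound w1 C by apply: kernel_bound_le hC1; rewrite le_max lexx.
have b2 : kernel_bound w2 C by apply: kernel_bound_le hC2; rewrite le_max lexx orbT.
have C0 := b1.1; have CC : 0 < 2 * C by rewrite mulr_gt0.
pose eta' := Num.min eta (2 * C)^-1.
have eta'0 : 0 < eta' by rewrite lt_min eta0 invr_gt0.
have t1 := kmean_taylor_at hmu1 b1; have t2 := kmean_taylor_at hmu2 b2.
have eb : w2 = (z0 - w1 * w2) * kcoef mu1 w1 0 by rewrite kcoef0; exact/Kratio_eqP.
have ea : w1 = (z0 - w1 * w2) * kcoef mu2 w2 0.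
  by rewrite kcoef0 (mulrC w1); exact/Kratio_eqP.
have q1 : 1 + w1 * kcoef mu1 w1 0 != 0 by rewrite kcoef0; exact: kden_neq0.
have q2 : 1 + w2 * kcoef mu2 w2 0 != 0 by rewrite kcoef0; exact: kden_neq0.
have Dn : 1 - ((z0 - w1 * w2) * kcoef mu1 w1 1 - w2 * kcoef mu1 w1 0) /
                (1 + w1 * kcoef mu1 w1 0) *
              (((z0 - w1 * w2) * kcoef mu2 w2 1 - w1 * kcoef mu2 w2 0) /
                (1 + w2 * kcoef mu2 w2 0)) != 0.
  rewrite (derivative_Kratio hmu1 s1 e2) (mulrC w1) (derivative_Kratio hmu2 s2 e1).
  have := kcovariance_le hmu1 s1 s1; have := kcovariance_le hmu2 s2 s2.
  set p := _ / (kden mu2 w2 * _); set q := _ / (kden mu1 w1 * _).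
  have := slopeA_ge0 hmu1 s1; have := slopeA_ge0 hmu2 s2; move: lt1.
  move: (slopeA mu1 w1) (slopeA mu2 w2) => A1 A2 lt1 A2_0 A1_0 h2 h1.
  have {}h1 : normc q <= A1 by rewrite -ler_sqr ?nnegrE ?normc_ge0// (expr2 A1).
  have {}h2 : normc p <= A2 by rewrite -ler_sqr ?nnegrE ?normc_ge0// (expr2 A2).
  clearbody p q; rewrite subr_eq0 eq_sym; apply/eqP => /(congr1 (@normc R)).
  rewrite normc1 !normcM => h; move: lt1; rewrite ltNge => /negP; apply.
  rewrite -h expr2 mulrACA; apply: ler_wpM2l; first by rewrite mulr_ge0 ?normc_ge0.
  by rewrite ler_pM ?normc_ge0.
have [r [x [y [r0 H]]]] := implicit_system t1 t2 eb ea q1 q2 Dn eta'0.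
exists r, x, y; split=> // t /H [xt [yt [sx sy [nx ny] ey ex]]].
exists xt, yt; have le1 : eta' <= eta by rewrite ge_min lexx.
have small u : normc u <= eta' -> normc u * (2 * C) <= 1.
  by move=> hu; rewrite -ler_pdivlMr// div1r (le_trans hu)// ge_min lexx orbT.
have sl w u : kernel_bound w C -> normc u <= eta' -> slit (w + u).
  move=> hw hu; apply: (@kernel_bound_slit _ _ (2 * C)); apply: (kernel_bound_near hw).
  have -> : w + u - w = u by ring.
  exact: small.
have sl1 := sl _ _ b1 nx; have sl2 := sl _ _ b2 ny.
split=> //; first by split; apply: le_trans le1.
split; first exact/Kratio_eqP.
by apply/Kratio_eqP => //; rewrite (mulrC (w2 + yt)).
Qed.

(** Close to the negative half-line the imaginary parts of w1, w2 cannot turn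
    negative while that of z is nonnegative: w1 and w2 lie in the same half-plane
    as K1(w1) = K2(w2), and Im w1 < 0 would force Im w2 = Im (z h1(w1)) >= 0. *)
Lemma solution_near_negative mu1 mu2 (hmu1 : Mplus mu1) (hmu2 : Mplus mu2) z v1 v2 :
  upper_slit z -> Re z < 0 -> Re v1 < 0 -> Re v2 < 0 ->
  v2 = z * Kratio mu1 v1 -> v1 = z * Kratio mu2 v2 -> solution mu1 mu2 z v1 v2.
Proof.
move=> uz z0 r1 r2 e2 e1.
have s1 : slit v1 by rewrite /slit r1 orbT.
have s2 : slit v2 by rewrite /slit r2 orbT.
have ImE := subordination_Im hmu1 hmu2 (upper_slit_neq0 uz) s1 s2 e2 e1.
have B1 := slopeB_gt0 hmu1 s1; have B2 := slopeB_gt0 hmu2 s2.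
have A1 := slopeA_ge0 hmu1 s1.
have i1 : 0 <= Im v1.
  rewrite leNgt; apply/negP => i1.
  have i2 : Im v2 < 0.
    have : slopeB mu2 v2 * Im v2 < 0 by rewrite -ImE pmulr_rlt0.
    by rewrite pmulr_rlt0.
  move: i2; rewrite (KratioIm hmu1 s1 e2) ltNge => /negP; apply.
  have y0 := upper_slit_Im_ge0 uz.
  move: (slopeA mu1 v1) (slopeB mu1 v1) A1 B1 => A B A1 B1.
  apply: addr_ge0.
    by apply: mulr_le0; [exact: ltW | apply: mulr_le0_ge0 => //; exact: ltW].
  apply: mulr_ge0 => //; rewrite subr_ge0; apply: le_trans (ltW B1).
  by apply: mulr_le0_ge0 => //; exact: ltW.
have i2 : 0 <= Im v2.
  have : 0 <= slopeB mu2 v2 * Im v2 by rewrite -ImE; apply: mulr_ge0 => //; exact: ltW.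
  by rewrite pmulr_rge0.
split=> //; rewrite /upper_slit ?r1 ?r2 andbT orbC eq_sym -le_eqVlt//.
Qed.

End LocalSolution.

(** * Limits of solutions, and continuation *)

Section Compactness.
Context {R : realType}.
Implicit Types (u v : nat -> R[i]).

Lemma BolzanoWeierstrass u v (M : R) :
  (forall n, normc (u n) <= M) -> (forall n, normc (v n) <= M) ->
  exists (phi : nat -> nat) (p q : R[i]), [/\ forall k, (k <= phi k)%N,
    tends (fun k => u (phi k)) p & tends (fun k => v (phi k)) q].
Proof.
move=> uM vM.
pose x n : 'rV[R]_4 := \row_i [:: Re (u n); Im (u n); Re (v n); Im (v n)]`_i.
pose K : set 'rV[R]_4 := [set w | forall i, `[- M, M]%classic (w ord0 i)].
have cK : compact K := rV_compact (fun i => @segment_compact R (- M) M).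
have xK n : K (x n).
  have h (z : R[i]) : normc z <= M -> `[- M, M]%classic (Re z) /\ `[- M, M]%classic (Im z).
    move=> zM; rewrite /= !in_itv /= -!ler_norml.
    by split; apply: le_trans zM; [exact: normc_Re | exact: normc_Im].
  have [h1 h2] := h _ (uM n); have [h3 h4] := h _ (vM n).
  by case=> -[|[|[|[|//]]]] i /=; rewrite mxE.
have FK : (x @ \oo) K by exists 0%N => // n _; exact: xK.
have [p [Kp clp]] := cK _ _ FK.
have near k : exists n, (k <= n)%N /\ forall i, `|p ord0 i - x n ord0 i| < k.+1%:R^-1.
  have k0 : 0 < (k.+1%:R^-1 : R) by rewrite invr_gt0.
  have [] := clp [set x n | n in [set n | (k <= n)%N]] (ball p k.+1%:R^-1).
  - by exists k => // n /= kn; exists n.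
  - exact: nbhsx_ballx.
  by move=> _ [[n kn <-] [_ pn]]; exists n; split=> // i; exact: (pn ord0 i).
have [phi hphi] := choice near.
have lim (z : nat -> R[i]) (i j : 'I_4) :
    (forall n, x n ord0 i = Re (z n)) -> (forall n, x n ord0 j = Im (z n)) ->
    tends (fun k => z (phi k)) (p ord0 i +i* p ord0 j).
  move=> hi hj e e0; have e2 : 0 < e / 2 by rewrite divr_gt0.
  near=> k; apply: le_lt_trans (normc_le _) _; rewrite !ReIm_simp /= -hi -hj.
  have kl : k.+1%:R^-1 < e / 2 by near: k; exact: near_infty_natSinv_lt (PosNum e2).
  rewrite [e]splitr; apply: ltrD; apply: lt_trans kl; exact: (hphi k).2.
exists phi, (p ord0 (inord 0) +i* p ord0 (inord 1)),
  (p ord0 (inord 2) +i* p ord0 (inord 3)); split.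
- by move=> k; exact: (hphi k).1.
- by apply: lim => n; rewrite mxE inordK.
- by apply: lim => n; rewrite mxE inordK.
Unshelve. all: by end_near.
Qed.

Lemma kmean_tends (mu : probability (measurableTypeR R) R) (hmu : Mplus mu) u (p : R[i]) :
  slit p -> tends u p -> tends (fun k => kmean mu (u k)) (kmean mu p).
Proof.
move=> sp up; have [C hC] := slit_kernel_bound sp.
have [L0 M0 _ _ lip] := kmean_taylor_at hmu hC.
have K0 : 0 < 2 * C * (4 * C) by rewrite !mulr_gt0.
move=> e e0; near=> k.
have h1 : normc (p - u k) < (2 * C)^-1 by near: k; apply: up; rewrite invr_gt0 mulr_gt0.
have h2 : normc (p - u k) < e / (2 * C * (4 * C)) by near: k; apply: up; rewrite divr_gt0.
have s0 : normc (0 : R[i]) * (2 * C) <= 1 by rewrite normc0 mul0r.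
have s1 : normc (u k - p) * (2 * C) <= 1.
  by rewrite normc_distC -ler_pdivlMr ?mulr_gt0// div1r ltW.
have := lip _ _ s0 s1; rewrite addr0 [p + _]addrC subrK sub0r opprB.
by move/le_lt_trans; apply; rewrite mulrC -ltr_pdivlMr.
Unshelve. all: by end_near.
Qed.

(** Sectors are closed. *)
Lemma tends_Re_ge u (p a : R[i]) (c : R) : tends u p ->
  (forall k, c * normc (u k) <= Re (a * (u k)^*)) -> 0 <= c ->
  c * normc p <= Re (a * p^*).
Proof.
move=> up H c0; apply/ler_addgt0Pr => e e0.
have K0 : 0 < c + normc a + 1 by have := normc_ge0 a; lra.
have := up _ (divr_gt0 e0 K0) => -[N _ /(_ N (leqnn N))] /=.
rewrite ltr_pdivlMr// => h.
have h1 : c * normc p <= c * normc (u N) + c * normc (p - u N).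
  rewrite -mulrDr ler_wpM2l//; have := normc_subr p (u N); lra.
have h2 : Re (a * (u N)^*) <= Re (a * p^*) + normc a * normc (p - u N).
  have -> : Re (a * (u N)^*) = Re (a * p^*) - Re (a * (p - u N)^*).
    by rewrite !ReIm_simp; ring.
  rewrite lerD2l -(normc_conj (p - _)) -normcM.
  by apply: le_trans (normc_Re _); rewrite -normrN; exact: ler_norm.
have := H N; have := normc_ge0 (p - u N); lra.
Qed.

Lemma tends_Im_ge0 u (p : R[i]) : tends u p -> (forall k, 0 <= Im (u k)) -> 0 <= Im p.
Proof.
move=> up H; rewrite leNgt; apply/negP => p0.
have e0 : 0 < - Im p by rewrite oppr_gt0.
have := up _ e0 => -[N _ /(_ N (leqnn N))] /=.
rewrite ltNge => /negP; apply; apply: le_trans (normc_Im _).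
by rewrite -normrN; apply: le_trans (ler_norm _); rewrite !ReIm_simp; have := H N; lra.
Qed.

End Compactness.

Section Continuation.
Context {R : realType} (mu1 mu2 : probability (measurableTypeR R) R).
Hypotheses (hmu1 : Mplus mu1) (hmu2 : Mplus mu2).
Implicit Types (z w t : R[i]).

Lemma slit_upper_slit w : slit w -> 0 <= Im w -> upper_slit w.
Proof.
move=> sw; rewrite /upper_slit le_eqVlt => /predU1P[h|->//].
by move: sw; rewrite /slit -h eqxx ltxx.
Qed.

Lemma solution_limit (z_ w1_ w2_ : nat -> R[i]) z p1 p2 :
  (forall k, solution mu1 mu2 (z_ k) (w1_ k) (w2_ k)) ->
  tends z_ z -> tends w1_ p1 -> tends w2_ p2 -> slit p1 -> slit p2 ->
  solution mu1 mu2 z p1 p2.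
Proof.
move=> H cz c1 c2 s1 s2.
have up (w_ : nat -> R[i]) p : tends w_ p -> slit p ->
    (forall k, upper_slit (w_ k)) -> upper_slit p.
  move=> cp sp uw; apply: slit_upper_slit => //; apply: tends_Im_ge0 cp _ => k.
  exact: upper_slit_Im_ge0.
have den := tendsB cz (tendsM c1 c2).
split.
- by apply: up c1 s1 _ => k; case: (H k).
- by apply: up c2 s2 _ => k; case: (H k).
- apply/(Kratio_eqP hmu1 _ _ s1); apply: tends_unique c2 _.
  have := tendsM den (kmean_tends hmu1 s1 c1); congr tends; apply/funext => k.
  have [u1 _ e _] := H k; apply/esym.
  exact: (Kratio_eqP hmu1 _ _ (upper_slit_slit u1)).1 e.
- apply/(Kratio_eqP hmu2 _ _ s2); rewrite (mulrC p2); apply: tends_unique c1 _.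
  have := tendsM den (kmean_tends hmu2 s2 c2); congr tends; apply/funext => k.
  have [_ u2 _ e] := H k; apply/esym; rewrite (mulrC (w1_ k)).
  exact: (Kratio_eqP hmu2 _ _ (upper_slit_slit u2)).1 e.
Qed.

(** Around each point the solutions are given by convergent power series. Near
    the negative half-line those series also run below the real axis, where
    their conjugates are solutions. *)
Lemma solution_power_series z0 w1 w2 :
  upper_slit z0 -> solution mu1 mu2 z0 w1 w2 ->
  exists (r : R) (x y : nat -> R[i]), 0 < r /\ forall t, normc t < r ->
    exists xt yt : R[i],
      [/\ tends (fun N => \sum_(n < N) x n * t ^+ n) xt,
          tends (fun N => \sum_(n < N) y n * t ^+ n) yt,
          upper_slit (z0 + t) -> solution mu1 mu2 (z0 + t) (w1 + xt) (w2 + yt)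
        & ~~ upper_slit (z0 + t) -> upper_slit (z0 + t)^* /\
            solution mu1 mu2 (z0 + t)^* (w1 + xt)^* (w2 + yt)^*].
Proof.
move=> uz sol; have [y0|y0] : 0 < Im z0 \/ Im z0 = 0.
  by move: uz; rewrite /upper_slit => /orP[|/andP[/eqP]]; tauto.
  have [i1 i2] := solution_upper hmu1 hmu2 uz sol y0.
  pose eta := Num.min (Im w1) (Im w2) / 2.
  have eta0 : 0 < eta by rewrite divr_gt0// lt_min i1.
  have [r [x [y [r0 H]]]] := local_solution hmu1 hmu2 uz sol eta0.
  exists (Num.min r (Im z0)), x, y; split; first by rewrite lt_min r0.
  move=> t; rewrite lt_min => /andP[tr tz].
  have [xt [yt [sx sy [nx ny] [s1 s2] [e2 e1]]]] := H _ tr.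
  have pos w u (c : R) : normc u <= c -> c < Im w -> 0 < Im (w + u).
    move=> uc cw; rewrite ImD; have := normc_Im u; rewrite ler_norml => /andP[h _].
    lra.
  have etaw : eta < Im w1 /\ eta < Im w2.
    have h1 : Num.min (Im w1) (Im w2) <= Im w1 by rewrite ge_min lexx.
    have h2 : Num.min (Im w1) (Im w2) <= Im w2 by rewrite ge_min lexx orbT.
    rewrite /eta; lra.
  have uzt : upper_slit (z0 + t).
    rewrite /upper_slit ImD; have := normc_Im t; rewrite ler_norml => /andP[h _].
    by apply/orP; left; lra.
  exists xt, yt; split=> //; last by rewrite uzt.
  by split=> //; rewrite /upper_slit (pos _ _ _ _ etaw.1, pos _ _ _ _ etaw.2).
have [_ _ a1 a2] := solution_real hmu1 hmu2 uz sol y0.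
have x0 : Re z0 < 0 by move: uz; rewrite /upper_slit y0 ltxx eqxx.
pose eta := Num.min (- Re w1) (- Re w2) / 2.
have eta0 : 0 < eta by rewrite divr_gt0// lt_min !oppr_gt0 a1.
have [r [x [y [r0 H]]]] := local_solution hmu1 hmu2 uz sol eta0.
exists (Num.min r (- Re z0)), x, y; split; first by rewrite lt_min r0 oppr_gt0.
move=> t; rewrite lt_min => /andP[tr tz].
have [xt [yt [sx sy [nx ny] [s1 s2] [e2 e1]]]] := H _ tr.
have neg w u (c : R) : normc u <= c -> c < - Re w -> Re (w + u) < 0.
  move=> uc cw; rewrite ReD; have := normc_Re u; rewrite ler_norml => /andP[_ h].
  lra.
have etaw : eta < - Re w1 /\ eta < - Re w2.
  have h1 : Num.min (- Re w1) (- Re w2) <= - Re w1 by rewrite ge_min lexx.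
  have h2 : Num.min (- Re w1) (- Re w2) <= - Re w2 by rewrite ge_min lexx orbT.
  rewrite /eta; lra.
have n1 := neg _ _ _ nx etaw.1; have n2 := neg _ _ _ ny etaw.2.
have nz : Re (z0 + t) < 0 by exact: neg (lexx _) tz.
exists xt, yt; split=> // uzt.
  exact: solution_near_negative.
have uzc : upper_slit (z0 + t)^*.
  rewrite /upper_slit Im_conj Re_conj nz andbT oppr_gt0 oppr_eq0.
  by move: uzt; rewrite /upper_slit nz andbT negb_or -leNgt lt_neqAle andbC => /andP[-> ->].
split=> //; apply: solution_near_negative => //; rewrite ?Re_conj//.
  by rewrite Kratio_conj// -conjcM -e2.
by rewrite Kratio_conj// -conjcM -e1.
Qed.

Section Segment.
Context (x0 : R) (z : R[i]) (x00 : x0 < 0) (uz : upper_slit z).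

(* Up to a positive factor, -e bisects the angle between z and -1, so that z, -1
   and the whole segment lie in the sector (e, c). *)
Let path (s : R) : R[i] := ((1 - s) * x0)%:C + s%:C * z.
Let e : R[i] := (normc z)%:C - z.
Let c : R := normc z - Re z.

Let c0 : 0 < c.
Proof.
rewrite subr_gt0; move: uz => /orP[y0|/andP[_ /lt_le_trans]]; last first.
  by apply; exact: normc_ge0.
rewrite ltNge; apply/negP => h; have := normc_sqr z.
have : normc z ^+ 2 <= Re z ^+ 2.
  by rewrite lerXn2r// nnegrE ?normc_ge0// (le_trans (normc_ge0 z)).
have : 0 < Im z ^+ 2 by rewrite exprn_gt0.
lra.
Qed.

Let sec_z : sector e c z.
Proof.
split=> //; first by rewrite /e !ReIm_simp.
have -> : Re (- e * z^*) = normc z ^+ 2 - normc z * Re z.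
  by rewrite normc_sqr /e !ReIm_simp; ring.
by rewrite /c; lra.
Qed.

Let sec_path s : 0 <= s <= 1 -> sector e c (path s).
Proof.
move=> /andP[s0 s1]; apply: (@sector_cone _ e c z _ s (- ((1 - s) * x0))) => //.
  by rewrite oppr_ge0 mulr_ge0_le0 ?subr_ge0// ltW.
by rewrite /path rmorphN opprK addrC.
Qed.

Let upper_path s : 0 <= s <= 1 -> upper_slit (path s).
Proof.
move=> /andP[s0 s1]; have i0 := upper_slit_Im_ge0 uz.
apply: slit_upper_slit; last by rewrite /path !ReIm_simp mul0r addr0 add0r mulr_ge0.
have [->|sn] := eqVneq s 0.
  have -> : path 0 = x0%:C by apply: complexP; rewrite /path !ReIm_simp; ring.
  by rewrite /slit /= x00 orbT.
have sp : 0 < s by rewrite lt_def sn.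
rewrite /slit /path !ReIm_simp mul0r addr0 add0r.
move: uz => /orP[y0|/andP[/eqP -> r0]]; first by rewrite gt_eqF ?mulr_gt0.
rewrite !mulr0 eqxx /= subr0.
have : (1 - s) * x0 <= 0 by rewrite mulr_ge0_le0 ?subr_ge0// ltW.
have : s * Re z < 0 by rewrite pmulr_rlt0.
lra.
Qed.

Let r : R := c * Num.min (normc z) (- x0) / normc e.

Let e0 : 0 < normc e. Proof. exact: sector_e_gt0 sec_z. Qed.

Let r0 : 0 < r.
Proof.
rewrite divr_gt0// mulr_gt0// lt_min oppr_gt0 x00 andbT normc_gt0.
exact: upper_slit_neq0.
Qed.

Let path_ge s : 0 <= s <= 1 -> r <= normc (path s).
Proof.
move=> /andP[s0 s1]; rewrite ler_pdivrMr//.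
have h : Re (- e * (path s)^*) <= normc (path s) * normc e.
  rewrite -(normc_conj (path s)) mulrC -(normc_opp e) -normcM.
  by apply: le_trans (normc_Re _); exact: ler_norm.
apply: le_trans h; case: sec_z => _ _ h.
have -> : Re (- e * (path s)^*) = s * Re (- e * z^*) + (1 - s) * (- x0) * c.
  by rewrite /path /e /c !ReIm_simp; ring.
set m := Num.min _ _.
have m1 : m <= normc z by rewrite ge_min lexx.
have m2 : m <= - x0 by rewrite ge_min lexx orbT.
have h1 : s * (c * m) <= s * Re (- e * z^*).
  by rewrite ler_wpM2l//; apply: le_trans h; rewrite ler_pM2l.
have h2 : (1 - s) * (m * c) <= (1 - s) * (- x0 * c).
  by rewrite ler_wpM2l ?subr_ge0// ler_pM2r.
by move: h1 h2; lra.
Qed.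

Let path_le s : 0 <= s <= 1 -> normc (path s) <= - x0 + normc z.
Proof.
move=> /andP[s0 s1]; apply: le_trans (normcD _ _) _.
rewrite normcM !normc_real normrM (ltr0_norm x00) !ger0_norm ?subr_ge0//.
apply: lerD; first by rewrite ler_piMl ?oppr_ge0 ?(ltW x00)//; lra.
by rewrite ler_piMl ?normc_ge0.
Qed.

Let good s := exists w1 w2, solution mu1 mu2 (path s) w1 w2.

Let path_sub s s' : path s' = path s + (s' - s)%:C * (z - x0%:C).
Proof. by apply: complexP; rewrite /path !ReIm_simp; ring. Qed.

(* Openness: the power series at one point of the segment. *)
Let good_open s : 0 <= s <= 1 -> good s -> exists2 d, 0 < d &
  forall s', 0 <= s' <= 1 -> `|s' - s| < d -> good s'.
Proof.
move=> hs [w1 [w2 sol]].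
have [q [x [y [q0 H]]]] := solution_power_series (upper_path hs) sol.
have n0 : 0 < normc (z - x0%:C) + 1 by have := normc_ge0 (z - x0%:C); lra.
exists (q / (normc (z - x0%:C) + 1)); first by rewrite divr_gt0.
move=> s' hs'; rewrite ltr_pdivlMr// => d.
have tq : normc ((s' - s)%:C * (z - x0%:C)) < q.
  rewrite normcM normc_real; apply: le_lt_trans d.
  by rewrite mulrDr mulr1 lerDl.
have [xt [yt [_ _ h _]]] := H _ tq.
exists (w1 + xt), (w2 + yt); rewrite (path_sub s s'); apply: h.
by rewrite -path_sub; exact: upper_path.
Qed.

(* Closedness: the a priori bounds give a convergent subsequence, and the limits
   stay off the half-line since they lie in the sector and are nonzero. *)
Let good_closed S : 0 < S <= 1 -> (forall s, 0 <= s < S -> good s) -> good S.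
Proof.
move=> /andP[S0 S1] H.
pose s_ n : R := S * (1 - n.+1%:R^-1).
have ninv n : 0 < (n.+1%:R^-1 : R) <= 1 by rewrite invr_gt0 ltr0n /= invf_le1// ler1n.
have s_in n : 0 <= s_ n < S.
  have /andP[h1 h2] := ninv n; apply/andP; split; first by rewrite mulr_ge0 ?(ltW S0)// subr_ge0.
  by rewrite /s_ mulrBr mulr1 ltrBlDr ltrDl mulr_gt0.
have s_in' n : 0 <= s_ n <= 1.
  by have /andP[h1 h2] := s_in n; rewrite h1 (le_trans (ltW h2)).
have [w hw] := choice (fun n => H _ (s_in n)).
have [w' hw'] := choice hw.
have [m [M [m0 bnd]]] := solution_bounds hmu1 hmu2 e c (- x0 + normc z) r0.
have b n := bnd _ _ _ (upper_path (s_in' n)) (sec_path (s_in' n)) (path_ge (s_in' n))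
  (path_le (s_in' n)) (hw' n).
have bM1 n : normc (w n) <= M by case: (b n).
have bM2 n : normc (w' n) <= M by case: (b n).
have [phi [p [q [phik cp cq]]]] := BolzanoWeierstrass bM1 bM2.
have cz : tends (fun k => path (s_ (phi k))) (path S).
  move=> d d0; have n0 : 0 < S * normc (z - x0%:C) + 1.
    by have := mulr_ge0 (ltW S0) (normc_ge0 (z - x0%:C)); lra.
  near=> k; rewrite (path_sub (s_ (phi k)) S) addrC addKr normcM normc_real.
  have -> : S - s_ (phi k) = S * (phi k).+1%:R^-1 by rewrite /s_; ring.
  have /andP[h1 h2] := ninv (phi k).
  rewrite ger0_norm ?mulr_ge0 ?(ltW S0) ?(ltW h1)//.
  have h3 : (phi k).+1%:R^-1 <= (k.+1%:R^-1 : R).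
    by rewrite lef_pV2 ?posrE ?ltr0n// ler_nat ltnS.
  have h4 : k.+1%:R^-1 < d / (S * normc (z - x0%:C) + 1).
    by near: k; exact: near_infty_natSinv_lt (PosNum (divr_gt0 d0 n0)).
  have := le_lt_trans h3 h4; rewrite ltr_pdivlMr// => h5.
  apply: le_lt_trans h5; rewrite mulrDr mulr1 -mulrA mulrCA lerDl.
  exact: ltW.
have sec_lim (u : nat -> R[i]) v : tends (fun k => u (phi k)) v ->
    (forall n, m <= normc (u n)) -> (forall n, sector e c (u n)) -> slit v.
  move=> cv um su; apply: (@sector_slit _ e _ c).
    case: sec_z => _ ce _; split=> //; apply: tends_Re_ge cv _ (ltW c0) => k.
    by case: (su (phi k)).
  rewrite -normc_gt0; apply: lt_le_trans m0 _; rewrite leNgt; apply/negP => vm.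
  have d0 : 0 < m - normc v by rewrite subr_gt0.
  have := cv _ d0 => -[N _ /(_ N (leqnn N))] /=.
  rewrite normc_distC; have := normc_subr (u (phi N)) v; have := um (phi N); lra.
have sp : slit p.
  apply: sec_lim cp _ _ => n; first by case: (b n).
  exact: sector_solution2 hmu1 hmu2 _ _ _ _ _ (upper_path (s_in' n)) (hw' n) (sec_path (s_in' n)).
have sq : slit q.
  apply: sec_lim cq _ _ => n; first by case: (b n).
  exact: sector_solution1 hmu1 hmu2 _ _ _ _ _ (upper_path (s_in' n)) (hw' n) (sec_path (s_in' n)).
exists p, q; exact: (solution_limit (fun k => hw' (phi k)) cz cp cq sp sq).
Unshelve. all: by end_near.
Qed.

(** Solutions continue along the segment from a negative number to any point
    of the domain: the set of parameters up to which they do is open and, by the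
    a priori bounds, closed. *)
Lemma solution_continues : (exists w1 w2, solution mu1 mu2 x0%:C w1 w2) ->
  exists w1 w2, solution mu1 mu2 z w1 w2.
Proof.
move=> start.
have g0 : good 0.
  by have -> : good 0 = exists w1 w2, solution mu1 mu2 x0%:C w1 w2;
    rewrite // /good /path subr0 mul1r mul0r addr0.
pose A : set R := [set s | 0 <= s <= 1 /\ forall s', 0 <= s' <= s -> good s'].
have A0 : A 0.
  split; first by rewrite lexx ler01.
  by move=> s'; rewrite -eq_le => /eqP <-.
have hA : has_sup A by split; [exists 0 | exists 1 => s [/andP[]]].
pose S := sup A.
have S0 : 0 <= S by apply: sup_upper_bound.
have S1 : S <= 1 by apply: ge_sup; [exists 0 | move=> s [/andP[]]].
have below s : 0 <= s < S -> good s.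
  move=> /andP[s0 sS]; have d0 : 0 < S - s by rewrite subr_gt0.
  have [a [_ Aa]] := sup_adherent d0 hA; rewrite -/S => aS.
  by apply: Aa; rewrite s0 /=; lra.
have gS : good S.
  have [<-//|Sn] := eqVneq 0 S; apply: good_closed => //.
  by rewrite S1 lt_def eq_sym Sn S0.
have [d d0 hd] := good_open (introT andP (conj S0 S1)) gS.
have [S1'|S1'] := eqVneq S 1.
  move: gS; rewrite S1' /good /path subrr mul0r => -[w1 [w2]].
  by rewrite rmorph0 add0r rmorph1 mul1r => sol; exists w1, w2.
have Slt : S < 1 by rewrite lt_neqAle S1' S1.
pose s1 := Num.min (S + d / 2) 1.
have s1S : S < s1 by rewrite lt_min Slt ltrDl divr_gt0.
suff : A s1 by move=> /(sup_upper_bound hA); rewrite leNgt s1S.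
have s1d : s1 <= S + d / 2 by rewrite ge_min lexx.
have s11 : s1 <= 1 by rewrite ge_min lexx orbT.
split; first by rewrite s11 andbT; exact: le_trans S0 (ltW s1S).
move=> s' /andP[s0 ss]; have [sS|Ss] := ltP s' S; first by apply: below; rewrite s0.
by apply: hd; [rewrite s0 (le_trans ss)|rewrite ger0_norm ?subr_ge0//; lra].
Qed.

End Segment.

Lemma solution_exists z : upper_slit z -> exists w1 w2, solution mu1 mu2 z w1 w2.
Proof.
move=> uz; have [x [w1 [w2 [x0 sol]]]] := solution_exists_negative hmu1 hmu2.
by apply: (solution_continues x0 uz); exists w1, w2.
Qed.

End Continuation.

(** * The subordination functions *)

Section SubordinationFunctions.
Context {R : realType} (mu1 mu2 : probability (measurableTypeR R) R).
Hypotheses (hmu1 : Mplus mu1) (hmu2 : Mplus mu2).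
Implicit Types (z w t : R[i]) (S : R[i] -> R[i]).

(** Solutions are given on the upper half-plane and the negative half-line; the
    values needed for analyticity across that half-line are the conjugates. *)
Definition reflect_ext S z : R[i] := if upper_slit z then S z else (S z^*)^*.

Lemma analytic_at_tends (f : R[i] -> R[i]) z (x : nat -> R[i]) (w : R[i]) (r : R) :
  0 < r ->
  (forall t, normc t < r -> exists2 xt, tends (fun N => \sum_(n < N) x n * t ^+ n) xt &
     f (z + t) = w + xt) ->
  analytic_at f z.
Proof.
move=> r0 H; exists (fun n => if n is 0 then w + x 0 else x n), r; split=> // v vr.
have tr : normc (v - z) < r by move: vr; rewrite ltcR.
have [xt sx fv] := H _ tr; move: fv; rewrite addrC subrK => ->.
apply/tendsP => e e0; have [N _ hN] := sx _ e0; exists N.+1 => // -[//|n] /= Nn.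
suff -> : w + xt - series (fun n => (if n is 0 then w + x 0 else x n) *
    (v - z) ^+ n : R[i]^o) n.+1 = xt - \sum_(k < n.+1) x k * (v - z) ^+ k.
  by apply: hN => /=; exact: leqW.
rewrite seriesEnat /= big_mkord !big_ord_recl expr0 !mulr1.
by move: (\sum_(i < n) _) => s; ring.
Qed.

(** By uniqueness the solution is the sum of the local power series. *)
Lemma solution_analytic S1 S2 z :
  (forall w, upper_slit w -> solution mu1 mu2 w (S1 w) (S2 w)) -> upper_slit z ->
  analytic_at (reflect_ext S1) z /\ analytic_at (reflect_ext S2) z.
Proof.
move=> HS uz.
have [r [x [y [r0 H]]]] := solution_power_series hmu1 hmu2 uz (HS z uz).
suff E t : normc t < r -> exists xt yt,
    [/\ tends (fun N => \sum_(n < N) x n * t ^+ n) xt,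
        tends (fun N => \sum_(n < N) y n * t ^+ n) yt,
        reflect_ext S1 (z + t) = S1 z + xt & reflect_ext S2 (z + t) = S2 z + yt].
  split; [apply: (@analytic_at_tends _ _ x (S1 z) r r0) => t /E [xt [yt [? ? ? ?]]] |
          apply: (@analytic_at_tends _ _ y (S2 z) r r0) => t /E [xt [yt [? ? ? ?]]]].
    by exists xt.
  by exists yt.
move=> /H [xt [yt [sx sy hu hl]]]; exists xt, yt; rewrite /reflect_ext.
case: ifPn => [uzt|/hl [uc sol]].
  by have [-> ->] := solution_unique hmu1 hmu2 uzt (HS _ uzt) (hu uzt).
by have [-> ->] := solution_unique hmu1 hmu2 uc (HS _ uc) sol; rewrite !conjK.
Qed.

Lemma upper_slit_half_plane z : upper_half_plane z -> upper_slit z.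
Proof. by rewrite /upper_half_plane /upper_slit /= => ->. Qed.

Lemma upper_slit_negative (x : R) : x < 0 -> upper_slit x%:C.
Proof. by move=> x0; rewrite /upper_slit /= eqxx x0 orbT. Qed.

Lemma krein_solution S :
  (forall z, upper_slit z -> analytic_at (reflect_ext S) z) ->
  (forall z, upper_half_plane z -> 0 < Im (S z)) ->
  (forall x : R, x < 0 -> Im (S x%:C) = 0 /\ Re (S x%:C) < 0) ->
  (forall e : R, 0 < e -> exists2 d, 0 < d &
     forall x, 0 < x -> x < d -> normc (S (- x)%:C) < e) ->
  krein (reflect_ext S).
Proof.
move=> an up neg lim; split.
  move=> z uz; have uz' := upper_slit_half_plane uz.
  by split; [exact: an | left; rewrite /reflect_ext uz'; exact: up].
exists (reflect_ext S); split=> //.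
- by move=> z /upper_slit_half_plane; exact: an.
- by move=> x /upper_slit_negative; exact: an.
- move=> x x0; have [i0 r0] := neg _ x0; exists (Re (S x%:C)); last exact: ltW.
  by rewrite /reflect_ext upper_slit_negative//; apply: complexP.
apply/cvgrPdist_lt => e; rewrite ltcE /= => /andP[/eqP e0 e1].
have [d d0 H] := lim _ e1; near=> x.
have x0 : 0 < x by near: x; exact: nbhs_right_gt.
have xd : x < d by near: x; exact: nbhs_right_lt.
rewrite sub0r normrN /reflect_ext upper_slit_negative ?oppr_lt0//.
by rewrite ltcE /= e0 eqxx /=; exact: H x0 xd.
Unshelve. all: by end_near.
Qed.

(** Dividing the two expressions of w1 w2, which are z K1(w1) and z K2(w2), by w1
    and by w2 gives the symmetric system. *)
Lemma subordination_solution z w1 w2 : upper_half_plane z ->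
  (@upper_half_plane R `|` @real_line R) w1 -> (@upper_half_plane R `|` @real_line R) w2 ->
  ~ nonneg_axis w1 -> ~ nonneg_axis w2 ->
  w1 * w2 = z * K_transform mu1 w1 -> K_transform mu1 w1 = K_transform mu2 w2 ->
  solution mu1 mu2 z w1 w2.
Proof.
move=> uz d1 d2 /slitP s1 /slitP s2.
have n0 w : slit w -> w != 0.
  by move=> sw; apply/eqP => w0; move: sw; rewrite w0 /slit /= eqxx ltxx.
have up w : (@upper_half_plane R `|` @real_line R) w -> slit w -> upper_slit w.
  move=> d sw; apply: slit_upper_slit => //; case: d => [/ltW//|[x _ <-]] /=.
  exact: lexx.
rewrite !K_transformE// => e1 e2; split; [exact: up|exact: up| |].
  by apply: (mulfI (n0 _ s1)); rewrite e1 mulrCA.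
by apply: (mulfI (n0 _ s2)); rewrite mulrC e1 e2 mulrCA.
Qed.

End SubordinationFunctions.

Theorem theorem2p4 (R : realType)
    (mu1 mu2 : probability (measurableTypeR R) R)
    (hmu1 : Mplus mu1) (hmu2 : Mplus mu2) :
  exists Z1 Z2 : R[i] -> R[i],
    subordination_pair mu1 mu2 Z1 Z2 /\
    forall Y1 Y2 : R[i] -> R[i], subordination_pair mu1 mu2 Y1 Y2 ->
      forall z, upper_half_plane z -> Y1 z = Z1 z /\ Y2 z = Z2 z.
Proof.
have ex z : exists w : R[i] * R[i], upper_slit z -> solution mu1 mu2 z w.1 w.2.
  have [uz|_] := boolP (upper_slit z); last by exists 0.
  by have [w1 [w2 sol]] := solution_exists hmu1 hmu2 uz; exists (w1, w2).
have [S HS] := choice ex.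
pose S1 z := (S z).1; pose S2 z := (S z).2.
have an z uz := @solution_analytic R mu1 mu2 hmu1 hmu2 S1 S2 z HS uz.
have up z : upper_half_plane z -> 0 < Im (S1 z) /\ 0 < Im (S2 z).
  by move=> uz; have uz' := upper_slit_half_plane uz;
    exact: (solution_upper hmu1 hmu2 uz' (HS _ uz') uz).
have neg (x : R) : x < 0 -> [/\ Im (S1 x%:C) = 0, Im (S2 x%:C) = 0,
    Re (S1 x%:C) < 0 & Re (S2 x%:C) < 0].
  move=> /upper_slit_negative ux.
  exact: (solution_real hmu1 hmu2 ux (HS _ ux) (erefl _)).
exists (reflect_ext S1), (reflect_ext S2); split; first split.
- apply: krein_solution => [z /an[]//|z /up[]//|x /neg[]//|e e0].
  have [d d0 H] := solution_small hmu1 hmu2 e0; exists d => // x x0 xd.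
  by apply: H (HS _ _) => //; apply: upper_slit_negative; rewrite oppr_lt0.
- apply: krein_solution => [z /an[]//|z /up[]//|x /neg[]//|e e0].
  have [d d0 H] := solution_small hmu2 hmu1 e0; exists d => // x x0 xd.
  apply: H (solution_sym (HS _ _)) => //.
  by apply: upper_slit_negative; rewrite oppr_lt0.
- move=> z /upper_slit_half_plane uz; rewrite /reflect_ext uz.
  have [u1 u2 e2 e1] := HS z uz.
  have s1 := upper_slit_slit u1; have s2 := upper_slit_slit u2.
  rewrite -/(S1 z) -/(S2 z) in s1 s2 e1 e2.
  split; [exact/slitP|exact/slitP| |].
    by rewrite K_transformE// mulrCA -e2.
  rewrite !K_transformE//; exact: (solution_K uz (HS z uz)).
move=> Y1 Y2 [[N1 _] [N2 _] HY] z uz; have uz' := upper_slit_half_plane uz.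
have [n1 n2 e1 e2] := HY _ uz; rewrite /reflect_ext uz'.
have sol : solution mu1 mu2 z (Y1 z) (Y2 z).
  by apply: subordination_solution => //; [exact: (N1 z uz).2 | exact: (N2 z uz).2].
exact: (solution_unique hmu1 hmu2 uz' sol (HS z uz')).
Qed.
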